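(* Let $\mathcal{H}_n(q)$ be semisimple, $\lambda\vdash n$, $\mu\vdash j$ with $\mu\subseteq\lambda$. Fix a basis $\kappa_\mu$ of $\{v\in S^\mu: v\,\mathcal{R}_j(q)=0\}$, let $u\in\kappa_\mu$ and $\mathfrak{t}\in\mathrm{SYT}(\lambda\setminus\mu)$. Then $u\,\Phi_{\mathfrak{t}}\,p_{\mathfrak{t}}\,\mathcal{C}^{(n)}_j$ belongs to $S^\lambda$ and is either zero or an eigenvector of $\mathcal{R}_n(q)$ (acting on the right) with eigenvalue $q^n\mathfrak{c}_{\lambda\setminus\mu}(q)+\sum_{k=j+1}^{n}q^{n-k}[k]_q$.
   Context: $\mathcal{H}_m(q)$ is the Type A Iwahori–Hecke algebra over $\mathbb{C}$ (generators $T_{s_i}$, relations $T_{s_i}^2=(q-1)T_{s_i}+q$, far commutation, braid), with $\mathcal{H}_{m'}(q)\subseteq\mathcal{H}_m(q)$ for $m'\le m$; semisimple iff $q\ne0$ and $q$ is not a primitive $k$-th root of unity, $2\le k\le m$. $\mathcal{B}_m(q)=\sum_{i=1}^mT_{s_{m-1}}\cdots T_{s_i}$, $\mathcal{B}^*_m(q)=\sum_{i=1}^mT_{s_i}\cdots T_{s_{m-1}}$, $\mathcal{R}_m(q)=\mathcal{B}^*_m(q)\mathcal{B}_m(q)$, $\mathcal{C}^{(n)}_j=\mathcal{B}_{j+1}(q)\cdots\mathcal{B}_n(q)$. $[k]_q=(1-q^k)/(1-q)$ interpreted as a Laurent polynomial. For $\nu\vdash m$, $W^\nu$ is the span of words $w_1\cdots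 w_m$ with $\nu_i$ letters $i$, with right action $\mathbf{w}T_{s_i}=q\mathbf{w}$ if $w_i=w_{i+1}$, $\mathbf{w}s_i$ if $w_i<w_{i+1}$, $q\mathbf{w}s_i+(q-1)\mathbf{w}$ if $w_i>w_{i+1}$ ($\mathbf{w}s_i$ swaps positions $i,i+1$). For a standard tableau $\mathfrak{t}$, $\mathrm{word}(\mathfrak{t})$ records in position $i$ the row of $i$. $J_k(q)=\sum_{i<k}q^{i-k}T_{(i,k)}$; $c_{\mathfrak{t},k}=$ column minus row of $k$ in $\mathfrak{t}$; $\mathfrak{C}(k)=\{d:-k<d<k\}$, minus $\{0\}$ when $k\in\{2,3\}$; $p_{\mathfrak{t}}=\prod_{k}\prod_{d\in\mathfrak{C}(k)\setminus\{c_{\mathfrak{t},k}\}}\frac{J_k(q)-[d]_q}{[c_{\mathfrak{t},k}]_q-[d]_q}$ for $\mathfrak{t}\in\mathrm{SYT}(\nu)$; $p_\nu=\sum_{\mathfrak{t}\in\mathrm{SYT}(\nu)}p_{\mathfrak{t}}$; $S^\nu=\mathrm{span}\{\mathrm{word}(\mathfrak{t})p_{\mathfrak{t}}:\mathfrak{t}\in\mathrm{SYT}(\nu)\}\subseteq W^\nu$. $\mathrm{SYT}(\lambda\setminus\mu)$ is the set of fillings of $\lambda\setminus\mu$ by $j+1,\dots,n$ increasing along rows and down columns. For such $\mathfrak{t}$ and $j\le k\le n$, $\lambda^{(k)}$ is $\mu$ together with the boxes of $\mathfrak{t}$ with entries $\le k$, and $p_{\mathfrak{t}}:=p_{\lambda^{(j+1)}}p_{\lambda^{(j+2)}}\cdots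 p_{\lambda^{(n)}}$. $\Phi_{\mathfrak{t}}:W^\mu\to W^\lambda$ sends $w_1\cdots w_j$ to $w_1\cdots w_n$ where, for $i>j$, $w_i$ is the row of $\mathfrak{t}$ containing $i$. $\mathfrak{c}_{\lambda\setminus\mu}(q)=\sum_{(a,b)\in\lambda\setminus\mu}[b-a]_q$ (row $a$, column $b$).
   Formalization: In p_t, factors whose denominator [c_{t,k}]_q − [d]_q vanishes are omitted: the displayed product is undefined there even when H_n(q) is semisimple (e.g. n=4, q a primitive 5th root of unity, t=(4), k=4, d=−2); otherwise p_t is unchanged. *)

(* Defs.v *)
From HB Require Import structures.
From mathcomp Require Import all_boot all_order all_algebra perm.
From mathcomp Require Import ring zify.
From mathcomp Require Import boolp reals complex.
Set Implicit Arguments.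
Unset Strict Implicit.
Unset Printing Implicit Defensive.
Import Order.TTheory GRing.Theory Num.Theory.
Local Open Scope ring_scope.
Local Open Scope quotient_scope.

(* Generators T_i are indexed by 1 <= i <= n-1. *)
Definition gidx (n : nat) := {i : nat | (0 < i < n)%N}.

Inductive hterm (F : Type) (n : nat) : Type :=
| HGen of gidx n
| HZero | HOne
| HAdd of hterm F n & hterm F n
| HOpp of hterm F n
| HMul of hterm F n & hterm F n
| HScale of F & hterm F n.
Arguments HZero {F n}.
Arguments HOne {F n}.
Arguments HGen {F n} _.

HB.instance Definition _ (F : Type) (n : nat) := gen_eqMixin (hterm F n).
HB.instance Definition _ (F : Type) (n : nat) := gen_choiceMixin (hterm F n).

(* The least congruence on terms containing the axioms of unital associative
   F-algebras and the Iwahori-Hecke relations. *)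
Inductive heq (F : fieldType) (q : F) (n : nat) :
    hterm F n -> hterm F n -> Prop :=
| heq_refl x : heq q x x
| heq_sym x y : heq q x y -> heq q y x
| heq_trans x y z : heq q x y -> heq q y z -> heq q x z
| heq_add x x' y y' : heq q x x' -> heq q y y' ->
    heq q (HAdd x y) (HAdd x' y')
| heq_opp x x' : heq q x x' -> heq q (HOpp x) (HOpp x')
| heq_mul x x' y y' : heq q x x' -> heq q y y' ->
    heq q (HMul x y) (HMul x' y')
| heq_scale c x x' : heq q x x' -> heq q (HScale c x) (HScale c x')
| heq_addA x y z : heq q (HAdd x (HAdd y z)) (HAdd (HAdd x y) z)
| heq_addC x y : heq q (HAdd x y) (HAdd y x)
| heq_add0 x : heq q (HAdd HZero x) x
| heq_addN x : heq q (HAdd (HOpp x) x) HZero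
| heq_mulA x y z : heq q (HMul x (HMul y z)) (HMul (HMul x y) z)
| heq_mul1l x : heq q (HMul HOne x) x
| heq_mul1r x : heq q (HMul x HOne) x
| heq_mulDl x y z : heq q (HMul (HAdd x y) z) (HAdd (HMul x z) (HMul y z))
| heq_mulDr x y z : heq q (HMul x (HAdd y z)) (HAdd (HMul x y) (HMul x z))
| heq_scaleA a b x : heq q (HScale a (HScale b x)) (HScale (a * b) x)
| heq_scale1 x : heq q (HScale 1 x) x
| heq_scaleDr a x y :
    heq q (HScale a (HAdd x y)) (HAdd (HScale a x) (HScale a y))
| heq_scaleDl a b x :
    heq q (HScale (a + b) x) (HAdd (HScale a x) (HScale b x))
| heq_scaleAl a x y : heq q (HScale a (HMul x y)) (HMul (HScale a x) y)
| heq_scaleAr a x y : heq q (HScale a (HMul x y)) (HMul x (HScale a y))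
| heq_quad (i : gidx n) :
    heq q (HMul (HGen i) (HGen i))
          (HAdd (HScale (q - 1) (HGen i)) (HScale q HOne))
| heq_far (i j : gidx n) : ((val i).+1 < val j)%N ->
    heq q (HMul (HGen i) (HGen j)) (HMul (HGen j) (HGen i))
| heq_braid (i j : gidx n) : val j = (val i).+1 ->
    heq q (HMul (HMul (HGen i) (HGen j)) (HGen i))
          (HMul (HMul (HGen j) (HGen i)) (HGen j)).

Section Hecke.
Context (F : fieldType) (q : F) (n : nat).

Definition heqb (x y : hterm F n) : bool := `[< heq q x y >].

Lemma heqb_refl : reflexive heqb.
Proof. by move=> x; apply/asboolP; apply: heq_refl. Qed.
Lemma heqb_sym : symmetric heqb.
Proof. by move=> x y; apply/asboolP/asboolP; apply: heq_sym. Qed.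
Lemma heqb_trans : transitive heqb.
Proof.
by move=> y x z /asboolP xy /asboolP yz; apply/asboolP; apply: heq_trans yz.
Qed.

Definition heq_equiv := EquivRel heqb heqb_refl heqb_sym heqb_trans.

Definition hecke := {eq_quot heq_equiv}.
HB.instance Definition _ := Choice.on hecke.
HB.instance Definition _ := EqQuotient.on hecke.

Lemma hpiP (x y : hterm F n) :
  (\pi_hecke x = \pi_hecke y) <-> heq q x y.
Proof.
by split=> [/eqP|xy]; [rewrite eqmodE => /asboolP|
  apply/eqP; rewrite eqmodE; apply/asboolP].
Qed.

Lemma hrepr (x : hterm F n) : heq q (repr (\pi_hecke x)) x.
Proof. by apply/hpiP; rewrite reprK. Qed.

Definition hadd (x y : hecke) : hecke := \pi_hecke (HAdd (repr x) (repr y)).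
Definition hopp (x : hecke) : hecke := \pi_hecke (HOpp (repr x)).
Definition hmul (x y : hecke) : hecke := \pi_hecke (HMul (repr x) (repr y)).
Definition hscale (c : F) (x : hecke) : hecke := \pi_hecke (HScale c (repr x)).

Lemma hadd_pi x y : hadd (\pi_hecke x) (\pi_hecke y) = \pi_hecke (HAdd x y).
Proof. by apply/hpiP; apply: heq_add; apply: hrepr. Qed.
Lemma hopp_pi x : hopp (\pi_hecke x) = \pi_hecke (HOpp x).
Proof. by apply/hpiP; apply: heq_opp; apply: hrepr. Qed.
Lemma hmul_pi x y : hmul (\pi_hecke x) (\pi_hecke y) = \pi_hecke (HMul x y).
Proof. by apply/hpiP; apply: heq_mul; apply: hrepr. Qed.
Lemma hscale_pi c x : hscale c (\pi_hecke x) = \pi_hecke (HScale c x).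
Proof. by apply/hpiP; apply: heq_scale; apply: hrepr. Qed.

Lemma haddA : associative hadd.
Proof.
elim/quotW=> x; elim/quotW=> y; elim/quotW=> z.
by rewrite (hadd_pi y) (hadd_pi x y) !hadd_pi; apply/hpiP; apply: heq_addA.
Qed.
Lemma haddC : commutative hadd.
Proof. by elim/quotW=> x; elim/quotW=> y; rewrite !hadd_pi; apply/hpiP; apply: heq_addC. Qed.
Lemma hadd0 : left_id (\pi_hecke HZero) hadd.
Proof. by elim/quotW=> x; rewrite hadd_pi; apply/hpiP; apply: heq_add0. Qed.
Lemma haddN : left_inverse (\pi_hecke HZero) hopp hadd.
Proof. by elim/quotW=> x; rewrite hopp_pi hadd_pi; apply/hpiP; apply: heq_addN. Qed.

HB.instance Definition _ := GRing.isZmodule.Build hecke haddA haddC hadd0 haddN.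

Lemma hmulA : associative hmul.
Proof.
elim/quotW=> x; elim/quotW=> y; elim/quotW=> z.
by rewrite (hmul_pi y) (hmul_pi x y) !hmul_pi; apply/hpiP; apply: heq_mulA.
Qed.
Lemma hmul1l : left_id (\pi_hecke HOne) hmul.
Proof. by elim/quotW=> x; rewrite hmul_pi; apply/hpiP; apply: heq_mul1l. Qed.
Lemma hmul1r : right_id (\pi_hecke HOne) hmul.
Proof. by elim/quotW=> x; rewrite hmul_pi; apply/hpiP; apply: heq_mul1r. Qed.
Lemma hmulDl : left_distributive hmul hadd.
Proof.
elim/quotW=> x; elim/quotW=> y; elim/quotW=> z.
by rewrite (hadd_pi x) (hmul_pi x) (hmul_pi y) hmul_pi hadd_pi; apply/hpiP; apply: heq_mulDl.
Qed.
Lemma hmulDr : right_distributive hmul hadd.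
Proof.
elim/quotW=> x; elim/quotW=> y; elim/quotW=> z.
by rewrite (hadd_pi y) (hmul_pi x y) (hmul_pi x z) hmul_pi hadd_pi; apply/hpiP; apply: heq_mulDr.
Qed.

HB.instance Definition _ :=
  GRing.Zmodule_isPzRing.Build hecke hmulA hmul1l hmul1r hmulDl hmulDr.

(* T_i |-> q is a one-dimensional representation, so [hecke] is nontrivial. *)
Fixpoint heval (x : hterm F n) : F :=
  match x with
  | HGen _ => q
  | HZero => 0
  | HOne => 1
  | HAdd x y => heval x + heval y
  | HOpp x => - heval x
  | HMul x y => heval x * heval y
  | HScale c x => c * heval x
  end.

Lemma heval_heq x y : heq q x y -> heval x = heval y.
Proof.
elim=> /= *; try by [congruence | ring].
Qed.

Lemma hone_neq0 : (1 : hecke) != 0.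
Proof.
apply/eqP => /hpiP/heval_heq /= /eqP; apply/negP; exact: oner_neq0.
Qed.
HB.instance Definition _ := GRing.PzSemiRing_isNonZero.Build hecke hone_neq0.

Lemma hscaleA a b v : hscale a (hscale b v) = hscale (a * b) v.
Proof. by elim/quotW: v => x; rewrite (hscale_pi b) !hscale_pi; apply/hpiP; apply: heq_scaleA. Qed.
Lemma hscale1 : left_id 1 hscale.
Proof. by elim/quotW=> x; rewrite hscale_pi; apply/hpiP; apply: heq_scale1. Qed.
Lemma hscaleDr : right_distributive hscale +%R.
Proof.
move=> a; elim/quotW=> x; elim/quotW=> y.
by rewrite /GRing.add /= (hadd_pi x) (hscale_pi a x) (hscale_pi a y) hscale_pi hadd_pi; apply/hpiP; apply: heq_scaleDr.
Qed.
Lemma hscaleDl v : {morph hscale^~ v : a b / a + b}.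
Proof.
elim/quotW: v => x a b.
by rewrite [RHS]/GRing.add /= (hscale_pi a) (hscale_pi b) hscale_pi hadd_pi; apply/hpiP; apply: heq_scaleDl.
Qed.

HB.instance Definition _ :=
  GRing.Zmodule_isLmodule.Build F hecke hscaleA hscale1 hscaleDr hscaleDl.

Lemma hscaleAl a (x y : hecke) : a *: (x * y) = (a *: x) * y.
Proof.
elim/quotW: x => x; elim/quotW: y => y.
by rewrite /GRing.mul /GRing.scale /= (hmul_pi x) (hscale_pi a x) hmul_pi hscale_pi; apply/hpiP; apply: heq_scaleAl.
Qed.
HB.instance Definition _ :=
  GRing.LSemiModule_isLSemiAlgebra.Build F hecke hscaleAl.

Lemma hscaleAr a (x y : hecke) : a *: (x * y) = x * (a *: y).
Proof.
elim/quotW: x => x; elim/quotW: y => y.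
by rewrite /GRing.mul /GRing.scale /= (hmul_pi x) (hscale_pi a y) hmul_pi hscale_pi; apply/hpiP; apply: heq_scaleAr.
Qed.
HB.instance Definition _ :=
  GRing.LSemiAlgebra_isSemiAlgebra.Build F hecke hscaleAr.

(* T_{s_i} for 1 <= i <= n-1 (and, by convention, 0 for other i). *)
Definition Tgen (i : nat) : hecke :=
  if (insub i : option (gidx n)) is Some j then \pi_hecke (HGen j) else 0.

End Hecke.

(* A word w_1 ... w_m is a function on positions; the 0-based position p : 'I_m
   holds the letter w_{p+1}.  Letters are 1, ..., N; letter 0 is never used. *)
Definition word (N m : nat) := {ffun 'I_m -> 'I_N.+1}.

(* Formal linear combinations of words of length m: the direct sum of the
   modules W^nu over all contents nu, each W^nu being spanned by the words of
   content nu. *)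
Definition words (F : fieldType) (N m : nat) := {ffun word N m -> F^o}.

Section Action.
Context (F : fieldType) (q : F) (N m : nat).
Local Notation word := (word N m).
Local Notation W := (words F N m).
HB.instance Definition _ := GRing.Lmodule.on W.
HB.instance Definition _ := Vector.on W.

Definition wbase (w : word) : W := [ffun w' => (w' == w)%:R].

(* The positions of w_i and w_{i+1}. *)
Lemma lo_subproof (i : gidx m) : ((val i).-1 < m)%N.
Proof. by case: i => i /= /andP[]; lia. Qed.
Lemma hi_subproof (i : gidx m) : (val i < m)%N.
Proof. by case: i => i /= /andP[]. Qed.
Definition lo (i : gidx m) : 'I_m := Ordinal (lo_subproof i).
Definition hi (i : gidx m) : 'I_m := Ordinal (hi_subproof i).

Definition wswap (i : gidx m) (w : word) : word :=
  [ffun p => w (tperm (lo i) (hi i) p)].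

Definition wgen (i : gidx m) (w : word) : W :=
  if w (lo i) == w (hi i) then q *: wbase w
  else if (w (lo i) < w (hi i))%N then wbase (wswap i w)
  else q *: wbase (wswap i w) + (q - 1) *: wbase w.

Definition act_gen (i : gidx m) (v : W) : W := \sum_w v w *: wgen i w.

Fixpoint act_term (x : hterm F m) (v : W) : W :=
  match x with
  | HGen i => act_gen i v
  | HZero => 0
  | HOne => v
  | HAdd x y => act_term x v + act_term y v
  | HOpp x => - act_term x v
  | HMul x y => act_term y (act_term x v)
  | HScale c x => c *: act_term x v
  end.

Definition act (v : W) (x : hecke q m) : W := act_term (repr x) v.

Lemma act_gen_is_linear i : linear (act_gen i).
Proof.
move=> a u v; rewrite /act_gen scaler_sumr -big_split /=.
by apply: eq_bigr => w _; rewrite !ffunE scalerDl scalerA.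
Qed.
HB.instance Definition _ i :=
  GRing.isLinear.Build F W W _ (act_gen i) (act_gen_is_linear i).

Lemma act_genD i u v : act_gen i (u + v) = act_gen i u + act_gen i v.
Proof. exact: linearD. Qed.
Lemma act_genZ i c v : act_gen i (c *: v) = c *: act_gen i v.
Proof. exact: linearZ. Qed.

Lemma wbase_sum (v : W) : v = \sum_w v w *: wbase w.
Proof.
apply/ffunP => w; rewrite sum_ffunE (bigD1 w) //= big1 => [|w' ne].
  by rewrite !ffunE eqxx addr0 /GRing.scale /= mulr1.
by rewrite !ffunE eq_sym (negPf ne) /GRing.scale /= mulr0.
Qed.

Lemma act_gen_base i w : act_gen i (wbase w) = wgen i w.
Proof.
rewrite /act_gen (bigD1 w) //= big1 => [|w' ne].
  by rewrite !ffunE eqxx addr0 scale1r.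
by rewrite !ffunE (negPf ne) scale0r.
Qed.

Lemma linear_ext (f g : {linear W -> W}) :
  (forall w, f (wbase w) = g (wbase w)) -> f =1 g.
Proof.
move=> fg v; rewrite (wbase_sum v) !linear_sum; apply: eq_bigr => w _.
by rewrite !linearZ /= fg.
Qed.

Lemma act_term_is_linear x : linear (act_term x).
Proof.
elim: x => [i|||x IHx y IHy|x IHx|x IHx y IHy|c x IHx] a u v /=.
- exact: act_gen_is_linear.
- by rewrite scaler0 addr0.
- by [].
- by rewrite IHx IHy scalerDr addrACA.
- by rewrite IHx scalerN opprD.
- by rewrite IHx IHy.
- by rewrite IHx scalerDr !scalerA mulrC.
Qed.
HB.instance Definition _ x :=
  GRing.isLinear.Build F W W _ (act_term x) (act_term_is_linear x).

Lemma lo_neq_hi i : lo i != hi i.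
Proof. by rewrite -val_eqE /=; case: i => i /= /andP[]; lia. Qed.

Lemma wswap_lo i w : wswap i w (lo i) = w (hi i).
Proof. by rewrite ffunE tpermL. Qed.
Lemma wswap_hi i w : wswap i w (hi i) = w (lo i).
Proof. by rewrite ffunE tpermR. Qed.
Lemma wswap_out i w p : p != lo i -> p != hi i -> wswap i w p = w p.
Proof. by move=> pl ph; rewrite ffunE tpermD // eq_sym. Qed.
Lemma wswapK i w : wswap i (wswap i w) = w.
Proof. by apply/ffunP => p; rewrite !ffunE tpermK. Qed.

Lemma act_gen_quad i v :
  act_gen i (act_gen i v) = (q - 1) *: act_gen i v + q *: v.
Proof.
have E : act_term (HMul (HGen i) (HGen i)) =1
  act_term (HAdd (HScale (q - 1) (HGen i)) (HScale q HOne)).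
  apply: linear_ext => w /=; rewrite act_gen_base /wgen.
  case: ifP => e1; last case: ifP => e2.
  - rewrite linearZ /= act_gen_base /wgen e1 !scalerA -scalerDl.
    by congr (_ *: _); ring.
  - by rewrite act_gen_base /wgen wswap_lo wswap_hi wswapK eq_sym e1 ltnNge
       (ltnW e2) /= addrC.
  - rewrite linearD !linearZ /= !act_gen_base /wgen wswap_lo wswap_hi wswapK.
    have e3 : (w (hi i) < w (lo i))%N.
      by move: e1 e2; rewrite -val_eqE /=; lia.
    by rewrite eq_sym e1 e3 e2 addrC.
exact: E.
Qed.

Ltac split_eq :=
  repeat match goal with |- context [?a == ?b] =>
    lazymatch a with context [if _ then _ else _] => fail
    | _ => case: (a =P b) => ? //= end
  end.

Lemma act_gen_far i j v : ((val i).+1 < val j)%N ->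
  act_gen j (act_gen i v) = act_gen i (act_gen j v).
Proof.
move=> lt_ij.
have E : act_term (HMul (HGen i) (HGen j)) =1
         act_term (HMul (HGen j) (HGen i)).
  have [n1 n2 n3 n4] : [/\ lo i != lo j, lo i != hi j, hi i != lo j
                         & hi i != hi j].
    by rewrite -!val_eqE /=; case: i j lt_ij => i /= ? [j /= ?]; split; lia.
  have sw w : wswap i (wswap j w) = wswap j (wswap i w).
    apply/ffunP => p; rewrite !ffunE.
    congr (w _); move: (lo_neq_hi i) (lo_neq_hi j) n1 n2 n3 n4.
    move=> /eqP ? /eqP ? /eqP ? /eqP ? /eqP ? /eqP ?.
    by rewrite !permE /=; split_eq; congruence.
  have s1 w : wswap i w (lo j) = w (lo j) by rewrite wswap_out // eq_sym.
  have s2 w : wswap i w (hi j) = w (hi j) by rewrite wswap_out // eq_sym.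
  have s3 w : wswap j w (lo i) = w (lo i) by rewrite wswap_out.
  have s4 w : wswap j w (hi i) = w (hi i) by rewrite wswap_out.
  apply: linear_ext => w /=; rewrite !act_gen_base /wgen.
  case e1: (w (lo i) == w (hi i)); case e2: (w (lo j) == w (hi j));
  case l1: (w (lo i) < w (hi i))%N; case l2: (w (lo j) < w (hi j))%N;
  rewrite ?act_genD ?act_genZ !act_gen_base /wgen
    ?(s1, s2, s3, s4, e1, e2, l1, l2) ?sw;
  move: (wbase w) (wbase (wswap i w)) (wbase (wswap j w));
  move: (wbase (wswap j (wswap i w))) => b1 b2 b3 b4;
  apply/ffunP => x; rewrite ?ffunE /GRing.scale /=; ring.
exact: E.
Qed.

Lemma act_gen_braid i j v : val j = (val i).+1 ->
  act_gen i (act_gen j (act_gen i v)) = act_gen j (act_gen i (act_gen j v)).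
Proof.
move=> ij.
have E : act_term (HMul (HMul (HGen i) (HGen j)) (HGen i)) =1
         act_term (HMul (HMul (HGen j) (HGen i)) (HGen j)).
{ have hl : hi i = lo j by apply: val_inj => /=; rewrite ij.
  have lh : lo i != hi j.
    by rewrite -!val_eqE /=; case: i j ij {hl} => i /= ? [j /= ?]; lia.
  have ni := lo_neq_hi i; have nj := lo_neq_hi j; rewrite hl in ni.
  have s1 (w : word) : wswap i w (lo i) = w (lo j) by rewrite wswap_lo hl.
  have s2 (w : word) : wswap i w (lo j) = w (lo i) by rewrite -hl wswap_hi.
  have s3 (w : word) : wswap i w (hi j) = w (hi j).
    by rewrite wswap_out // ?hl eq_sym.
  have s4 (w : word) : wswap j w (lo i) = w (lo i) by rewrite wswap_out.
  have s5 (w : word) : wswap j w (lo j) = w (hi j) by rewrite wswap_lo.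
  have s6 (w : word) : wswap j w (hi j) = w (lo j) by rewrite wswap_hi.
  have sw (w : word) : wswap i (wswap j (wswap i w)) = wswap j (wswap i (wswap j w)).
    apply/ffunP => p; rewrite !ffunE hl.
    congr (w _); move: lh ni nj => /eqP ? /eqP ? /eqP ?.
    by rewrite !permE /=; split_eq; congruence.
  have lt_rw (x y : nat) : (x < y)%N ->
      ((x == y) = false) * ((y == x) = false) * ((x < y)%N = true)
      * ((y < x)%N = false).
    by move=> xy; do !split; lia.
  have eq_rw (x y : nat) : x = y ->
      ((x == y) = true) * ((y == x) = true) * ((x < y)%N = false)
      * ((y < x)%N = false).
    by move=> xy; do !split; lia.
  have wgi (w' : word) : wgen i w' =
      if w' (lo i) == w' (lo j) :> nat then q *: wbase w'
      else if (w' (lo i) < w' (lo j))%N then wbase (wswap i w')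
      else q *: wbase (wswap i w') + (q - 1) *: wbase w' by rewrite -hl.
  have wgj (w' : word) : wgen j w' =
      if w' (lo j) == w' (hi j) :> nat then q *: wbase w'
      else if (w' (lo j) < w' (hi j))%N then wbase (wswap j w')
      else q *: wbase (wswap j w') + (q - 1) *: wbase w' by [].
  apply: linear_ext => w /=; rewrite !act_gen_base.
  have [ab|ab|ab] := ltngtP (w (lo i)) (w (lo j));
  have [bc|bc|bc] := ltngtP (w (lo j)) (w (hi j));
  have [ac|ac|ac] := ltngtP (w (lo i)) (w (hi j)).
  all: try by exfalso; clear -ab bc ac; lia.
  all: clear lh nj ni hl ij.
  all: first [move/lt_rw: ab => ab | move/eq_rw: ab => ab].
  all: first [move/lt_rw: bc => bc | move/eq_rw: bc => bc].
  all: first [move/lt_rw: ac => ac | move/eq_rw: ac => ac].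
  all: rewrite (wgi w) (wgj w) ?ab ?bc /=.
  all: rewrite ?(act_genD, act_genZ) ?act_gen_base ?(wgi, wgj).
  all: rewrite ?(s1, s2, s3, s4, s5, s6) ?ab ?bc ?ac /=.
  all: rewrite ?(act_genD, act_genZ) ?act_gen_base ?(wgi, wgj).
  all: rewrite ?(s1, s2, s3, s4, s5, s6) ?ab ?bc ?ac /=.
  all: rewrite ?sw ?wswapK.
  all: move: (wbase w) (wbase (wswap i w)) (wbase (wswap j w)).
  all: move: (wbase (wswap i (wswap j w))) (wbase (wswap j (wswap i w))).
  all: move: (wbase (wswap j (wswap i (wswap j w)))) => b1 b2 b3 b4 b5 b6.
  all: clear; apply/ffunP => x; rewrite ?ffunE /GRing.scale /=; ring.
}
exact: E.
Qed.

Lemma act_term_heq x y : heq q x y -> act_term x =1 act_term y.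
Proof.
elim=> {x y} /=.
- by [].
- by move=> x y _ e v; rewrite e.
- by move=> x y z _ e1 _ e2 v; rewrite e1 e2.
- by move=> x x' y y' _ e1 _ e2 v; rewrite e1 e2.
- by move=> x x' _ e v; rewrite e.
- by move=> x x' y y' _ e1 _ e2 v; rewrite e1 e2.
- by move=> c x x' _ e v; rewrite e.
- by move=> x y z v; rewrite addrA.
- by move=> x y v; rewrite addrC.
- by move=> x v; rewrite add0r.
- by move=> x v; rewrite addNr.
- by [].
- by [].
- by [].
- by move=> x y z v; rewrite linearD.
- by [].
- by move=> a b x v; rewrite scalerA.
- by move=> x v; rewrite scale1r.
- by move=> a x y v; rewrite scalerDr.
- by move=> a b x v; rewrite scalerDl.
- by move=> a x y v; rewrite linearZ.
- by [].
- by move=> i v; rewrite act_gen_quad.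
- by move=> i j ij v; rewrite act_gen_far.
- by move=> i j ij v; rewrite act_gen_braid.
Qed.

Lemma act_pi v x : act v (\pi_(hecke q m) x) = act_term x v.
Proof. exact: act_term_heq (hrepr q x) v. Qed.

Lemma act1 v : act v 1 = v.
Proof. exact: act_pi v HOne. Qed.

Lemma actM v (x y : hecke q m) : act v (x * y) = act (act v x) y.
Proof. exact: act_pi v (HMul (repr x) (repr y)). Qed.

Lemma actD v (x y : hecke q m) : act v (x + y) = act v x + act v y.
Proof. exact: act_pi v (HAdd (repr x) (repr y)). Qed.

Lemma actZ v c (x : hecke q m) : act v (c *: x) = c *: act v x.
Proof. exact: act_pi v (HScale c (repr x)). Qed.

Lemma actT (i : gidx m) v : act v (Tgen q m (val i)) = act_gen i v.
Proof. by rewrite /Tgen valK act_pi. Qed.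

End Action.

Definition actr (F : fieldType) (q : F) (N m : nat) (x : hecke q m)
  (v : words F N m) : words F N m := act v x.

Lemma actr_is_linear (F : fieldType) (q : F) (N m : nat) (x : hecke q m) :
  linear (@actr F q N m x).
Proof. exact: act_term_is_linear. Qed.
HB.instance Definition _ (F : fieldType) (q : F) (N m : nat) (x : hecke q m) :=
  GRing.isLinear.Build F (words F N m) (words F N m) _ (@actr F q N m x)
    (@actr_is_linear F q N m x).

(* [k]_q = (1 - q^k) / (1 - q) as a Laurent polynomial in q. *)
Definition qint (F : fieldType) (q : F) (k : int) : F :=
  match k with
  | Posz m => \sum_(0 <= i < m) q ^+ i
  | Negz m => - \sum_(1 <= i < m.+2) q ^- i
  end.

Section Elements.
Context (F : fieldType) (q : F) (n : nat).
Local Notation H := (hecke q n).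
Local Notation T := (Tgen q n).

(* The inclusion of H_m(q) in H_n(q), m <= n, maps T_{s_i} to T_{s_i}; the
   elements below belong to H_m(q) and are written in H_n(q). *)

Definition Bop (m : nat) : H :=
  \sum_(1 <= i < m.+1) \prod_(l <- rev (index_iota i m)) T l.
Definition Bstar (m : nat) : H :=
  \sum_(1 <= i < m.+1) \prod_(i <= l < m) T l.
Definition R2R (m : nat) : H := Bstar m * Bop m.
Definition Cop (j r : nat) : H := \prod_(j.+1 <= m < r.+1) Bop m.

(* T_w for the transposition w = (i, k), i < k, via the reduced expression
   s_i s_{i+1} ... s_{k-1} s_{k-2} ... s_i. *)
Definition Ttransp (i k : nat) : H :=
  (\prod_(i <= l < k) T l) * (\prod_(l <- rev (index_iota i k.-1)) T l).

Definition JM (k : nat) : H := \sum_(1 <= i < k) q ^- (k - i) *: Ttransp i k.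

End Elements.

(* -k < d < k, without 0 when k is 2 or 3. *)
Definition contents (k : nat) : seq int :=
  [seq d <- [seq (e%:Z - k.-1%:Z)%R | e <- iota 0 k.*2.-1]
     | (d == 0) ==> (k \notin [:: 2; 3]%N)].

Definition is_partition (n : nat) (s : seq nat) : bool :=
  [&& sorted geq s, 0%N \notin s & sumn s == n].

(* A box is (row, column), both counted from 1.  N has to be an upper bound
   for all rows, columns and entries that occur. *)
Definition box (N : nat) := ('I_N.+1 * 'I_N.+1)%type.

Definition ydiag (N : nat) (s : seq nat) : {set box N} :=
  [set x : box N | (0 < x.1)%N && (0 < x.2 <= nth 0%N s x.1.-1)%N].

(* The entry 0 marks the boxes outside the shape. *)
Definition filling (N : nat) := {ffun box N -> 'I_N.+1}.

(* Fillings of the boxes in D by j+1, ..., n, each used once, increasing along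
   rows and down columns. *)
Definition SYT (N : nat) (D : {set box N}) (j n : nat) : {set filling N} :=
  [set t : filling N |
    [&& [forall x, if x \in D then (j < t x <= n)%N else t x == 0%N :> nat],
        [forall k : 'I_N.+1, (j < k <= n)%N ==> (#|[set x | t x == k]| == 1%N)],
        [forall x in D, forall y in D,
           (x.1 == y.1) && (x.2 < y.2)%N ==> (t x < t y)%N]
      & [forall x in D, forall y in D,
           (x.2 == y.2) && (x.1 < y.1)%N ==> (t x < t y)%N]]].

Section Tableaux.
Context (N : nat).
Implicit Types (t : filling N) (D : {set box N}).

Definition box_of t (k : nat) : box N :=
  odflt (ord0, ord0) [pick x | t x == k :> nat].
Definition row_of t (k : nat) : 'I_N.+1 := (box_of t k).1.
Definition content_of t (k : nat) : int :=
  (box_of t k).2%:Z - (box_of t k).1%:Z.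

Definition word_of t (m : nat) : word N m := [ffun p : 'I_m => row_of t p.+1].

(* lambda^(k), for t a filling of lambda \ mu and D the diagram of mu. *)
Definition shape_upto D t (k : nat) : {set box N} :=
  D :|: [set x | (0 < t x <= k)%N].

Section Projectors.
Context (F : fieldType) (q : F) (n : nat).

(* p_t for a standard tableau t with m boxes.  Even when H_n(q) is semisimple,
   [c]_q = [d]_q can happen for contents c <> d of [contents k]: |c - d| can
   reach 2k - 2, and q may be a root of unity of order between n + 1 and
   2n - 2.  The corresponding factor of the usual product then has a zero
   denominator and is omitted, which gives the specialisation at q of the
   generic p_t; when all denominators are nonzero nothing is omitted. *)
Definition ptab t (m : nat) : hecke q n :=
  \prod_(1 <= k < m.+1)
    \prod_(d <- contents k | (d != content_of t k) &&
                             (qint q (content_of t k) - qint q d != 0))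
      ((qint q (content_of t k) - qint q d)^-1 *: (JM q n k - (qint q d)%:A)).

(* p_nu, for nu the shape with diagram D and m boxes. *)
Definition pshape D (m : nat) : hecke q n :=
  \sum_(t in SYT D 0 m) ptab t m.

(* p_t for a filling t of lambda \ mu, D the diagram of mu and |mu| = j. *)
Definition pskew D (j : nat) t : hecke q n :=
  \prod_(j.+1 <= k < n.+1) pshape (shape_upto D t k) k.

End Projectors.

(* S^nu, for nu the shape with diagram D and m boxes. *)
Definition specht (F : fieldType) (q : F) (m : nat) D : {vspace words F N m} :=
  <<[seq act (wbase F (word_of t m)) (ptab q m t m)
      | t <- enum (SYT D 0 m)]>>%VS.

(* w_1 ... w_j |-> w_1 ... w_n, w_i being the row of i in t for i > j. *)
Definition wext t (j n : nat) (w : word N j) : word N n :=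
  [ffun p : 'I_n => if (insub (val p) : option 'I_j) is Some p' then w p'
                    else row_of t p.+1].

Definition Phi (F : fieldType) t (j n : nat) (v : words F N j) : words F N n :=
  \sum_w v w *: wbase F (wext t n w).

End Tableaux.

(* The content sum of lambda \ mu, D being its set of boxes. *)
Definition qcontent (F : fieldType) (q : F) (N : nat) (D : {set box N}) : F :=
  \sum_(x in D) qint q (x.2%:Z - x.1%:Z).

Definition right_ideal (A : pzRingType) (I : A -> Prop) : Prop :=
  [/\ I 0, forall x y, I x -> I y -> I (x + y)
    & forall x a, I x -> I (x * a)].

(* The right regular module is semisimple: every submodule is a summand. *)
Definition semisimple (A : pzRingType) : Prop :=
  forall I : A -> Prop, right_ideal I ->
    exists J : A -> Prop, [/\ right_ideal J,
      forall x, I x -> J x -> x = 0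
    & forall x, exists y z, [/\ I y, J z & x = y + z]].

(* Main.v *)
Require Import Defs.
From HB Require Import structures.
From mathcomp Require Import all_boot all_order all_algebra.
From mathcomp Require Import perm ring zify.
From mathcomp Require Import reals complex.
Set Implicit Arguments.
Unset Strict Implicit.
Unset Printing Implicit Defensive.
Import Order.TTheory GRing.Theory Num.Theory.
Local Open Scope ring_scope.
Local Open Scope complex_scope.

(* By semisimplicity [k]_q <> 0 for 0 < k <= n: the q-symmetrizer e satisfies
   e^2 = [n]_q! e, and a nonzero right ideal of square zero has no complement.
   The p_t are then orthogonal projectors onto joint eigenspaces of the
   Jucys-Murphy elements, and p_nu commutes with H_m(q).  The key relation
     B_m R_m = (q R_(m-1) + [m]_q + q^m J_m) B_m,
   together with p_(lambda^(m-1)) p_(lambda^(m)) J_m = [c] p_(lambda^(m-1)) p_(lambda^(m)),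
   c the content of the box m, makes B_m map an eigenvector of R_(m-1) to one of
   R_m, with eigenvalue q eps + [m]_q + q^m [c]_q.  Membership in S^lambda follows
   from W^lambda p_lambda = S^lambda, by straightening words to sorted ones, on
   which all but one p_t vanish.  When j > n the fillings of mu are truncated
   and S^mu is zero. *)

(** Everything rests on the spectrum of the Jucys-Murphy elements in the right regular module. Joint
    right eigenvectors whose eigenvalues are the contents of a tableau serve as weight vectors, and
    [spectral] confines the next Jucys-Murphy element to the contents of the addable boxes. In its
    induction the square of an intertwiner yields candidate eigenvalues; those that belong to no
    addable box are refuted by the quadratic and braid relations. Hence 1 is a sum of weight
    vectors, and an identity in the algebra may be tested on them: the seminormal form and all rules
    for products of projectors are obtained so. The obstacle is that q may be a root of unity of
    order slightly above n, so that [c]_q separates contents only up to distance n. Two addable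
    boxes of a shape with m boxes have contents at distance between 2 and m + 1: the upper bound
    makes separation possible, and the lower bound shows that a content adjacent to that of an
    addable box belongs to no addable box. Tableaux are encoded by the rows of 1, 2, ...: a shape
    becomes a family of letter counts, and exchanging consecutive entries exchanges neighbouring
    letters. *)

Section QInt.
Context (F : fieldType) (q : F).
Hypothesis q_neq0 : q != 0.

Lemma qint0 : qint q 0 = 0.
Proof. by rewrite -[0]/(Posz 0) /qint big_geq. Qed.

Lemma qintD1 (d : int) : qint q (d + 1) = q * qint q d + 1.
Proof.
case: d => [m|[|m]].
- have -> : Posz m + 1 = Posz m.+1 by lia.
  rewrite /qint big_nat_recl // expr0 addrC mulr_sumr.
  by congr (_ + 1); apply: eq_bigr => i _; rewrite exprS.
- have -> : Negz 0 + 1 = 0 by lia.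
  by rewrite qint0 /qint big_nat1 expr1 mulrN mulfV // addNr.
have -> : Negz m.+1 + 1 = Negz m by lia.
rewrite /qint [in RHS]big_nat_recl // mulrN mulrDr expr1 mulfV // opprD addrAC.
rewrite addNr add0r mulr_sumr; congr (- _).
by apply: eq_bigr => i _; rewrite exprS invfM mulrA mulfV // mul1r.
Qed.

Lemma qint1 : qint q 1 = 1.
Proof. by rewrite -[1 in LHS]add0r qintD1 qint0 mulr0 add0r. Qed.

Lemma qintB1 (d : int) : q * qint q (d - 1) + 1 = qint q d.
Proof. by rewrite -qintD1 subrK. Qed.

(* [(q - 1) * [d]_q + 1] is q^d. *)
Lemma qint_pow_neq0 (d : int) : (q - 1) * qint q d + 1 != 0.
Proof.
have step e : (q - 1) * qint q (e + 1) + 1 = q * ((q - 1) * qint q e + 1).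
  by rewrite qintD1; ring.
elim/int_rect: d => [|m IH|m IH].
- by rewrite qint0 mulr0 add0r oner_neq0.
- by rewrite -addn1 PoszD step mulf_neq0.
- have := step (- m.+1%:Z).
  have -> : - m.+1%:Z + 1 = - m%:Z by lia.
  by move=> E; move: IH; rewrite E mulf_eq0 negb_or => /andP[].
Qed.

Lemma qint_addn (d : int) (m : nat) :
  qint q (d + m%:Z) - qint q d = ((q - 1) * qint q d + 1) * qint q m.
Proof.
elim: m => [|m IH]; first by rewrite addr0 subrr qint0 mulr0.
have -> : d + m.+1%:Z = d + m%:Z + 1 by lia.
have -> : m.+1%:Z = m%:Z + 1 by lia.
by rewrite !qintD1 mulrDr mulrCA -IH; ring.
Qed.

(** For [d <= c] the difference is [q^d [c - d]_q], so distances up to [n] are separated; at a root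
    of unity of larger order values can repeat further away. *)
Lemma qint_inj_bounded (n : nat) (c d : int) :
  (forall m, (0 < m <= n)%N -> qint q m != 0) ->
  c != d -> (`|c - d| <= n)%N -> qint q c != qint q d.
Proof.
move=> qn; wlog le_dc : c d / d <= c => [H ne le|ne le].
  case: (lerP d c) => cd; first exact: H.
  by rewrite eq_sym; apply: H; rewrite 1?eq_sym //; lia.
have -> : c = d + `|c - d|%:Z by lia.
rewrite -subr_eq0 qint_addn mulf_neq0 ?qint_pow_neq0 // qn //.
by lia.
Qed.

End QInt.

(** * Lattice words: row lengths, addable boxes and contents *)

(** The content of the box that a further letter [r] would add: letters are row numbers, so
    [count_mem r s] is the current length of row [r]. *)
Definition kap (s : seq nat) (r : nat) : int := (count_mem r s)%:Z + 1 - r%:Z.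

Definition addable (s : seq nat) (r : nat) : bool :=
  (0 < r)%N && ((r == 1)%N || (count_mem r s < count_mem r.-1 s)%N).

(* Rows of the entries 1, 2, ... of a standard tableau. *)
Definition yam (s : seq nat) : bool :=
  all (fun k => addable (take k s) (nth 0%N s k)) (iota 0 (size s)).

Lemma yam_rcons s r : yam (rcons s r) = yam s && addable s r.
Proof.
rewrite /yam size_rcons -addn1 iotaD all_cat /= add0n andbT.
rewrite nth_rcons ltnn eqxx -cats1 take_size_cat //; congr (_ && _).
apply: eq_in_all => k; rewrite mem_iota add0n => /andP[_ lt].
by rewrite nth_cat lt takel_cat // ltnW.
Qed.

Lemma yamP s : reflect (forall k, (k < size s)%N -> addable (take k s) (nth 0%N s k))
  (yam s).
Proof.
apply: (iffP allP) => H k; first by move=> lt; apply: H; rewrite mem_iota.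
by rewrite mem_iota => /andP[_]; apply: H.
Qed.

Lemma yam_catl s t : yam (s ++ t) -> yam s.
Proof.
elim/last_ind: t => [|t r IH]; first by rewrite cats0.
by rewrite -rcons_cat yam_rcons => /andP[/IH].
Qed.

Lemma yam_take k s : yam s -> yam (take k s).
Proof. by rewrite -{1}(cat_take_drop k s); apply: yam_catl. Qed.

Lemma yam_count s r : yam s -> (0 < r)%N -> (count_mem r.+1 s <= count_mem r s)%N.
Proof.
move=> + r0; elim/last_ind: s => [|s a IH] //.
rewrite yam_rcons => /andP[/IH {}IH /andP[a0 /orP[/eqP->|lt]]];
  rewrite -!cats1 !count_cat /= !addn0.
- by have -> : (1 == r.+1)%N = false; [lia|rewrite addn0 (leq_trans IH) ?leq_addr].
- case: (a =P r.+1) => [E|_]; last by rewrite addn0 (leq_trans IH) // leq_addr.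
  by rewrite E /= in lt *; rewrite addn1 (leq_trans lt) // leq_addr.
Qed.

Lemma yam_count_le s r r' : yam s -> (0 < r <= r')%N ->
  (count_mem r' s <= count_mem r s)%N.
Proof.
move=> ys /andP[r0 /subnK<-]; elim: (r' - r)%N => [|d IH] //.
by rewrite addSn (leq_trans _ IH) // yam_count // addn_gt0 r0 orbT.
Qed.

Lemma yam_mem_gt0 s r : yam s -> r \in s -> (0 < r)%N.
Proof.
move/yamP => ys rs; have := rs; rewrite -index_mem => /ys.
by rewrite nth_index // => /andP[].
Qed.

Lemma addable_count s r r' : addable s r -> yam s -> (0 < r' < r)%N ->
  (count_mem r s < count_mem r' s)%N.
Proof.
move=> /andP[_ ar] ys lt; have {ar} : (count_mem r s < count_mem r.-1 s)%N.
  by case/orP: ar => //; lia.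
move=> H; apply: leq_trans H _; apply: yam_count_le => //; lia.
Qed.

(** Each position of [s] is counted by at most one letter. With a free lower bound [f], one row can
    be counted in full and the others by a single box. *)
Lemma count_rows s (f : nat -> nat) a (m : nat) :
  (forall i, (a < i <= a + m)%N -> (f i <= count_mem i s)%N) ->
  (f a <= count_mem a s)%N ->
  (f a + \sum_(a.+1 <= i < a + m.+1) f i <= size s)%N.
Proof.
move=> H Ha; rewrite -big_ltn ?addnS ?ltnS ?leq_addr //.
have : (\sum_(a <= i < (a + m).+1) f i <=
        \sum_(a <= i < (a + m).+1) count_mem i s)%N.
  rewrite big_nat_cond [leqRHS]big_nat_cond; apply: leq_sum => i; rewrite andbT => /andP[le lt].
  by move: le; rewrite leq_eqVlt => /orP[/eqP<-//|lt']; apply: H; rewrite lt'.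
move/leq_trans; apply.
under eq_bigr => i _ do rewrite -sum1_count.
rewrite (exchange_big_dep predT) //= -sum1_size; apply: leq_sum => x _.
rewrite (eq_bigl (pred1 x)); last by move=> i; rewrite /= eq_sym.
by rewrite -big_filter sum1_size size_filter count_uniq_mem ?iota_uniq ?leq_b1.
Qed.

(** Row [r] is strictly longer than row [r'], which gives the gap of 2. For the upper bound, the
    boxes of row [r] and one box in each row strictly between [r] and [r'] are all in the shape, so
    their number is at most [size s]. *)
Lemma kap_gt s r r' : yam s -> addable s r' -> (0 < r < r')%N ->
  (kap s r' + 2 <= kap s r) && (kap s r <= kap s r' + (size s).+1%:Z).
Proof.
move=> ys ar' lt; have c := addable_count ar' ys lt.
apply/andP; split; first by rewrite /kap; lia.
have : (count_mem r s + (r' - r.+1) <= size s)%N.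
  have := @count_rows s (fun i => if i == r then count_mem r s else 1%N) r (r' - r.+1).
  rewrite /= eqxx => /(_ _ (leqnn _)) H.
  have {H} := H _; rewrite big_nat_cond (eq_bigr (fun=> 1%N)); last first.
    by move=> i /andP[/andP[lti _] _]; rewrite gtn_eqF.
  rewrite -big_nat_cond sum_nat_const_nat muln1.
  have -> : (r + (r' - r.+1).+1 - r.+1)%N = (r' - r.+1)%N by lia.
  apply=> i /andP[lti le]; rewrite gtn_eqF //.
  by apply: leq_trans (addable_count ar' ys (_ : (0 < i < r')%N)); lia.
by rewrite /kap; lia.
Qed.

Lemma addable_le s r : yam s -> addable s r -> (r <= (size s).+1)%N.
Proof.
move=> ys ar; case: (ltnP 1 r) => [lt|]; last by lia.
have /andP[_] := @kap_gt s 1 r ys ar lt.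
have /andP[_] := ar; have := @addable_count s r 1 ar ys lt.
by rewrite /kap; lia.
Qed.

(** The upper bound is what allows [qint_inj_bounded] to separate addable contents; the lower bound
    keeps the neighbours of an addable content from being addable contents themselves. *)
Lemma kap_dist s r r' : yam s -> addable s r -> addable s r' -> r != r' ->
  (2 <= `|kap s r - kap s r'| <= (size s).+1)%N.
Proof.
move=> ys ar ar' ne; have /andP[r0 _] := ar; have /andP[r'0 _] := ar'.
case: (ltngtP r r') ne => // lt _.
  by have /andP[] := @kap_gt s r r' ys ar' (introT andP (conj r0 lt)); lia.
by have /andP[] := @kap_gt s r' r ys ar (introT andP (conj r'0 lt)); lia.
Qed.

Lemma kap_rcons s a r : kap (rcons s a) r = kap s r + (a == r)%:Z.
Proof. by rewrite /kap -cats1 count_cat /= addn0; lia. Qed.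

Lemma kap_perm s t r : perm_eq s t -> kap s r = kap t r.
Proof. by move=> /seq.permP st; rewrite /kap st. Qed.

Lemma addable_perm s t r : perm_eq s t -> addable s r = addable t r.
Proof. by move=> /seq.permP st; rewrite /addable !st. Qed.

Lemma perm_swap (s t : seq nat) a c : perm_eq (s ++ a :: c :: t) (s ++ c :: a :: t).
Proof. by rewrite perm_cat2l; apply/seq.permP => p /=; rewrite addnCA. Qed.

Lemma yam_cat s t : yam (s ++ t) =
  yam s && all (fun k => addable (s ++ take k t) (nth 0%N t k)) (iota 0 (size t)).
Proof.
elim/last_ind: t => [|t r IH]; first by rewrite cats0 andbT.
rewrite -rcons_cat yam_rcons IH -andbA; congr (_ && _).
rewrite size_rcons -addn1 iotaD all_cat /= add0n andbT.
rewrite nth_rcons ltnn eqxx -cats1 take_size_cat //; congr (_ && _).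
apply: eq_in_all => k; rewrite mem_iota add0n => /andP[_ lt].
by rewrite nth_cat lt takel_cat // ltnW.
Qed.

Lemma addable_rcons s a c : a != c -> c != a.+1 ->
  addable (rcons s a) c -> addable s c.
Proof.
move=> ac ca /andP[c0]; rewrite /addable c0 /= -cats1 !count_cat /= !addn0.
rewrite (negbTE ac) addn0; have -> : (a == c.-1)%N = false by lia.
by rewrite addn0.
Qed.

Lemma yam_swap s a c t : a != c -> addable s c ->
  yam (s ++ a :: c :: t) -> yam (s ++ c :: a :: t).
Proof.
move=> ne ac yt.
have := yt; rewrite -cat1s catA cats1 -cat1s catA cats1 yam_cat => /andP[].
rewrite !yam_rcons => /andP[/andP[ys aa] ac'] H.
rewrite -cat1s catA cats1 -cat1s catA cats1 yam_cat !yam_rcons ys ac /=.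
apply/andP; split.
  have /andP[a0 aa'] := aa; rewrite /addable a0 -cats1 !count_cat /= !addn0.
  rewrite (eq_sym c) (negbTE ne) addn0; case/orP: aa' => [->//|lt].
  by apply/orP; right; apply: leq_trans lt _; rewrite leq_addr.
apply: sub_all H => k; rewrite (@addable_perm _ (rcons (rcons s c) a ++ take k t)) //.
by rewrite -!cats1 -!catA perm_swap.
Qed.

(** The three positions of consecutive entries: same row, same column (equal counts put [c] right
    below [a]), or exchangeable. They are the three cases of the seminormal form. *)
Lemma yam_adjacent s a c t : yam (s ++ a :: c :: t) ->
  [\/ a = c, c = a.+1 /\ count_mem c s = count_mem a s
    | [/\ a != c, addable s c & yam (s ++ c :: a :: t)]].
Proof.
move=> yt; case: (a =P c) => [->|/eqP ne]; first by constructor 1.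
have := yt; rewrite -cat1s catA cats1 -cat1s catA cats1 yam_cat => /andP[].
rewrite !yam_rcons => /andP[/andP[ys aa] ac'] _.
case ac: (addable s c); first by constructor 3; split=> //; apply: yam_swap.
case: (c =P a.+1) => [E|/eqP ca]; last by rewrite (addable_rcons ne ca) in ac.
constructor 2; split=> //; have /andP[a0 _] := aa.
have := yam_count ys a0; rewrite -E.
by move: ac ac'; rewrite /addable E /= -cats1 !count_cat /= eqxx; lia.
Qed.

Lemma not_addable_below s a : (0 < a)%N -> count_mem a.+1 s = count_mem a s ->
  ~~ addable s a.+1.
Proof. by move=> a0 E; rewrite /addable /= E ltnn orbF eqSS -lt0n. Qed.

(* k boxes cannot contain the box (r, r) when k < r ^ 2; only k = 2, 3 matter. *)
Lemma contents_kap s r : yam s -> addable s r -> kap s r \in contents (size s).+1.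
Proof.
move=> ys ar; have /andP[r0 ar'] := ar; have rs := addable_le ys ar.
have cs := count_size (pred1 r) s.
rewrite /contents mem_filter; apply/andP; split; last first.
  apply/mapP; exists (absz (kap s r + (size s)%:Z)).
    rewrite mem_iota leq0n add0n doubleS /kap -mul2n /=; move: (count_mem r s) (size s) cs rs r0 {ar ar' ys} => c m cs rs r0.
    by lia.
  by rewrite /kap; lia.
apply/implyP => /eqP k0.
rewrite !inE negb_or !eqSS.
(* Content 0 in row 1 is the very first box, so [s] is empty. In row [r > 1] it requires [r - 1]
   boxes in row [r] and at least [r] in the row above, hence at least 3 boxes in [s]. *)
have [E|r1] : r = 1%N \/ (1 < r)%N by lia.
  subst r; move: k0; rewrite /kap => k0.
  have c0 : count_mem 1%N s = 0%N by lia.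
  suff -> : s = [::] by [].
  case/lastP: s ys c0 {ar ar' cs rs k0} => // s a; rewrite yam_rcons => /andP[ys /andP[a0 aa]].
  rewrite -cats1 count_cat /= addn0 => c0.
  case: (a =P 1%N) aa c0 => [->|/eqP a1 /= lt]; first by rewrite addn1.
  have a1' : (0 < 1 <= a.-1)%N by lia.
  by rewrite addn0 => c0; have := leq_trans lt (yam_count_le ys a1'); rewrite c0 ltn0.
have cc : (count_mem r s < count_mem r.-1 s)%N by case/orP: ar' => //; lia.
have : (count_mem r s + count_mem r.-1 s <= size s)%N.
  rewrite -count_predUI; set x := count (predI _ _) _.
  have -> : x = 0%N.
    by apply/eqP; rewrite /x -leqn0 leqNgt -has_count; apply/hasP => -[y _ /andP[/eqP/= ->]]; lia.
  by rewrite addn0 count_size.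
by move: k0; rewrite /kap; lia.
Qed.

(** * Reflexive proofs of linear identities *)

Section LinearCombinations.
Context (F : fieldType) (V : lmodType F).

(* Syntax for linear combinations, so that an identity between them reduces to
   the equality of the coefficients of each atom. *)
Inductive lexp :=
| LZero | LVar of nat | LAdd of lexp & lexp | LOpp of lexp | LScale of F & lexp.

Fixpoint leval (env : seq V) (e : lexp) : V :=
  match e with
  | LZero => 0
  | LVar i => nth 0 env i
  | LAdd a b => leval env a + leval env b
  | LOpp a => - leval env a
  | LScale c a => c *: leval env a
  end.

Fixpoint lcoef (e : lexp) (i : nat) : F :=
  match e with
  | LZero => 0
  | LVar j => if Nat.eqb i j then 1 else 0
  | LAdd a b => lcoef a i + lcoef b i
  | LOpp a => - lcoef a i
  | LScale c a => c * lcoef a i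
  end.

Lemma levalE env e :
  leval env e = \sum_(i < size env) lcoef e i *: nth 0 env i.
Proof.
elim: e => [|j|a IHa b IHb|a IHa|c a IHa] /=; rewrite ?IHa ?IHb.
- by rewrite big1 // => i _; rewrite scale0r.
- have eqE k : Nat.eqb k j = (k == j) by apply/PeanoNat.Nat.eqb_spec/eqP.
  case: (ltnP j (size env)) => [lt|ge].
    rewrite (bigD1 (Ordinal lt)) //= eqE eqxx scale1r big1 ?addr0 // => i ne.
    by rewrite eqE -[j]/(val (Ordinal lt)) val_eqE (negbTE ne) scale0r.
  rewrite nth_default // big1 // => i _; rewrite eqE.
  by rewrite ltn_eqF ?scale0r // (leq_trans (ltn_ord i)).
- by rewrite -big_split; apply: eq_bigr => i _; rewrite scalerDl.
- by rewrite -sumrN; apply: eq_bigr => i _; rewrite scaleNr.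
- by rewrite scaler_sumr; apply: eq_bigr => i _; rewrite scalerA.
Qed.

Fixpoint lagree (m : nat) (e1 e2 : lexp) : Prop :=
  if m is m'.+1 then lcoef e1 m' = lcoef e2 m' /\ lagree m' e1 e2 else True.

Lemma leval_eq env e1 e2 : lagree (size env) e1 e2 ->
  leval env e1 = leval env e2.
Proof.
move=> H; rewrite !levalE; apply: eq_bigr => -[i lt] _ /=; congr (_ *: _).
elim: (size env) lt H => // m IH; rewrite ltnS leq_eqVlt => /orP[/eqP->|lt] [e H] //.
exact: IH.
Qed.

End LinearCombinations.

(* Atoms are compared up to unification: the instances inferred for the unit of
   an algebra are not always syntactically equal. *)
Ltac lin_index x l :=
  match l with
  | cons ?y _ => let _ := match goal with _ => unify x y end in constr:(O)
  | cons _ ?l' => let k := lin_index x l' in constr:(S k)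
  end.

Ltac lin_add x l :=
  match l with
  | nil => constr:(cons x nil)
  | cons ?y _ => let _ := match goal with _ => unify x y end in l
  | cons ?y ?l' => let r := lin_add x l' in constr:(cons y r)
  end.

Ltac lin_atoms e l :=
  match e with
  | (?a + ?b)%R => let l1 := lin_atoms a l in lin_atoms b l1
  | (- ?a)%R => lin_atoms a l
  | (_ *: ?a)%R => lin_atoms a l
  | 0%R => l
  | _ => lin_add e l
  end.

Ltac lin_reify F e l :=
  match e with
  | (?a + ?b)%R => let a' := lin_reify F a l in let b' := lin_reify F b l in
                   constr:(@LAdd F a' b')
  | (- ?a)%R => let a' := lin_reify F a l in constr:(@LOpp F a')
  | (?c *: ?a)%R => let a' := lin_reify F a l in constr:(@LScale F c a')
  | 0%R => constr:(@LZero F)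
  | _ => let k := lin_index e l in constr:(@LVar F k)
  end.

Ltac lin F V :=
  lazymatch goal with
  | |- ?a = ?b =>
    let l := lin_atoms a (@nil V) in
    let l := lin_atoms b l in
    let a' := lin_reify F a l in
    let b' := lin_reify F b l in
    refine (@leval_eq F V l a' b' _);
    cbn [size lagree lcoef Nat.eqb]; repeat split
  end.

Section NoncommutativeExpansion.
Context (F : fieldType) (A : algType F).

Lemma mul_scalel (c : F) (x y : A) : (c *: x) * y = c *: (x * y).
Proof. by rewrite scalerAl. Qed.

Lemma mul_scaler (c : F) (x y : A) : x * (c *: y) = c *: (x * y).
Proof. by rewrite scalerAr. Qed.

Lemma comm_scale (x y : A) (c : F) : GRing.comm x y -> GRing.comm x (c *: y).
Proof. by rewrite /GRing.comm mul_scalel mul_scaler => ->. Qed.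

End NoncommutativeExpansion.

Definition ncE := (mulrDl, mulrDr, mulNr, mulrN, mulr1, mul1r, mulr0, mul0r,
  mulrA, mul_scalel, mul_scaler).

(** * Shuffling operators and Jucys-Murphy elements *)

Section HeckeRelations.
Context (F : fieldType) (q : F) (n : nat) (A : algType F) (T J : nat -> A).
Hypothesis q_neq0 : q != 0.
Hypothesis Tquad : forall i, (0 < i < n)%N -> T i * T i = (q - 1) *: T i + q *: 1.
Hypothesis Tfar : forall i j, (0 < i)%N -> (i.+1 < j < n)%N ->
  T i * T j = T j * T i.
Hypothesis Tbraid : forall i, (0 < i)%N -> (i.+1 < n)%N ->
  T i * T i.+1 * T i = T i.+1 * T i * T i.+1.
Hypothesis J1 : J 1 = 0.
Hypothesis JS : forall k, (0 < k < n)%N ->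
  J k.+1 = q^-1 *: (T k * J k * T k + T k).

Lemma comm_J_T_gt k i : (0 < k < i)%N -> (i < n)%N -> GRing.comm (T i) (J k).
Proof.
elim: k => // -[_ _ _|k IH /andP[_ lt] lti]; first by rewrite J1; apply: commr0.
have c : GRing.comm (T i) (T k.+1).
  by apply: commr_sym; apply: Tfar; lia.
rewrite JS; last by lia.
apply/comm_scale/commrD => //; apply: commrM => //; apply: commrM => //.
by apply: IH => //; lia.
Qed.

(** The case [k = i + 2] carries the content: unfolding [J] twice leaves [J i], which commutes with
    [T i.+1], and the braid relation does the rest. Larger [k] follow because [T k] and [T i]
    commute. *)
Lemma comm_J_T_lt k i : (0 < i)%N -> (i.+1 < k <= n)%N -> GRing.comm (T i) (J k).
Proof.
move=> i0; elim: k => // k IH /andP[]; rewrite ltnS leq_eqVlt => /orP[/eqP<-|lt] lek; last first.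
  have c : GRing.comm (T i) (T k) by apply: Tfar => //; lia.
  rewrite JS; last by lia.
  apply/comm_scale/commrD => //; apply: commrM => //; apply: commrM => //.
  by apply: IH; lia.
rewrite JS ?JS; try lia.
have br := Tbraid i0 lek; have qu := @Tquad i (_ : (0 < i < n)%N).
have cj : GRing.comm (T i.+1) (J i) by apply: comm_J_T_gt; lia.
move: (T i) (T i.+1) (J i) br (qu ltac:(lia)) cj => a b j br {}qu cj.
have e1 : a * b * a * j * a * b = b * a * j * a * b * a.
  rewrite br -(mulrA _ b j) cj mulrA -(mulrA _ b a) -(mulrA _ _ b) -br.
  by rewrite !mulrA.
have e2 : a * b * a * b = (q - 1) *: (a * b * a) + q *: (b * a).
  by rewrite -mulrA -mulrA (mulrA b) -br !mulrA qu !ncE.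
have e3 : b * a * b * a = (q - 1) *: (a * b * a) + q *: (a * b).
  by rewrite -br -mulrA qu !ncE.
rewrite /GRing.comm !ncE e1 e2 e3.
by lin F A; field.
Qed.

(** For [l < k], [J l] is built from generators of index below [l], each of which commutes with
    [J k]. *)
Lemma comm_J k l : (0 < k <= n)%N -> (0 < l <= n)%N -> GRing.comm (J k) (J l).
Proof.
wlog lt : k l / (l < k)%N => [H lek lel|].
  case: (ltngtP l k) => [lt|lt|->]; first exact: H.
    by apply: commr_sym; apply: H.
  by [].
elim: l lt => // -[|l] IH lt lek lel; first by rewrite J1; apply: commr0.
have c : GRing.comm (J k) (T l.+1).
  by apply: commr_sym; apply: comm_J_T_lt; lia.
rewrite JS; last by lia.
apply/comm_scale/commrD => //; apply: commrM => //; apply: commrM => //.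
by apply: IH; lia.
Qed.

Lemma T_J_succ k : (0 < k < n)%N ->
  T k * J k.+1 = J k * T k + 1 + (q - 1) *: J k.+1.
Proof.
move=> kn; rewrite JS // !ncE Tquad // !ncE.
by lin F A; field.
Qed.

Lemma J_succ_T k : (0 < k < n)%N ->
  J k.+1 * T k = T k * J k + 1 + (q - 1) *: J k.+1.
Proof.
move=> kn; rewrite JS // !ncE -(mulrA _ (T k)) Tquad // !ncE.
by lin F A; field.
Qed.

Section Intertwiner.
Variable k : nat.
Hypothesis kn : (0 < k < n)%N.
Let X1 := J k.
Let X2 := J k.+1.
Let t := T k.
Definition intertwiner := t * X1 - X1 * t.
Local Notation phi := intertwiner.

Let cX : X1 * X2 = X2 * X1. Proof. by apply: comm_J; lia. Qed.
Let tX2 : t * X2 = X1 * t + 1 + (q - 1) *: X2. Proof. exact: T_J_succ. Qed.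
Let X2t : X2 * t = t * X1 + 1 + (q - 1) *: X2. Proof. exact: J_succ_T. Qed.
Let tt : t * t = (q - 1) *: t + q *: 1. Proof. exact: Tquad. Qed.

Lemma intertwiner_J : phi * J k = J k.+1 * phi.
Proof.
rewrite /phi -/X1 -/X2 !ncE -cX -(mulrA X1 X2) X2t !ncE -cX.
by lin F A; ring.
Qed.

(** The right side factors as [- (X2 - q X1 - 1) (q X2 - X1 + 1)]. Where [X1] is [c]_q it vanishes
    exactly when [X2] is [c + 1]_q or [c - 1]_q, that is, for adjacent contents. *)
Lemma intertwiner_sqr : phi * phi =
  (q - 1) ^+ 2 *: (X1 * X2) + (q - 1) *: X1 + (q - 1) *: X2 + 1
  - q *: (X1 * X1) - q *: (X2 * X2) + (q *+ 2) *: (X1 * X2).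
Proof.
have p1 : phi = X2 * t - X1 * t - (q - 1) *: X2 - 1.
  by rewrite X2t /phi; lin F A; ring.
have p2 : t * phi = (q - 1) *: (t * X1) + t + q *: X1 - q *: X2.
  have -> : phi = t * X1 - t * X2 + (q - 1) *: X2 + 1.
    by rewrite tX2 /phi; lin F A; ring.
  by rewrite !ncE tt !ncE; lin F A; ring.
have p3 : X2 * phi = phi * X1 by rewrite intertwiner_J.
move: phi p1 p2 p3 => f p1 p2 p3.
have -> : f * f = X2 * (t * f) - X1 * (t * f) - (q - 1) *: (X2 * f) - f.
  by rewrite [X in X * _ = _]p1 !ncE; lin F A; ring.
rewrite p2 p3 p1 !ncE X2t -(mulrA X1 t) -cX !ncE.
by lin F A; ring.
Qed.

End Intertwiner.

Section Shuffles.
Variables B Bs : nat -> A.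
Hypotheses (B1 : B 1 = 1) (Bs1 : Bs 1 = 1).
Hypothesis BS : forall m, (0 < m < n)%N -> B m.+1 = 1 + T m * B m.
Hypothesis BsS : forall m, (0 < m < n)%N -> Bs m.+1 = 1 + Bs m * T m.

Lemma comm_B (y : A) m : (forall i, (0 < i < m)%N -> GRing.comm y (T i)) ->
  (0 < m <= n)%N -> GRing.comm y (B m) /\ GRing.comm y (Bs m).
Proof.
elim: m => // -[_ _ _|m IH H lt]; first by rewrite B1 Bs1; split; apply: commr1.
have [||cB cBs] := IH; [by move=> i ?; apply: H; lia|by lia|].
have cT : GRing.comm y (T m.+1) by apply: H; rewrite ltnSn.
have lt' : (0 < m.+1 < n)%N by [].
by rewrite (BS lt') (BsS lt'); split; apply: commrD; (exact: commr1 || exact: commrM).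
Qed.

(** In the sum over coset representatives that [B m * B m.+1] expands to, left multiplication by
    [T m] acts as on a symmetrizer. This absorbs the generator in [B_R] and makes [symmetrizer] an
    eigenvector. *)
Lemma T_B_B m : (0 < m < n)%N -> T m * B m * B m.+1 = q *: (B m * B m.+1).
Proof.
elim: m => // -[_ lt|m IH lt].
  rewrite (BS lt) B1 !mulr1 mul1r mulrDr mulr1 Tquad //.
  by lin F A; ring.
have {}IH := IH (_ : (0 < m.+1 < n)%N).
have {}IH := IH (ltac:(lia)).
have ct : GRing.comm (T m.+2) (B m.+1).
  by apply: (proj1 (comm_B _ _)) => [i ?|]; [apply/commr_sym/Tfar; lia|lia].
have br := @Tbraid m.+1 isT (ltac:(lia)).
have qu := @Tquad m.+2 lt.
rewrite (BS lt) (BS (ltac:(lia) : (0 < m.+1 < n)%N)) in IH *.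
move: (T m.+1) (T m.+2) (B m.+1) IH ct br qu => s t b IH ct br qu.
have bE : b * (1 + s * b) = b + b * s * b by rewrite !ncE.
have {}IH : s * (b + b * s * b) = q *: (b + b * s * b) by rewrite -bE mulrA.
(* The first summand is absorbed by [t (1 + t) = q (1 + t)]; in the second, [t s t = s t s] brings
   the induction hypothesis next to [b + b s b]. *)
have e0 : (1 + s * b) * (1 + t * (1 + s * b)) =
    (1 + t) * (1 + s * b) + s * (t * (b + b * s * b)).
  rewrite !ncE -(mulrA s b t) -ct !mulrA.
  by lin F A; ring.
rewrite -mulrA e0 mulrDr !mulrA scalerDr !mulrDr !mulr1 qu; congr (_ + _).
  by rewrite !ncE; lin F A; ring.
by rewrite -!mulrDr -br -mulrA IH -scalerAr.
Qed.

(** This is where the Jucys-Murphy element enters: passing from [m] to [m + 1] conjugates the whole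
    expression by a generator, just as the recursion for [J] does. *)
Lemma B_Bs m : (0 < m < n)%N -> B m.+1 * Bs m.+1 =
  qint q m.+1 *: 1 + q ^+ m.+1 *: J m.+1 + Bs m * T m * B m.
Proof.
have qS (k : nat) : qint q k.+1 = q * qint q k + 1.
  by rewrite -(qintD1 q_neq0); congr qint; lia.
elim: m => // -[_ lt|m IH lt].
  rewrite (BS lt) (BsS lt) B1 Bs1 (JS lt) J1 !mulr1 !mul1r mulr0 mul0r add0r.
  have -> : (1 + T 1) * (1 + T 1) = 1 + T 1 + T 1 + T 1 * T 1.
    by rewrite !ncE; lin F A; ring.
  rewrite (Tquad lt) !qS (qint0 q : qint q 0%N = 0).
  by lin F A; field.
have {}IH := IH (ltac:(lia)).
have [ct cst] : GRing.comm (T m.+2) (B m.+1) /\ GRing.comm (T m.+2) (Bs m.+1).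
  by apply: comm_B => [i ?|]; [apply/commr_sym/Tfar; lia|lia].
have br := @Tbraid m.+1 isT (ltac:(lia)).
have qu := @Tquad m.+2 lt.
rewrite (BS lt) (BsS lt) (JS lt) qS (exprS q m.+2).
have BE := BS (ltac:(lia) : (0 < m.+1 < n)%N).
have BsE := BsS (ltac:(lia) : (0 < m.+1 < n)%N).
have -> : (1 + T m.+2 * B m.+2) * (1 + Bs m.+2 * T m.+2) =
  1 + T m.+2 * B m.+2 + Bs m.+2 * T m.+2 + T m.+2 * (B m.+2 * Bs m.+2) * T m.+2.
  by rewrite !ncE; lin F A; ring.
rewrite IH BE BsE.
move: (T m.+1) (T m.+2) (B m.+1) (Bs m.+1) (J m.+2) ct cst br qu => s t b bs j ct cst br qu.
have e1 : t * bs * s * b * t = bs * s * t * s * b.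
  by rewrite cst -(mulrA _ b) -ct -!mulrA (mulrA t s) (mulrA (t * s) t) -br !mulrA.
have qp : q ^+ m.+2 = (q - 1) * qint q m.+2 + 1.
  elim: m.+2 => [|k IHk]; first by rewrite (qint0 q : qint q 0%N = 0) mulr0 add0r.
  by rewrite exprS IHk qS; ring.
move: (q ^+ m.+2) (qint q m.+2) qp => e f ->.
rewrite !ncE e1 qu ?ncE.
by lin F A; field.
Qed.

(** [B_Bs] multiplied by [B m], with its last term absorbed by [T_B_B]. The multiplicity [(1 < m)]
    suppresses that term for [m = 1], since nothing is assumed about [B] and [Bs] at index 0. *)
Lemma B_R m : (0 < m <= n)%N -> B m * (Bs m * B m) =
  (q *: (Bs m.-1 * B m.-1) *+ (1 < m)%N + qint q m *: 1 + q ^+ m *: J m) * B m.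
Proof.
case: m => // -[_|m lt].
  rewrite B1 Bs1 J1 scaler0 addr0 !mulr1 add0r.
  by rewrite -[Posz 1]/(1 : int) qint1 // scale1r.
rewrite mulrA B_Bs //= mulr1n !mulrDl -[in X in _ + X](mulrA (Bs m.+1)) -mulrA.
rewrite -mulrA (mulrA (T m.+1)) T_B_B //.
by rewrite -!(scalerAr, scalerAl) mulrA; lin F A; ring.
Qed.

End Shuffles.

(** * Weight vectors and the spectrum of the Jucys-Murphy elements *)

Hypothesis qint_neq0 : forall m, (0 < m <= n)%N -> qint q m != 0.

(** Weight vectors live in the algebra itself, under right multiplication; every element has the
    empty weight, so 1 can be split into weight vectors step by step. *)
Definition wt (s : seq nat) (x : A) : Prop := forall k, (k < size s)%N ->
  x * J k.+1 = qint q (kap (take k s) (nth 0%N s k)) *: x.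

Lemma wt_cat s t x : wt (s ++ t) x <-> wt s x /\ forall k, (k < size t)%N ->
  x * J (size s + k).+1 = qint q (kap (s ++ take k t) (nth 0%N t k)) *: x.
Proof.
split=> [H|[Hs Ht] k].
  split=> k lt.
    have := H k; rewrite size_cat ltn_addr // => /(_ isT).
    by rewrite nth_cat lt takel_cat // ltnW.
  have := H (size s + k)%N; rewrite size_cat ltn_add2l lt => /(_ isT).
  by rewrite nth_cat ltnNge leq_addr /= addKn take_cat ltnNge leq_addr /= addKn.
rewrite size_cat => lt; case: (ltnP k (size s)) => [lt'|ge].
  by rewrite nth_cat lt' takel_cat ?(ltnW lt') //; apply: Hs.
have := Ht (k - size s)%N; rewrite subnKC // => H.
by rewrite nth_cat take_cat !ltnNge ge /= H // ltn_subLR.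
Qed.

Lemma wt_rcons s r x : wt (rcons s r) x <->
  wt s x /\ x * J (size s).+1 = qint q (kap s r) *: x.
Proof.
rewrite -cats1 wt_cat; split=> -[Hs H]; split=> //.
  by have := H 0%N isT; rewrite addn0 cats0.
by case=> //= _; rewrite addn0 cats0.
Qed.

Lemma wt_linear s a x y : wt s x -> wt s y -> wt s (a *: x + y).
Proof.
move=> Hx Hy k lt; rewrite mulrDl -scalerAl Hx // Hy // scalerDr !scalerA.
by rewrite mulrC.
Qed.

Lemma wt_comm s x y : (forall k, (0 < k <= size s)%N -> GRing.comm y (J k)) ->
  wt s x -> wt s (x * y).
Proof. by move=> c Hx k lt; rewrite -mulrA c // mulrA Hx // scalerAl. Qed.

Lemma eigen_prod (X x : A) (d : F) (es : seq F) : x * X = d *: x ->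
  x * \prod_(e <- es) (X - e%:A) = \prod_(e <- es) (d - e) *: x.
Proof.
move=> Hx; elim: es => [|e es IH]; first by rewrite !big_nil mulr1 scale1r.
rewrite !big_cons mulrA mulrBr Hx -scalerAr mulr1 -scalerBl -scalerAl IH.
by rewrite scalerA.
Qed.

(** Induction on the roots: decompose [x (X - e)], divide its component at each other root [d] by
    [d - e], and what remains of [x] is an eigenvector for [e]. The predicate [P] keeps all
    components in the same weight space. *)
Lemma eigen_decomp (X : A) (P : A -> Prop) (es : seq F) (x : A) :
  (forall a u v, P u -> P v -> P (a *: u + v)) ->
  (forall u, P u -> P (u * X)) -> uniq es -> P x ->
  x * \prod_(e <- es) (X - e%:A) = 0 ->
  exists f : F -> A, x = \sum_(e <- es) f e /\
    forall e, e \in es -> P (f e) /\ f e * X = e *: f e.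
Proof.
move=> PL PX; elim: es x => [|e es IH] x /=.
  by move=> _ _; rewrite big_nil mulr1 => ->; exists (fun=> 0); rewrite big_nil.
case/andP=> ne ue Px; rewrite big_cons mulrA => H.
have Pw : P (x * (X - e%:A)).
  by rewrite mulrBr -scalerAr mulr1 addrC -scaleNr; apply: PL => //; apply: PX.
have [f [xf Hf]] := IH _ ue Pw H.
have P0 : P 0 by rewrite -(addNr x) -scaleN1r; apply: PL.
pose g d := (d - e)^-1 *: f d.
have Pg d : d \in es -> P (g d).
  by move=> /Hf[Pf _]; rewrite -[g d]addr0; apply: PL.
have gX d : d \in es -> g d * X = d *: g d.
  by move=> /Hf[_ fX]; rewrite -scalerAl fX !scalerA mulrC.
pose z := x - \sum_(d <- es) g d.
have Pz : P z.
  rewrite /z addrC -scaleN1r; apply: (PL) => //.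
  rewrite big_seq; apply: big_ind => // u v Pu Pv.
  by rewrite -[u]scale1r; apply: PL.
exists (fun d => if d == e then z else g d); rewrite big_cons eqxx; split.
  rewrite [X in _ + X](_ : _ = \sum_(d <- es) g d) ?subrK //.
  apply: eq_big_seq => d /= ds; case: eqP => // E; by rewrite -E ds in ne.
move=> d; rewrite inE; case: eqP => [-> _|_ /= ds]; last by split; [apply: Pg|apply: gX].
split=> //; rewrite /z mulrBl mulr_suml (eq_big_seq _ gX).
have key : \sum_(d <- es) f d = \sum_(d <- es) d *: g d - e *: \sum_(d <- es) g d.
  rewrite scaler_sumr -sumrB; apply: eq_big_seq => d' /= d's.
  rewrite -scalerBl scalerA mulfV ?scale1r // subr_eq0.
  by apply: contraNneq ne => <-.
move: xf; rewrite mulrBr -scalerAr mulr1 key => /(canRL (subrK _)) ->.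
by lin F A; ring.
Qed.

Definition addables (s : seq nat) : seq nat :=
  [seq r <- iota 1 (size s).+1 | addable s r].

Lemma mem_addables s r : yam s -> (r \in addables s) = addable s r.
Proof.
move=> ys; rewrite mem_filter mem_iota add1n ltnS.
case ar: (addable s r) => //=; rewrite (addable_le ys ar) andbT.
by have /andP[] := ar.
Qed.

Definition next_kappas (s : seq nat) : seq F :=
  [seq qint q (kap s r) | r <- addables s].

Lemma uniq_next_kappas s : yam s -> (size s < n)%N -> uniq (next_kappas s).
Proof.
move=> ys sn; rewrite map_inj_in_uniq ?filter_uniq ?iota_uniq // => r r'.
rewrite !mem_addables // => ar ar' /eqP E; apply/eqP; apply: contraTT E => ne.
have /andP[d2 dn] := kap_dist ys ar ar' ne.
by apply: (qint_inj_bounded q_neq0 qint_neq0); [apply: contraTneq d2 => ->; rewrite subrr|apply: leq_trans dn _].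
Qed.

(* J_{m+1} acts on a weight space of level m with the contents of the addable
   boxes as its only eigenvalues. *)
Definition spectral (m : nat) : Prop := forall s x, yam s -> size s = m ->
  wt s x -> x * \prod_(e <- next_kappas s) (J m.+1 - e%:A) = 0.

Lemma spectral_eigen s y d : spectral (size s) -> yam s -> wt s y ->
  y * J (size s).+1 = d *: y ->
  (forall r, addable s r -> d != qint q (kap s r)) -> y = 0.
Proof.
move=> sp ys wy yJ ne; have := sp s y ys erefl wy; rewrite (eigen_prod _ yJ).
move/eqP; rewrite scaler_eq0 => /orP[|/eqP//]; rewrite prodf_seq_eq0 => /hasP[e].
by move=> /mapP[r]; rewrite mem_addables // => ar -> /=; rewrite subr_eq0 (negbTE (ne r ar)).
Qed.

(* The vector [x * T i - a *: x] has the weights b and d of x exchanged. *)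
Lemma swap_eigen i x b d a : (0 < i < n)%N ->
  x * J i = b *: x -> x * J i.+1 = d *: x -> a * (d - b) = (q - 1) * d + 1 ->
  (x * T i - a *: x) * J i = d *: (x * T i - a *: x) /\
  (x * T i - a *: x) * J i.+1 = b *: (x * T i - a *: x).
Proof.
move=> lti xb xd E.
have e1 : x * T i * J i = d *: (x * T i) - ((q - 1) * d + 1) *: x.
  have := congr1 (fun z => x * z) (J_succ_T lti).
  rewrite /= !ncE xd !ncE => ->.
  by lin F A; ring.
have e2 : x * T i * J i.+1 = b *: (x * T i) + ((q - 1) * d + 1) *: x.
  have := congr1 (fun z => x * z) (T_J_succ lti).
  rewrite /= !ncE xd xb !ncE => ->.
  by lin F A; ring.
rewrite !ncE e1 e2 xb xd -E; split; lin F A; ring.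
Qed.

Lemma wt_T s i x : (size s < i < n)%N -> wt s x -> wt s (x * T i).
Proof.
move=> /andP[lt ltn]; apply: wt_comm => k kb.
by apply: comm_J_T_gt; lia.
Qed.

Lemma wt_sub_scale s a x y : wt s x -> wt s y -> wt s (y - a *: x).
Proof. by move=> wx wy; rewrite addrC -scaleNr; apply: wt_linear. Qed.

(* When the next content is adjacent to the last one the intertwined vector
   would have a forbidden weight, so it vanishes. *)
Lemma adjacent_action s r d a x : spectral (size s) -> ((size s).+1 < n)%N ->
  yam (rcons s r) -> wt (rcons s r) x -> x * J (size s).+2 = qint q d *: x ->
  (d = kap s r + 1 /\ a = q) \/ (d = kap s r - 1 /\ a = -1) ->
  x * T (size s).+1 = a *: x.
Proof.
move=> sp ltn; rewrite yam_rcons wt_rcons => /andP[ys ar] [wx xJ] xd da.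
apply/eqP; rewrite -subr_eq0; apply/eqP.
have [||yJ _] := @swap_eigen (size s).+1 x _ (qint q d) a _ xJ xd; first by lia.
  case: da => -[-> ->]; first by rewrite qintD1 //; ring.
  by rewrite -[in qint q (kap s r)](qintB1 q_neq0); ring.
apply: (spectral_eigen sp ys _ yJ).
  by apply: wt_sub_scale => //; apply: wt_T => //; lia.
(* The content of an addable box is at distance 0 or at least 2 from [kap s r], whereas [d] is at
   distance 1; all distances stay below the bound [n]. *)
move=> r' ar'; apply: (qint_inj_bounded q_neq0 qint_neq0).
  case: (r =P r') => [<-|/eqP ne]; first by case: da => -[-> _]; lia.
  by have := kap_dist ys ar ar' ne; case: da => -[-> _]; lia.
case: (r =P r') => [<-|/eqP ne]; first by case: da => -[-> _]; lia.
by have := kap_dist ys ar ar' ne; case: da => -[-> _]; lia.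
Qed.

(** The diagonal entry [q^c / ([c]_q - [a]_q)] of Young's seminormal form, for the contents of the
    two boxes. *)
Definition swap_coef (s : seq nat) (a c : nat) : F :=
  ((q - 1) * qint q (kap s c) + 1) / (qint q (kap s c) - qint q (kap s a)).

(** The coefficient is [q] exactly when [[a + 1]_q = [c]_q], and [-1] exactly when [[c + 1]_q =
    [a]_q]; contents at distance at least 2 exclude both. *)
Lemma swap_coefP s a c : yam s -> addable s a -> addable s c -> a != c ->
  ((size s).+1 < n)%N ->
  [/\ swap_coef s a c * (qint q (kap s c) - qint q (kap s a)) =
      (q - 1) * qint q (kap s c) + 1,
      swap_coef s a c != q & swap_coef s a c != -1].
Proof.
move=> ys aa ac ne ltn; have kd := kap_dist ys aa ac ne.
have ne1 (e f : int) : e != f -> (`|e - f| <= n)%N -> qint q e - qint q f != 0.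
  by rewrite subr_eq0; apply: (qint_inj_bounded q_neq0 qint_neq0).
have nz : qint q (kap s c) - qint q (kap s a) != 0 by apply: ne1; lia.
split; first by rewrite /swap_coef divfK.
  apply/eqP => /(congr1 (fun z => z * (qint q (kap s c) - qint q (kap s a)))).
  rewrite /swap_coef divfK // => /eqP; rewrite -subr_eq0; apply/negP.
  have -> : (q - 1) * qint q (kap s c) + 1 - q * (qint q (kap s c) - qint q (kap s a))
    = qint q (kap s a + 1) - qint q (kap s c) by rewrite qintD1 //; ring.
  by apply: ne1; lia.
apply/eqP => /(congr1 (fun z => z * (qint q (kap s c) - qint q (kap s a)))).
rewrite /swap_coef divfK // => /eqP; rewrite -subr_eq0; apply/negP.
have -> : (q - 1) * qint q (kap s c) + 1 - (-1) * (qint q (kap s c) - qint q (kap s a))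
  = qint q (kap s c + 1) - qint q (kap s a) by rewrite qintD1 //; ring.
by apply: ne1; lia.
Qed.

Lemma wt_swap s a c t x : yam (s ++ a :: c :: t) -> addable s c -> a != c ->
  ((size s).+1 < n)%N -> (size (s ++ a :: c :: t) <= n)%N ->
  wt (s ++ a :: c :: t) x ->
  let y := x * T (size s).+1 - swap_coef s a c *: x in
  wt (s ++ c :: a :: t) y /\ (y = 0 -> x = 0).
Proof.
move=> ysact ac ne ltn le_n + y.
have [ys aa] : yam s /\ addable s a.
  have := yam_catl (_ : yam (rcons s a ++ c :: t)).
  by rewrite cat_rcons => /(_ ysact); rewrite yam_rcons => /andP[].
have [E nq n1] := swap_coefP ys aa ac ne ltn.
rewrite size_cat /= in le_n.
rewrite wt_cat => -[ws wt'].
have xa := wt' 0%N isT; have xc := wt' 1%N isT.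
rewrite /= ?take0 cats0 addn0 in xa; rewrite /= ?take0 addn1 in xc.
have {xc} xc : x * J (size s).+2 = qint q (kap s c) *: x.
  by rewrite xc cats1 kap_rcons (negbTE ne) addr0.
have [|yc ya] := swap_eigen _ xa xc E; first by lia.
split; last first.
  (* If [y] vanishes, [x] is an eigenvector of the generator with eigenvalue [swap_coef], which by
     the quadratic relation has to be [q] or [-1]. *)
  move/eqP; rewrite subr_eq0 => /eqP xT.
  have := congr1 (fun z => x * z) (Tquad (_ : (0 < (size s).+1 < n)%N)).
  rewrite /= ltn => /(_ isT); rewrite !ncE xT -scalerAl xT => /eqP.
  set al := swap_coef s a c in xT nq n1 *.
  rewrite -subr_eq0 (_ : _ - _ = ((al - q) * (al + 1)) *: x); last first.
    by lin F A; ring.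
  rewrite scaler_eq0 mulf_eq0 subr_eq0 (negbTE nq) /=.
  by rewrite -subr_eq0 opprK addrC in n1; rewrite addrC (negbTE n1) => /eqP.
apply/wt_cat; split.
  by apply: wt_sub_scale => //; apply: wt_T => //; lia.
case=> [_|[_|k lt]].
- by rewrite addn0 /= cats0.
- by rewrite addn1 /= ?take0 cats1 kap_rcons eq_sym (negbTE ne) addr0.
have := wt' k.+2 lt => /= xk; rewrite /= in lt.
rewrite mulrBl -scalerAl -mulrA comm_J_T_lt; last 2 first.
- by [].
- by lia.
rewrite mulrA xk -(kap_perm _ (perm_swap s (take k t) a c)).
by rewrite -scalerAl scalerBr !scalerA mulrC.
Qed.

(* Moves a box to a later time through boxes that are not adjacent to it. *)
Lemma wt_move s1 a s2 s3 x : a \notin s2 ->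
  (count_mem a.+1 (s1 ++ s2) <= count_mem a s1)%N ->
  yam (s1 ++ a :: s2 ++ s3) -> (size (s1 ++ a :: s2 ++ s3) <= n)%N ->
  wt (s1 ++ a :: s2 ++ s3) x ->
  exists y, [/\ wt (s1 ++ s2 ++ a :: s3) y, y = 0 -> x = 0,
    yam (s1 ++ s2 ++ a :: s3) &
    forall k e, (size (s1 ++ a :: s2 ++ s3) < k <= n)%N ->
      x * J k = e *: x -> y * J k = e *: y].
Proof.
elim: s2 s1 x => [|c s2 IH] s1 x; first by exists x.
rewrite inE negb_or => /andP[ac as2] cnt ys le_n wx.
(* The box of [c] does not lie right below that of [a]: row [a.+1] would then become longer than
   [cnt] permits. *)
have ac1 : addable s1 c.
  case: (yam_adjacent ys) => [E|[E E']|[]//]; first by rewrite E eqxx in ac.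
  by move: cnt; rewrite -E count_cat /= eqxx E' -[leqRHS]addn0 leq_add2l add1n ltn0.
have ltn : ((size s1).+1 < n)%N.
  by apply: leq_trans le_n; rewrite size_cat /=; lia.
have [] := wt_swap ys ac1 ac ltn le_n wx.
set y := _ - _ => wy y0; have yy := yam_swap ac ac1 ys.
have := IH (rcons s1 c) y as2; rewrite !cat_rcons.
have -> : count_mem a (rcons s1 c) = count_mem a s1.
  by rewrite -cats1 count_cat /= eq_sym (negbTE ac) !addn0.
have E : size (s1 ++ c :: a :: s2 ++ s3) = size (s1 ++ a :: c :: s2 ++ s3).
  by rewrite !size_cat.
rewrite E => /(_ cnt yy le_n wy) [z [wz z0 yz Hz]].
exists z; split=> // [/z0/y0//|k e kn xk].
apply: Hz => //; rewrite /y mulrBl -scalerAl -mulrA.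
rewrite comm_J_T_lt; last 2 first.
- by [].
- by move: kn; rewrite size_cat /=; lia.
by rewrite mulrA xk -scalerAl scalerBr !scalerA mulrC.
Qed.

Lemma cat_last_mem (a : nat) (s : seq nat) : a \in s ->
  exists s1 s2, s = s1 ++ a :: s2 /\ a \notin s2.
Proof.
elim/last_ind: s => // s b IH; rewrite mem_rcons inE.
case: (a =P b) => [-> _|/eqP ne /= /IH[s1 [s2 [-> as2]]]].
  by exists s, [::]; rewrite cats1.
by exists s1, (rcons s2 b); rewrite rcons_cat rcons_cons mem_rcons inE (negbTE ne).
Qed.

Lemma qint2_neq0 : (1 < n)%N -> q + 1 != 0.
Proof.
by move=> n1; have := @qint_neq0 2 n1; rewrite (qintD1 q_neq0 1) (qint1 q_neq0) mulr1.
Qed.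

(* A weight (c, c - 1, c) or (c, c + 1, c) contradicts the braid relation. *)
Lemma no_repeated_content s a r x :
  (forall m, (m <= (size s).+1)%N -> spectral m) -> ((size s).+2 < n)%N ->
  yam (rcons (rcons s a) r) -> wt (rcons (rcons s a) r) x ->
  x * J (size s).+3 = qint q (kap s a) *: x ->
  kap (rcons s a) r = kap s a - 1 \/ kap (rcons s a) r = kap s a + 1 ->
  x = 0.
Proof.
move=> sp ltn ysar wxr xa adj; have := ysar; rewrite yam_rcons => /andP[ysa ar].
have := wxr; rewrite wt_rcons size_rcons => -[wx xr].
(* Two adjacent steps in opposite directions make the generators act on [x] by [q] and [-1] in some
   order, and the braid relation gives [t1 t2 (t1 - t2) x = 0]. *)
have [t1 [t2 tt]] : exists t1 t2, [/\ x * T (size s).+1 = t1 *: x,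
    x * T (size s).+2 = t2 *: x & t1 * t2 * (t1 - t2) != 0].
  have q1 : q + 1 != 0 by apply: qint2_neq0; lia.
  have A1 := @adjacent_action s a (kap (rcons s a) r) _ x (sp _ (leqnSn _)) (ltnW ltn) ysa wx xr.
  have A2 := @adjacent_action (rcons s a) r (kap s a) _ x.
  rewrite size_rcons in A2; have {}A2 := A2 _ (sp _ (leqnn _)) ltn ysar wxr xa.
  case: adj => E; [exists (-1), q|exists q, (-1)]; split.
  - by apply: A1; right.
  - by apply: A2; left; rewrite E subrK.
  - by rewrite -opprD (addrC 1) mulN1r mulrNN mulf_neq0.
  - by apply: A1; left.
  - by apply: A2; right; rewrite E addrK.
  - by rewrite opprK mulrN1 mulNr oppr_eq0 mulf_neq0.
have [xt1 xt2 nz] := tt; have := congr1 (fun z => x * z) (@Tbraid (size s).+1 isT ltn).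
rewrite /= !mulrA; do 3!rewrite ?xt1 ?xt2 -?scalerAl.
rewrite !scalerA => /eqP; rewrite -subr_eq0 -scalerBl scaler_eq0 => /orP[|/eqP//].
by rewrite (_ : t1 * t2 * t1 - _ = t1 * t2 * (t1 - t2)); [rewrite (negbTE nz)|ring].
Qed.

(** Sorts the candidate eigenvalues left by the intertwiner argument: each belongs to an addable box
    of the enlarged shape or forces [x] to vanish. *)
Lemma spectral_excluded s' r x d : (forall m, (m <= size s')%N -> spectral m) ->
  ((size s').+1 < n)%N -> yam (rcons s' r) -> wt (rcons s' r) x ->
  x * J (size s').+2 = qint q d *: x ->
  (d = kap s' r \/ (d = kap s' r + 1 \/ d = kap s' r - 1) \/
   exists2 r', addable s' r' & r' != r /\ d = kap s' r') ->
  x = 0 \/ exists2 a, addable (rcons s' r) a & d = kap (rcons s' r) a.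
Proof.
move=> sp ltn ysr wx xd; have := ysr; rewrite yam_rcons => /andP[ys ar].
have := wx; rewrite wt_rcons => -[wx' xr]; have /andP[r0 _] := ar.
have cr : count_mem r (rcons s' r) = (count_mem r s').+1.
  by rewrite -cats1 count_cat /= eqxx addn1.
have cne a : a != r -> count_mem a (rcons s' r) = count_mem a s'.
  by move=> ne; rewrite -cats1 count_cat /= eq_sym (negbTE ne) !addn0.
(* If the last box of row [a] has content [d] and no box below it, it can be moved to just before
   the final letter. The contents [d], [d - 1] or [d + 1], [d] then follow each other. *)
have move_box a : a \in s' -> kap s' a - 1 = d ->
    (count_mem a.+1 s' < count_mem a s')%N -> d = kap s' r + 1 \/ d = kap s' r - 1 -> x = 0.
  move=> /cat_last_mem[s1 [s2 [E as2]]] dE cnt adj.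
  have yE := ysr; have wE := wx; rewrite E -cats1 -catA /= in yE wE.
  have sE : size s' = (size (s1 ++ s2)).+1 by rewrite E !size_cat /= addnS.
  have pE : perm_eq s' (rcons (s1 ++ s2) a).
    by rewrite E -cats1 -catA perm_cat2l -cat1s perm_catC.
  have kE : kap (s1 ++ s2) a = d.
    by rewrite -dE (kap_perm _ pE) kap_rcons eqxx addrK.
  have [||y [wy y0 yy Hy]] := wt_move as2 _ yE _ wE.
  - move: cnt; rewrite E !count_cat /= eqxx.
    by have -> : (a == a.+1) = false; [lia | move/count_memPn: as2 => ->; lia].
  - by move: ltn; rewrite sE !size_cat /= !size_cat /=; lia.
  apply: y0; have e2 : s1 ++ s2 ++ [:: a; r] = rcons (rcons (s1 ++ s2) a) r.
    by rewrite -!cats1 -!catA.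
  rewrite e2 in yy wy.
  apply: (no_repeated_content _ _ yy wy).
  - by rewrite -sE.
  - by rewrite -sE.
  - rewrite kE -sE; apply: Hy => //.
    by move: sE; rewrite !size_cat /= !size_cat /=; lia.
  - rewrite -(kap_perm _ pE) kE.
    by case: adj => ->; [left; rewrite addrK|right; rewrite subrK].
case=> [dE|[[dE|dE]|[r' ar' [ne dE]]]].
(* Equal consecutive contents would be a Jordan block: [x T (X - b) = - q^d x]. The polynomial that
   kills [x T] has simple roots, so its other factors would have to kill [x], on which they act by
   nonzero scalars. *)
- left; have lti : (0 < (size s').+1 < n)%N by [].
  have wy : wt s' (x * T (size s').+1) by apply: wt_T => //; lia.
  have := sp _ (leqnn _) s' _ ys erefl wy.
  have : qint q d \in next_kappas s'.
    by apply/mapP; exists r; rewrite ?mem_addables // dE.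
  move=> /(@path.splitPr _ _ _); have := uniq_next_kappas ys (ltnW ltn).
  move=> + H; case: H => l1 l2 ul.
  rewrite big_cat big_cons /= mulrA.
  set X := J (size s').+1; set b := qint q d.
  have cX e : GRing.comm (X - e%:A) X.
    apply/commr_sym/commrB => //; exact/comm_scale/commr1.
  have -> : x * T (size s').+1 * \prod_(e <- l1) (X - e%:A) *
     ((X - b%:A) * \prod_(e <- l2) (X - e%:A)) =
     (x * T (size s').+1 * (X - b%:A)) * \prod_(e <- l1 ++ l2) (X - e%:A).
    rewrite big_cat /= !mulrA; congr (_ * _); rewrite -!mulrA; congr (_ * (_ * _)).
    suff C : GRing.comm (X - b%:A) (\prod_(e <- l1) (X - e%:A)) by rewrite C.
    apply: commr_prod => e _.
    by apply: commrB; [apply: cX|apply/comm_scale/commr1].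
  have -> : x * T (size s').+1 * (X - b%:A) = - ((q - 1) * b + 1) *: x.
    have := congr1 (fun z => x * z) (J_succ_T lti).
    rewrite /= -/X !ncE xd !ncE -/b => ->.
    by lin F A; ring.
  rewrite -scalerAl (@eigen_prod X x b) ?scalerA; last by rewrite /b dE.
  move/eqP.
  rewrite scaler_eq0 mulf_eq0 oppr_eq0 (negbTE (qint_pow_neq0 q_neq0 d)) /=.
  case/orP=> [|/eqP//]; rewrite prodf_seq_eq0 => /hasP[e el /=].
  rewrite subr_eq0 => /eqP be; move: ul; rewrite cat_uniq /= => /and3P[_].
  by rewrite -/b be negb_or; move: el; rewrite mem_cat => /orP[el|->]; rewrite ?el ?andbF //.
(* If row [r] cannot grow again, row [r - 1] ends right above the box just added, and that last box
   has content [d]. *)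
- case ars: (addable (rcons s' r) r).
    by right; exists r => //; rewrite dE kap_rcons eqxx.
  left; have [r1 cr1] : r != 1%N /\ (count_mem r s' < count_mem r.-1 s')%N.
    by have := ar; move: ars; rewrite /addable r0 /=; case: eqP.
  have cr2 : count_mem r.-1 s' = (count_mem r s').+1.
    have ner : r.-1 != r by rewrite neq_ltn prednK // leqnn.
    move/negbT: ars; rewrite /addable r0 (negbTE r1) /= cr cne // -leqNgt => le.
    by apply/eqP; rewrite eqn_leq le.
  apply: (move_box r.-1).
  - by rewrite -has_pred1 has_count cr2.
  - by rewrite dE /kap cr2; lia.
  - by rewrite prednK // cr2.
  - by left.
(* If rows [r] and [r + 1] had equal length, row [r + 1] has become addable with content [d].
   Otherwise the previous last box of row [r] has content [d] and no box below it. *)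
- have := yam_count ys r0; rewrite leq_eqVlt => /orP[/eqP cE|lt].
    right; exists r.+1; first by rewrite /addable /= cr cne ?cE ?ltnSn ?orbT //; lia.
    by rewrite dE kap_rcons /kap cE; lia.
  left; apply: (move_box r) => //; last by right.
  by rewrite -has_pred1 has_count; lia.
right; exists r'; last by rewrite kap_rcons eq_sym (negbTE ne) addr0.
move: ar'; rewrite /addable => /andP[-> /orP[->//|lt]] /=; apply/orP; right.
by rewrite cne // (leq_trans lt) // -cats1 count_cat leq_addr.
Qed.

Lemma intertwine_prod (f X Y : A) (es : seq F) : f * X = Y * f ->
  f * \prod_(e <- es) (X - e%:A) = (\prod_(e <- es) (Y - e%:A)) * f.
Proof.
move=> fX; elim: es => [|e es IH]; first by rewrite !big_nil mulr1 mul1r.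
rewrite !big_cons mulrA -[RHS]mulrA -IH mulrA; congr (_ * _).
by rewrite mulrBr mulrBl fX -!(scalerAr, scalerAl) mulr1 mul1r.
Qed.

Lemma spectral0 : spectral 0.
Proof.
move=> [|//] x _ _ _; have -> : next_kappas [::] = [:: 0].
  by rewrite -(qint0 q) -(subrr 1%:Z) -[in 1%:Z - _](add0r 1%:Z).
by rewrite big_seq1 J1 scale0r subrr mulr0.
Qed.

(** The intertwiner carries the polynomial relation for [X1] over to [X2], up to the factor
    [phi * phi]. On this weight space that factor is a quadratic polynomial in [X2] with the roots
    [c + 1]_q and [c - 1]_q; [spectral_excluded] then discards the spurious roots. *)
Lemma spectral_step m : (forall m', (m' <= m)%N -> spectral m') -> (m.+1 < n)%N ->
  spectral m.+1.
Proof.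
move=> sp ltn s x; case/lastP: s => // s' r; rewrite size_rcons => ysr [sm] wx.
have := wx; have := ysr; rewrite wt_rcons yam_rcons => /andP[ys ar] [wx' xr].
rewrite -{}sm in sp ltn *.
have lti : (0 < (size s').+1 < n)%N by [].
set X1 := J (size s').+1 in xr; set X2 := J (size s').+2.
pose phi := intertwiner (size s').+1.
pose Q := \prod_(e <- next_kappas s') (X2 - e%:A).
have pX1 : phi * X1 = X2 * phi by exact: intertwiner_J.
have c12 : GRing.comm X1 X2 by apply: comm_J; lia.
have wphi : wt s' (x * phi).
  apply: wt_comm wx' => k kb; apply: commr_sym.
  have cT : GRing.comm (J k) (T (size s').+1) by apply: commr_sym; apply: comm_J_T_gt; lia.
  have cJ : GRing.comm (J k) X1 by apply: comm_J; lia.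
  by apply: commrB; apply: commrM.
have H4 : x * Q * (phi * phi) = 0.
  have H3 : phi * \prod_(e <- next_kappas s') (X1 - e%:A) = Q * phi.
    exact: intertwine_prod.
  have := sp _ (leqnn _) s' _ ys erefl wphi; rewrite -mulrA H3 => H.
  by rewrite -mulrA (mulrA Q) mulrA H mul0r.
have zX1 : x * Q * X1 = qint q (kap s' r) *: (x * Q).
  have cQ : GRing.comm X1 Q.
    apply: commr_prod => e _.
    by apply: commrB => //; apply/comm_scale/commr1.
  by rewrite -mulrA -cQ mulrA xr -scalerAl.
(* All candidates: the contents addable before the last box, and the two neighbours of its own
   content. They are pairwise distinct, so [x] splits into eigenvectors. *)
pose es := next_kappas s' ++ [:: qint q (kap s' r + 1); qint q (kap s' r - 1)].
have es0 : x * \prod_(e <- es) (X2 - e%:A) = 0.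
  have pair (d d' : F) : \prod_(e <- [:: d; d']) (X2 - e%:A) = (X2 - d%:A) * (X2 - d'%:A).
    by rewrite !big_cons big_nil mulr1.
  rewrite big_cat pair -/Q mulrA.
  apply: (@scalerI _ _ (- q)); first by rewrite oppr_eq0.
  rewrite scaler0 -H4 intertwiner_sqr // -/X1 -/X2.
  rewrite qintD1 // -(qintB1 q_neq0 (kap s' r)).
  rewrite -(qintB1 q_neq0 (kap s' r)) in zX1.
  move: (x * Q) zX1 => z zX1.
  rewrite !ncE ?zX1 ?ncE ?zX1 ?ncE ?zX1 ?ncE.
  by lin F A; ring.
have ues : uniq es.
  have ne a d : addable s' a -> d = kap s' r + 1 \/ d = kap s' r - 1 ->
      qint q d != qint q (kap s' a).
    move=> aa dE; apply: (qint_inj_bounded q_neq0 qint_neq0);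
      by case: (r =P a) => [<-|/eqP ra]; [|have := kap_dist ys ar aa ra]; lia.
  rewrite /es cat_uniq uniq_next_kappas ?(ltnW ltn) //; apply/and3P; split=> //.
    apply/hasPn => e; rewrite mem_seq2 => /orP[]/eqP->; apply/negP => /mapP[a];
      rewrite mem_addables // => aa; apply/eqP; apply: ne => //; first by left.
    by right.
  rewrite cons_uniq mem_seq1 andbT.
  by apply: (qint_inj_bounded q_neq0 qint_neq0); lia.
have [||f [-> Hf]] := @eigen_decomp X2 (wt (rcons s' r)) es x _ _ ues wx es0.
- by move=> a u v; apply: wt_linear.
- move=> u wu; apply: wt_comm wu => k; rewrite size_rcons => kb.
  by apply: comm_J; lia.
rewrite mulr_suml big_seq big1 // => e ees; have [wf fX] := Hf e ees.
have [d eE dE] : exists2 d, e = qint q d &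
    (d = kap s' r \/ (d = kap s' r + 1 \/ d = kap s' r - 1) \/
     exists2 r', addable s' r' & r' != r /\ d = kap s' r').
  move: ees; rewrite mem_cat => /orP[/mapP[r' ]|].
    rewrite mem_addables // => ar' ->; exists (kap s' r') => //.
    by case: (r' =P r) => [->|/eqP ne]; [left|right; right; exists r'].
  rewrite mem_seq2 => /orP[/eqP->|/eqP->]; eexists=> //; right; left; first by left.
  by right.
rewrite eE in wf fX *.
have [->|[a aa da]] := spectral_excluded sp ltn ysr wf fX dE; first by rewrite mul0r.
rewrite (eigen_prod _ fX); set pr := \prod_(_ <- _) _.
have -> : pr = 0; last by rewrite scale0r.
apply/eqP; rewrite prodf_seq_eq0; apply/hasP; exists (qint q d); last by rewrite /= subrr.
by apply/mapP; exists a; rewrite ?mem_addables // da.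
Qed.

Lemma spectral_all m : (m < n)%N -> spectral m.
Proof.
elim/ltn_ind: m => -[_ _|m IH lt]; first exact: spectral0.
by apply: spectral_step => // m' le; apply: IH => //; lia.
Qed.

(** Starting from 1, which has the empty weight, each weight vector splits under the next
    Jucys-Murphy element, so 1 is a sum of weight vectors of length [n]. *)
Lemma weight_ext x y : (forall s v, yam s -> size s = n -> wt s v -> v * x = v * y) ->
  x = y.
Proof.
move=> H; suff K d : (d <= n)%N -> forall s v, yam s -> size s = (n - d)%N -> wt s v ->
    v * x = v * y.
  by rewrite -[x]mul1r -[y]mul1r; apply: (K n _ [::]); rewrite ?subnn.
elim: d => [_ s v ys|d IH lt s v ys sz wv]; first by rewrite subn0; apply: H.
have lts : (size s < n)%N by lia.
have [||f [-> Hf]] := @eigen_decomp (J (size s).+1) (wt s) _ v _ _ (uniq_next_kappas ys lts) wv (spectral_all lts ys erefl wv).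
- by move=> a u w; apply: wt_linear.
- by move=> u; apply: wt_comm => k kb; apply: comm_J; lia.
rewrite !mulr_suml !big_seq; apply: eq_bigr => e ee.
have [wf fX] := Hf e ee; case/mapP: ee => r; rewrite mem_addables // => ar eE.
apply: (IH (ltnW lt) (rcons s r)).
- by rewrite yam_rcons ys.
- by rewrite size_rcons; lia.
- by rewrite wt_rcons; split=> //; rewrite fX eE.
Qed.

Lemma wt_tail s a c t x : wt (s ++ a :: c :: t) x ->
  wt (rcons s a) x /\ x * J (size s).+2 = qint q (kap (rcons s a) c) *: x.
Proof.
rewrite wt_cat => -[ws wt']; have := wt' 0%N isT; have := wt' 1%N isT.
by rewrite /= ?take0 cats0 cats1 addn0 addn1 => E1 E0; rewrite wt_rcons.
Qed.

(** Young's seminormal form for weight vectors. In the third case the generator yields a multiple of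
    [x] plus a vector of the exchanged weight. *)
Lemma swap_action s a c t x : yam (s ++ a :: c :: t) ->
  size (s ++ a :: c :: t) = n -> wt (s ++ a :: c :: t) x ->
  [\/ a = c /\ x * T (size s).+1 = q *: x,
      [/\ c = a.+1, ~~ addable s c & x * T (size s).+1 = - x]
    | [/\ a != c, addable s c, yam (s ++ c :: a :: t) &
      wt (s ++ c :: a :: t) (x * T (size s).+1 - swap_coef s a c *: x)]].
Proof.
move=> ys sz wx; have ltn : ((size s).+1 < n)%N by rewrite -sz size_cat /=; lia.
have ysa : yam (rcons s a).
  by apply: (@yam_catl _ (c :: t)); rewrite cat_rcons.
have [wa xc] := wt_tail wx; have sp : spectral (size s) by apply: spectral_all; lia.
case: (yam_adjacent ys) => [E|[E Ec]|[ne ac yc]].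
- constructor 1; split=> //; apply: (adjacent_action sp ltn ysa wa xc).
  by left; rewrite -E kap_rcons eqxx.
- constructor 2; split=> //; last rewrite -scaleN1r.
    have a0 : (0 < a)%N by apply: (yam_mem_gt0 ys); rewrite mem_cat inE eqxx orbT.
    by rewrite E in Ec *; apply: not_addable_below.
  apply: (adjacent_action sp ltn ysa wa xc).
  right; split=> //; rewrite kap_rcons /kap Ec E.
  by have -> : (a == a.+1) = false; lia.
constructor 3; split=> //.
by have [] := wt_swap ys ac ne ltn _ wx; rewrite ?sz.
Qed.

(** * Projectors onto tableaux and onto shapes *)

Definition pw (s : seq nat) : A :=
  \prod_(1 <= k < (size s).+1)
    \prod_(d <- contents k | (d != kap (take k.-1 s) (nth 0%N s k.-1)) &&
             (qint q (kap (take k.-1 s) (nth 0%N s k.-1)) - qint q d != 0))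
      ((qint q (kap (take k.-1 s) (nth 0%N s k.-1)) - qint q d)^-1 *:
         (J k - (qint q d)%:A)).

(** While the tableaux agree each factor is 1. At the first difference both boxes are addable to the
    same shape, so the content of [s] occurs in [contents] and its denominator is nonzero: the
    factor that kills [x] is never among the omitted ones. *)
Lemma wt_pw s s' x : yam s -> yam s' -> (size s <= n)%N -> (size s' <= size s)%N ->
  wt s x -> x * pw s' = if take (size s') s == s' then x else 0.
Proof.
move=> ys ys' le_n le wx; rewrite /pw big_add1 /=.
pose c k := kap (take k s) (nth 0%N s k).
pose c' k := kap (take k s') (nth 0%N s' k).
pose f k := \prod_(d <- contents k.+1 | (d != c' k) && (qint q (c' k) - qint q d != 0))
    ((qint q (c' k) - qint q d)^-1 * (qint q (c k) - qint q d)).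
suff [E Ef] : x * pw s' = \prod_(0 <= k < size s') f k *: x /\
    \prod_(0 <= k < size s') f k = (take (size s') s == s')%:R.
  move: E; rewrite /pw big_add1 /= => ->; rewrite Ef.
  by case: eqP; rewrite ?scale1r ?scale0r.
split.
  rewrite /pw big_add1 /=; elim: (size s') le => [|m IH] lt.
    by rewrite !big_nil mulr1 scale1r.
  rewrite !big_nat_recr //= mulrA IH 1?ltnW // -scalerAl -scalerA; congr (_ *: _).
  rewrite /f -/(c' m); elim/big_rec2: _ => [|d y1 y2 _ E]; first by rewrite mulr1 scale1r.
  rewrite mulrA -scalerAr mulrBr wx // -/(c m) -scalerAr mulr1 -scalerBl.
  by rewrite scalerA -scalerAl E scalerA.
have take_eq m : (m <= size s')%N ->
    \prod_(0 <= k < m) f k = (take m s == take m s')%:R.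
  elim: m => [|m IH] lt; first by rewrite big_nil !take0 eqxx.
  rewrite big_nat_recr //= IH 1?ltnW //.
  rewrite (take_nth 0%N) 1?(take_nth 0%N) ?(leq_trans lt) // eqseq_rcons.
  case: eqP => [E|_] /=; last by rewrite mul0r.
  rewrite mul1r; case: eqP => [En|/eqP En] /=.
    by rewrite /f /c E En -/(c' m) big1 // => d /andP[_ nz]; rewrite mulVf.
  have yt : yam (take m s') by apply: yam_take.
  have aa : addable (take m s') (nth 0%N s m) by rewrite -E; apply/yamP => //; lia.
  have aa' : addable (take m s') (nth 0%N s' m) by apply/yamP.
  have st : size (take m s') = m by rewrite size_takel // ltnW.
  have kd := kap_dist yt aa aa' En.
  rewrite st in kd; apply/eqP; rewrite /f prodf_seq_eq0; apply/hasP; exists (c m).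
    by rewrite /c E -[X in contents X.+1]st contents_kap.
  rewrite /= subrr mulr0 eqxx andbT subr_eq0 /c E /c'.
  have ne : kap (take m s') (nth 0%N s m) != kap (take m s') (nth 0%N s' m).
    by apply: contraTneq kd => ->; rewrite subrr.
  rewrite ne /= eq_sym; apply: (qint_inj_bounded q_neq0 qint_neq0) => //.
  by apply: leq_trans (proj2 (andP kd)) _; lia.
by rewrite take_eq // (take_size s').
Qed.

Lemma wt_pw_full s s' x : yam s -> yam s' -> size s = n -> size s' = n ->
  wt s x -> x * pw s' = if s == s' then x else 0.
Proof.
move=> ys ys' sz sz' wx; rewrite (wt_pw ys ys' _ _ wx) ?sz ?sz' //.
by rewrite -sz take_size.
Qed.

Lemma split_two (s : seq nat) i : (i.+1 < size s)%N ->
  exists s1 a c t, s = s1 ++ a :: c :: t /\ size s1 = i.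
Proof.
move=> lt; exists (take i s), (nth 0%N s i), (nth 0%N s i.+1), (drop i.+2 s).
by rewrite -drop_nth // -drop_nth ?cat_take_drop ?size_takel // ?(ltnW lt) // ltnW // ltnW.
Qed.

(** A generator takes weight [r] into the sum of weight [r] and its exchange, and neither of these
    is the weight selected by the projector. *)
Lemma wt_T_pw_other s a c t r x : yam (s ++ a :: c :: t) ->
  size (s ++ a :: c :: t) = n -> yam r -> size r = n -> wt r x ->
  r != s ++ a :: c :: t -> r != s ++ c :: a :: t ->
  x * T (size s).+1 * pw (s ++ a :: c :: t) = 0.
Proof.
move=> ys sz yr sr wx ne ne'.
have [s1 [a1 [c1 [t1 [rE s1E]]]]] : exists s1 a1 c1 t1,
    r = s1 ++ a1 :: c1 :: t1 /\ size s1 = size s.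
  by apply: split_two; rewrite sr -sz size_cat /=; lia.
rewrite rE in yr sr wx ne ne'.
have xp : x * pw (s ++ a :: c :: t) = 0.
  by rewrite (wt_pw_full yr ys sr sz wx) (negbTE ne).
rewrite -s1E; case: (swap_action yr sr wx) => [[_ ->]|[_ _ ->]|[_ _ yr' wy]].
- by rewrite -scalerAl xp scaler0.
- by rewrite mulNr xp oppr0.
have sr' : size (s1 ++ c1 :: a1 :: t1) = n by rewrite -sr !size_cat.
have := wt_pw_full yr' ys sr' sz wy; rewrite mulrBl -scalerAl xp scaler0 subr0 => ->.
case: eqP => // /eqP; rewrite eqseq_cat // !eqseq_cons.
by move=> /and4P[/eqP E1 /eqP E2 /eqP E3 /eqP E4]; rewrite E1 E2 E3 E4 eqxx in ne'.
Qed.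

(** The seminormal form transported to projectors with [weight_ext]. The left version evaluates
    words, as in [v T p]; the right version shows that the Specht module is stable. *)
Lemma T_pw s a c t : yam (s ++ a :: c :: t) -> size (s ++ a :: c :: t) = n ->
  let p := pw (s ++ a :: c :: t) in let p' := pw (s ++ c :: a :: t) in
  let i := (size s).+1 in
  [\/ [/\ a = c, T i * p = q *: p & p * T i = q *: p],
      [/\ c = a.+1, ~~ addable s c, T i * p = - p & p * T i = - p]
   | [/\ a != c, addable s c, yam (s ++ c :: a :: t),
         T i * p = swap_coef s a c *: p + p' * T i * p
       & p * T i = swap_coef s a c *: p + p * T i * p']].
Proof.
move=> ys sz p p' i.
have pE r x (yr : yam r) (sr : size r = n) (wx : wt r x) :
    x * p = if r == s ++ a :: c :: t then x else 0 by apply: wt_pw_full.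
case: (yam_adjacent ys) => [E|[E Ec]|[ne ac ys']].
- constructor 1; split=> //; apply: weight_ext => r x yr sr wx; rewrite mulrA.
    rewrite -scalerAr (pE r x) //; case: eqP => [rE|/eqP ne].
      have := wx; rewrite rE => wx'; case: (swap_action ys sz wx') => [[_ xT]|[E']|[]];
        rewrite ?E ?eqxx //; last by lia.
      by rewrite xT -scalerAl (pE r x) // rE eqxx.
    by rewrite scaler0; apply: (wt_T_pw_other ys sz yr sr wx); rewrite // -{1}E E in ne *.
  rewrite (pE r x) // -scalerAr (pE r x) //; case: eqP => [rE|_]; last by rewrite mul0r scaler0.
  have := wx; rewrite rE => wx'; case: (swap_action ys sz wx') => [[_ ->]|[]|[]] //;
    rewrite ?E ?eqxx //; lia.
- have nac : ~~ addable s c.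
    have a0 : (0 < a)%N by apply: (yam_mem_gt0 ys); rewrite mem_cat inE eqxx orbT.
    by rewrite E in Ec *; apply: not_addable_below.
  constructor 2; split=> //; apply: weight_ext => r x yr sr wx; rewrite mulrA.
    rewrite mulrN (pE r x) //; case: eqP => [rE|/eqP ne].
      have := wx; rewrite rE => wx'; case: (swap_action ys sz wx') => [[E']|[_ _ xT]|[_ ac _ _]];
        [by lia| |by rewrite ac in nac].
      by rewrite xT mulNr (pE r x) // rE eqxx.
    rewrite oppr0; apply: (wt_T_pw_other ys sz yr sr wx) => //.
    apply: contraNneq nac => rE; move: yr; rewrite rE -cat_rcons => /yam_catl.
    by rewrite yam_rcons => /andP[].
  rewrite (pE r x) // mulrN (pE r x) //; case: eqP => [rE|_]; last by rewrite mul0r oppr0.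
  have := wx; rewrite rE => wx'; case: (swap_action ys sz wx') => [[E']|[_ _ ->]|[_ ac _ _]] //;
    [by lia|by rewrite ac in nac].
have sz' : size (s ++ c :: a :: t) = n by rewrite -sz !size_cat.
have nes : (s ++ a :: c :: t == s ++ c :: a :: t) = false.
  by rewrite eqseq_cat // eqxx /= eqseq_cons (negbTE ne).
have pE' r x (yr : yam r) (sr : size r = n) (wx : wt r x) :
    x * p' = if r == s ++ c :: a :: t then x else 0 by apply: wt_pw_full.
have act x : wt (s ++ a :: c :: t) x -> exists2 y, x * T i = swap_coef s a c *: x + y &
    wt (s ++ c :: a :: t) y.
  move=> wx; case: (swap_action ys sz wx) => [[E _]|[_ nac _]|[_ _ _ wy]].
  - by rewrite E eqxx in ne.
  - by rewrite ac in nac.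
  by exists (x * T i - swap_coef s a c *: x) => //; rewrite addrC subrK.
constructor 3; split=> //; apply: weight_ext => r x yr sr wx.
  rewrite mulrA mulrDr -scalerAr !mulrA (pE r x) // (pE' r x) //.
  case: eqP => [rE|/eqP ner].
    rewrite rE nes !mul0r addr0; have := wx; rewrite rE => /act[y -> wy].
    by rewrite mulrDl -scalerAl (pE r x) // rE eqxx (pE _ y ys' sz' wy) eq_sym nes addr0.
  rewrite scaler0 add0r; case: eqP => [//|/eqP ner'].
  by rewrite !mul0r; apply: (wt_T_pw_other ys sz yr sr wx).
rewrite mulrDr -scalerAr !mulrA (pE r x) //; case: eqP => [rE|_]; last first.
  by rewrite !mul0r scaler0 addr0.
have := wx; rewrite rE => wx'; have [y -> wy] := act x wx'.
by rewrite mulrDl -scalerAl (pE' _ x ys sz wx') nes scaler0 add0r (pE' _ y ys' sz' wy) eqxx.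
Qed.

(* P acts on the right as the projection onto the weight spaces whose tableau
   has after m steps a shape satisfying c. *)
Definition shape_projector (m : nat) (c : pred (seq nat)) (P : A) : Prop :=
  forall s x, yam s -> size s = n -> wt s x ->
    x * P = if c (take m s) then x else 0.

(** Exchanging two of the first [m] entries leaves the shape after [m] steps unchanged, so [T i]
    preserves the image and the kernel of the projection. *)
Lemma shape_projector_T m c P i : shape_projector m c P ->
  (forall s s', perm_eq s s' -> c s = c s') -> (0 < i < m)%N -> (m <= n)%N ->
  GRing.comm (T i) P.
Proof.
move=> HP cperm /andP[]; case: i => // i _ lt le.
apply: weight_ext => r x yr sr wx; rewrite !mulrA.
have [s [a [d [t [rE sE]]]]] : exists s a d t, r = s ++ a :: d :: t /\ size s = i.
  by apply: split_two; rewrite sr; lia.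
rewrite rE in yr sr wx *; rewrite (HP _ x yr sr wx).
have cE : c (take m (s ++ a :: d :: t)) = c (take m (s ++ d :: a :: t)).
  apply: cperm; rewrite !take_cat; case: ltnP => [|_]; first by lia.
  have -> : (m - size s = (m - size s).-2.+2)%N by lia.
  by rewrite /= perm_swap.
have := swap_action yr sr wx; rewrite sE.
case=> [[_ xT]|[_ _ xT]|[_ _ yr' wy]].
- rewrite xT -scalerAl (HP _ x yr sr wx).
  by case: ifP; rewrite ?xT ?mul0r ?scaler0.
- rewrite xT mulNr (HP _ x yr sr wx).
  by case: ifP; rewrite ?xT ?mul0r ?oppr0.
have sr' : size (s ++ d :: a :: t) = n by rewrite -sr !size_cat.
have := HP _ _ yr' sr' wy; rewrite mulrBl -scalerAl (HP _ x yr sr wx) -cE.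
by case: ifP => _ /eqP; rewrite ?scaler0 ?subr0 ?mul0r ?subr_eq ?subrK => /eqP.
Qed.

(** The product selects the tableaux that pass through both shapes; these differ by one box, whose
    content is then a constant. *)
Lemma shape_projector_J m c c' P P' (d : int) :
  (m < n)%N -> shape_projector m c P -> shape_projector m.+1 c' P' ->
  (forall s r, yam (rcons s r) -> size s = m -> c s -> c' (rcons s r) -> kap s r = d) ->
  P * P' * J m.+1 = qint q d *: (P * P').
Proof.
move=> lt HP HP' Hd; apply: weight_ext => s x ys sz wx.
rewrite -scalerAr !mulrA (HP s x) //; case: ifP => [cs|_]; last by rewrite !mul0r scaler0.
rewrite (HP' s x) //; case: ifP => [cs'|_]; last by rewrite !mul0r scaler0.
rewrite wx ?sz //; congr (qint q _ *: _); apply: Hd => //.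
- by rewrite -take_nth ?sz //; apply: yam_take.
- by rewrite size_takel // sz ltnW.
- by rewrite -take_nth ?sz.
Qed.

Lemma shape_projector_idem m c P : shape_projector m c P -> P * P = P.
Proof.
move=> HP; apply: weight_ext => s x ys sz wx.
by rewrite mulrA (HP s x) //; case: ifP => E; rewrite ?mul0r // (HP s x) // E.
Qed.

Lemma shape_projector_comm m m' c c' P P' :
  shape_projector m c P -> shape_projector m' c' P' -> GRing.comm P P'.
Proof.
move=> HP HP'; apply: weight_ext => s x ys sz wx.
rewrite !mulrA (HP s x) // (HP' s x) //.
by case: ifP => E; case: ifP => E'; rewrite ?mul0r // ?(HP s x) ?(HP' s x) ?E ?E'.
Qed.

Lemma shape_projector_sub m c c' P P' :
  shape_projector m c P -> shape_projector m c' P' ->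
  (forall s, c s -> c' s) -> P * P' = P.
Proof.
move=> HP HP' cc'; apply: weight_ext => s x ys sz wx.
by rewrite mulrA (HP s x) //; case: ifP => E; rewrite ?mul0r // (HP' s x) // cc'.
Qed.

Lemma pw_projector s : yam s -> (size s <= n)%N ->
  shape_projector (size s) (pred1 s) (pw s).
Proof. by move=> ys le r x yr sr wx; apply: wt_pw; rewrite ?sr. Qed.

End HeckeRelations.

Section HeckeElements.
Local Open Scope quotient_scope.
Context (F : fieldType) (q : F) (n : nat).
Local Notation H := (hecke q n).
Local Notation T := (Tgen q n).

Lemma TgenE i (lt : (0 < i < n)%N) : T i = \pi_H (HGen (Sub i lt : gidx n)).
Proof. by rewrite /Tgen insubT. Qed.

Lemma Tgen_quad i : (0 < i < n)%N -> T i * T i = (q - 1) *: T i + q *: 1.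
Proof.
move=> lt; rewrite TgenE -[LHS]/(hmul _ _) hmul_pi.
rewrite -[RHS]/(hadd (hscale _ _) (hscale _ (\pi_H HOne))) !hscale_pi hadd_pi.
by apply/hpiP/heq_quad.
Qed.

Lemma Tgen_far i j : (0 < i)%N -> (i.+1 < j < n)%N -> T i * T j = T j * T i.
Proof.
move=> i0 lt; have li : (0 < i < n)%N by lia.
have lj : (0 < j < n)%N by lia.
rewrite (TgenE li) (TgenE lj) -[LHS]/(hmul _ _) -[RHS]/(hmul _ _) !hmul_pi.
by apply/hpiP/heq_far => /=; lia.
Qed.

Lemma Tgen_braid i : (0 < i)%N -> (i.+1 < n)%N ->
  T i * T i.+1 * T i = T i.+1 * T i * T i.+1.
Proof.
move=> i0 lt; have li : (0 < i < n)%N by lia.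
have lj : (0 < i.+1 < n)%N by lia.
rewrite (TgenE li) (TgenE lj) -[LHS]/(hmul (hmul _ _) _) -[RHS]/(hmul (hmul _ _) _).
by rewrite !hmul_pi; apply/hpiP/heq_braid.
Qed.

Lemma Ttransp_recl i k : (i < k)%N ->
  Ttransp q n i k.+1 = T i * Ttransp q n i.+1 k.+1 * T i.
Proof.
move=> lt; rewrite /Ttransp /= big_ltn; last by lia.
have -> : index_iota i k = i :: index_iota i.+1 k.
  by rewrite /index_iota; have -> : (k - i = (k - i.+1).+1)%N by lia.
by rewrite rev_cons -cats1 big_cat big_seq1 /= !mulrA.
Qed.

Lemma Ttransp_adjacent k : Ttransp q n k k.+1 = T k.
Proof. by rewrite /Ttransp big_nat1 /index_iota subnn big_nil mulr1. Qed.

(** The defining expression is a conjugation by the lowest generator, the recursion for [JM] needs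
    the highest one. Induction on [k - i] passes from one to the other, with the braid relation as
    its base. *)
Lemma Ttransp_recr i k : (0 < i < k)%N -> (k < n)%N ->
  Ttransp q n i k.+1 = T k * Ttransp q n i k * T k.
Proof.
case: k => [|k /andP[i0 le] lt]; first by rewrite ltn0 andbF.
move dE: (k - i)%N => d; elim: d i i0 le dE => [|d IH] i i0 le dE.
  have -> : i = k by lia.
  by rewrite Ttransp_recl // !Ttransp_adjacent -Tgen_braid //; lia.
rewrite Ttransp_recl ?IH; try lia.
rewrite [in RHS]Ttransp_recl; last by lia.
have c : T i * T k.+1 = T k.+1 * T i by apply: Tgen_far; lia.
by rewrite !mulrA c -!mulrA -c.
Qed.

Lemma JM_1 : JM q n 1 = 0.
Proof. by rewrite /JM big_geq. Qed.

Lemma JM_succ k : (0 < k < n)%N -> JM q n k.+1 = q^-1 *: (T k * JM q n k * T k + T k).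
Proof.
move=> /andP[k0 lt]; rewrite /JM big_nat_recr //= subSn // subnn expr1.
rewrite Ttransp_adjacent scalerDr; congr (_ + _).
rewrite mulr_sumr mulr_suml scaler_sumr big_nat_cond [RHS]big_nat_cond.
apply: eq_bigr => i /andP[/andP[i0 ik] _].
rewrite Ttransp_recr ?i0 // -scalerAr -scalerAl scalerA; congr (_ *: _).
by rewrite subSn ?exprS ?invfM // ltnW.
Qed.

Lemma Bop_1 : Bop q n 1 = 1.
Proof. by rewrite /Bop big_nat1 /index_iota subnn big_nil. Qed.

Lemma Bstar_1 : Bstar q n 1 = 1.
Proof. by rewrite /Bstar big_nat1 big_geq. Qed.

Lemma Bop_succ m : Bop q n m.+1 = 1 + T m * Bop q n m.
Proof.
rewrite /Bop big_nat_recr //= addrC mulr_sumr {1}/index_iota subnn big_nil.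
congr (_ + _); rewrite big_nat_cond [RHS]big_nat_cond.
apply: eq_bigr => i /andP[/andP[i0 im] _].
have -> : index_iota i m.+1 = rcons (index_iota i m) m.
  rewrite /index_iota subSn // -addn1 iotaD cats1; congr rcons.
  by rewrite subnKC.
by rewrite rev_rcons big_cons.
Qed.

Lemma Bstar_succ m : Bstar q n m.+1 = 1 + Bstar q n m * T m.
Proof.
rewrite /Bstar big_nat_recr //= addrC mulr_suml [X in X + _]big_geq //.
congr (_ + _); rewrite big_nat_cond [RHS]big_nat_cond.
by apply: eq_bigr => i /andP[/andP[i0 im] _]; rewrite big_nat_recr.
Qed.

End HeckeElements.

(** * Standard tableaux and lattice words *)

Section SkewTableaux.
Context (N : nat).
Implicit Types (t : filling N) (D E : {set box N}).

Definition young D : Prop := forall x, x \in D -> [/\ (0 < x.1)%N, (0 < x.2)%N &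
  forall y : box N, (0 < y.1 <= x.1)%N -> (0 < y.2 <= x.2)%N -> y \in D].

Definition rowlen D (r : nat) : nat := #|[set x in D | x.1 == r :> nat]|.

Lemma card_ord_range (m : nat) : (m <= N)%N -> #|[set c : 'I_N.+1 | (0 < c <= m)%N]| = m.
Proof.
move=> le; rewrite -[RHS](size_iota 1 m) cardE -(size_map val).
apply/perm_size/uniq_perm; rewrite ?iota_uniq //.
  by rewrite map_inj_uniq ?enum_uniq //; apply: val_inj.
move=> k; rewrite mem_iota add1n ltnS; apply/mapP/idP => [[c]|kb].
  by rewrite mem_enum inE => H ->.
have lt : (k < N.+1)%N by lia.
by exists (Ordinal lt); rewrite // mem_enum inE.
Qed.

Lemma young_mem D (x : box N) : young D ->
  (x \in D) = (0 < x.1)%N && (0 < x.2 <= rowlen D x.1)%N.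
Proof.
case: x => r c /= yD; pose S := [set c' : 'I_N.+1 | (r, c') \in D].
have -> : rowlen D r = #|S|.
  rewrite /rowlen -(card_imset S (_ : injective (fun c' => (r, c')))); last by move=> ? ? [].
  apply: eq_card => -[r' c']; rewrite !inE /=; apply/andP/imsetP => [[xD /eqP/val_inj E]|[c'']].
    by exists c'; rewrite ?inE -E.
  by rewrite inE => H [-> ->].
apply/idP/idP => [xD|/and3P[r0 c0 cS]].
  have [/= r0 c0 H] := yD _ xD; rewrite r0 c0 /=.
  rewrite -[X in (X <= _)%N](@card_ord_range c); last by rewrite -ltnS.
  by apply/subset_leq_card/subsetP => c'; rewrite !inE => cb; apply: H; rewrite /= ?r0 ?leqnn.
apply: contraLR cS => nD; rewrite -ltnNge -[X in (_ < X)%N](@prednK c) // ltnS.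
rewrite -(@card_ord_range c.-1); last by rewrite (leq_trans (leq_pred _)) // -ltnS.
apply/subset_leq_card/subsetP => c'; rewrite !inE => cD.
have [/= _ c'0 H] := yD _ cD; rewrite c'0 /= -ltnS prednK // ltnNge.
by apply: contra nD => le; apply: H; rewrite /= ?r0 ?leqnn ?c0.
Qed.

Lemma rowlen_set1U D (x : box N) r : x \notin D ->
  rowlen (x |: D) r = ((x.1 == r :> nat) + rowlen D r)%N.
Proof.
move=> xD; rewrite /rowlen; case: (x.1 =P r :> nat) => E.
  rewrite (_ : [set _ in _ | _] = x |: [set y in D | y.1 == r :> nat]).
    by rewrite cardsU1 inE (negbTE xD).
  by apply/setP => y; rewrite !inE; case: (y =P x) => //= ->; rewrite E eqxx.
rewrite add0n; apply: eq_card => y; rewrite !inE; case: (y =P x) => //= ->.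
by rewrite (negbTE xD); apply/eqP.
Qed.

Lemma rowlen0 r : rowlen set0 r = 0%N.
Proof. by apply/eqP; rewrite cards_eq0; apply/eqP/setP => x; rewrite !inE. Qed.

Section Filling.
Variables (E D : {set box N}) (j n : nat) (t : filling N).
Hypotheses (yE : young E) (yED : young (E :|: D)) (dED : [disjoint E & D]).
Hypothesis tD : t \in SYT D j n.
Hypothesis nN : (n <= N)%N.

Lemma SYT_range x : x \in D -> (j < t x <= n)%N.
Proof. by move=> xD; move: tD; rewrite inE => /and4P[/forallP/(_ x)]; rewrite xD. Qed.

Lemma SYT_out x : x \notin D -> t x = 0%N :> nat.
Proof.
by move=> /negbTE xD; move: tD; rewrite inE => /and4P[/forallP/(_ x)]; rewrite xD => /eqP.
Qed.

Lemma SYT_mem x : (0 < t x)%N = (x \in D).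
Proof.
case xD: (x \in D); last by rewrite SYT_out ?xD.
by have /andP[lt _] := SYT_range xD; rewrite (leq_ltn_trans _ lt).
Qed.

Lemma SYT_uniq k : (j < k <= n)%N -> exists2 x, x \in D &
  t x = k :> nat /\ forall y, t y = k :> nat -> y = x.
Proof.
move=> kb; have lt : (k < N.+1)%N by case/andP: kb => _ kn; rewrite ltnS (leq_trans kn).
move: (tD); rewrite inE => /and4P[_ /forallP/(_ (Ordinal lt)) + _ _].
rewrite /= kb => /cards1P[x xE]; have tE y : (t y == k :> nat) = (y == x).
  by rewrite -in_set1 -xE inE -val_eqE.
have tx : t x = k :> nat by apply/eqP; rewrite tE.
exists x; first by rewrite -SYT_mem tx; case/andP: kb => + _; apply: leq_ltn_trans.
by split=> // y /eqP; rewrite tE => /eqP.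
Qed.

Lemma SYT_row x y : x \in D -> y \in D -> x.1 = y.1 -> (x.2 < y.2)%N -> (t x < t y)%N.
Proof.
move=> xD yD e lt; move: (tD); rewrite inE => /and4P[_ _ /forall_inP/(_ x xD) + _].
by move/forall_inP/(_ y yD)/implyP; apply; rewrite e eqxx.
Qed.

Lemma SYT_col x y : x \in D -> y \in D -> x.2 = y.2 -> (x.1 < y.1)%N -> (t x < t y)%N.
Proof.
move=> xD yD e lt; move: (tD); rewrite inE => /and4P[_ _ _ /forall_inP/(_ x xD)].
by move/forall_inP/(_ y yD)/implyP; apply; rewrite e eqxx.
Qed.

Lemma box_ofP k : (j < k <= n)%N -> box_of t k \in D /\ t (box_of t k) = k :> nat.
Proof.
move=> kb; have [x xD [tx ux]] := SYT_uniq kb; rewrite /box_of.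
case: pickP => [y /eqP ty|/(_ x)]; last by rewrite tx eqxx.
by rewrite /= (ux y ty).
Qed.

Lemma box_of_val x : x \in D -> box_of t (t x) = x.
Proof.
move=> xD; have [y yD [ty uy]] := SYT_uniq (SYT_range xD).
by have [_ /uy->] := box_ofP (SYT_range xD); rewrite -(uy x).
Qed.

Lemma mem_shape_upto k x : (x \in shape_upto E t k) = (x \in E) || (x \in D) && (t x <= k)%N.
Proof. by rewrite !inE SYT_mem. Qed.

Lemma shape_upto_start : shape_upto E t j = E.
Proof.
apply/setP => x; rewrite mem_shape_upto; case xD: (x \in D); last by rewrite orbF.
by have /andP[lt _] := SYT_range xD; rewrite leqNgt lt orbF.
Qed.

Lemma shape_upto_end : shape_upto E t n = E :|: D.
Proof.
apply/setP => x; rewrite mem_shape_upto inE; case xD: (x \in D) => //=.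
by have /andP[_ ->] := SYT_range xD.
Qed.

Lemma shape_upto_succ k : (j <= k < n)%N ->
  shape_upto E t k.+1 = box_of t k.+1 |: shape_upto E t k /\
  box_of t k.+1 \notin shape_upto E t k.
Proof.
move=> kb; have [bD tb] := @box_ofP k.+1 kb.
have bE : box_of t k.+1 \notin E by rewrite (disjointFl dED).
split; last by rewrite mem_shape_upto (negbTE bE) bD tb ltnn.
apply/setP => x; rewrite in_setU1 !mem_shape_upto.
case: (x =P _) => [->|ne]; first by rewrite bD tb leqnn orbT.
case xD: (x \in D) => //=; rewrite [in LHS]leq_eqVlt ltnS.
case: (t x =P k.+1 :> nat) => //= tx; case: ne.
by rewrite -tx box_of_val.
Qed.

Lemma young_shape_upto k : young (shape_upto E t k).
Proof.
move=> x; rewrite mem_shape_upto => xk.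
have xED : x \in E :|: D by rewrite inE; case/orP: xk => [->//|/andP[-> _]]; rewrite orbT.
have [x1 x2 H] := yED xED; split=> // y y1 y2; rewrite mem_shape_upto.
case yE': (y \in E) => //=; have := H y y1 y2; rewrite inE yE' /= => yD; rewrite yD /=.
have xE : x \notin E by apply: contraFN yE' => /yE[_ _]; apply.
move: xk; rewrite (negbTE xE) /= => /andP[xD]; apply: leq_trans.
(* The corner in the row of [x] and the column of [y]: entries increase down the column from [y] to
   it and along the row from it to [x]. *)
have zED : (x.1, y.2) \in E :|: D by apply: H => //=; rewrite ?x1 ?leqnn.
have zE : (x.1, y.2) \notin E.
  by apply: contraFN yE' => /yE[_ _]; apply=> //=; case/andP: y2 => -> _ /=.
have zD : (x.1, y.2) \in D by move: zED; rewrite inE (negbTE zE).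
apply: (@leq_trans (t (x.1, y.2))).
  case/andP: y1 => _; rewrite leq_eqVlt => /orP[/eqP/val_inj e|lt].
    by rewrite -e -surjective_pairing.
  by apply/ltnW/SYT_col.
case/andP: y2 => _; rewrite leq_eqVlt => /orP[/eqP/val_inj e|lt].
  by rewrite e -surjective_pairing.
by apply/ltnW/SYT_row.
Qed.

Lemma box_of_col k : (j <= k < n)%N ->
  (box_of t k.+1).2 = (rowlen (shape_upto E t k) (box_of t k.+1).1).+1 :> nat.
Proof.
move=> kb; have [sE nb] := shape_upto_succ kb.
have := young_mem (box_of t k.+1) (@young_shape_upto k).
rewrite (negbTE nb) => /esym H.
have := young_mem (box_of t k.+1) (@young_shape_upto k.+1).
rewrite sE setU11 rowlen_set1U // eqxx => /esym/and3P[b1 b2 b3].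
by move: H; rewrite b1 b2 /=; lia.
Qed.

Lemma box_of_addable k : (j <= k < n)%N -> (0 < (box_of t k.+1).1)%N /\
  ((box_of t k.+1).1 = 1%N :> nat \/
   (rowlen (shape_upto E t k) (box_of t k.+1).1 <
    rowlen (shape_upto E t k) (box_of t k.+1).1.-1)%N).
Proof.
move=> kb; have [sE nb] := shape_upto_succ kb; have cE := box_of_col kb.
have := young_mem (box_of t k.+1) (@young_shape_upto k.+1).
rewrite sE setU11 => /esym/andP[b1 /andP[b2 _]]; split=> //.
case: (ltnP 1 (box_of t k.+1).1) => [lt|le]; [right|left; lia].
have ltN : ((box_of t k.+1).1.-1 < N.+1)%N.
  exact: leq_ltn_trans (leq_pred _) (ltn_ord _).
pose x : box N := (Ordinal ltN, (box_of t k.+1).2).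
have : x \in shape_upto E t k.+1.
  have bE : box_of t k.+1 \in shape_upto E t k.+1 by rewrite sE setU11.
  have [_ _ H] := young_shape_upto bE.
  by apply: H => /=; lia.
rewrite sE in_setU1 => /orP[/eqP e|].
  by have := congr1 (fun y : box N => val y.1) e; rewrite /=; lia.
by rewrite (young_mem _ (@young_shape_upto k)) /= => /and3P[_ _]; rewrite cE.
Qed.

End Filling.

Definition rows t (m : nat) : seq nat := [seq (row_of t k : nat) | k <- iota 1 m].

Lemma size_rows t m : size (rows t m) = m.
Proof. by rewrite size_map size_iota. Qed.

Lemma rows_succ t m : rows t m.+1 = rcons (rows t m) (row_of t m.+1).
Proof. by have := iotaD 1 m 1; rewrite addn1 [iota (1 + m) 1]/= cats1 /rows => ->; rewrite map_rcons. Qed.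

Lemma take_rows t m k : (k <= m)%N -> take k (rows t m) = rows t k.
Proof. by move=> le; rewrite /rows -map_take take_iota (minn_idPl le). Qed.

Lemma nth_rows t m k : (k < m)%N -> nth 0%N (rows t m) k = row_of t k.+1.
Proof. by move=> lt; rewrite (nth_map 0%N) ?size_iota // nth_iota // add1n. Qed.

Lemma young0 : young set0.
Proof. by move=> x; rewrite inE. Qed.

Lemma disjoint0s D : [disjoint set0 & D].
Proof. by apply/pred0P => x; rewrite /= inE. Qed.

Section Straight.
Variables (D : {set box N}) (m : nat) (t : filling N).
Hypotheses (yD : young D) (tD : t \in SYT D 0 m) (mN : (m <= N)%N).

Local Lemma yD0 : young (set0 :|: D). Proof. by rewrite set0U. Qed.

Lemma count_rows_upto k r : (k <= m)%N ->
  count_mem r (rows t k) = rowlen (shape_upto set0 t k) r.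
Proof.
elim: k => [_|k IH lt].
  by rewrite (shape_upto_start set0 tD) rowlen0.
have [-> nb] := shape_upto_succ (disjoint0s D) tD mN (lt : (0 <= k < m)%N).
by rewrite rowlen_set1U // rows_succ -cats1 count_cat /= addn0 addnC IH // ltnW.
Qed.

Lemma yam_rows k : (k <= m)%N -> yam (rows t k).
Proof.
elim: k => // k IH lt; rewrite rows_succ yam_rcons IH 1?ltnW //=.
have [b1 b2] := box_of_addable young0 yD0 (disjoint0s D) tD mN (lt : (0 <= k < m)%N).
have lek := ltnW lt; rewrite /addable b1 !(count_rows_upto _ lek) /=.
by apply/orP; case: b2 => [/eqP|]; [left|right].
Qed.

Lemma count_rows_shape r : count_mem r (rows t m) = rowlen D r.
Proof.
by rewrite count_rows_upto // (shape_upto_end set0 tD) set0U.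
Qed.

Lemma box_of_rows k : (k < m)%N ->
  (box_of t k.+1).2 = (count_mem (row_of t k.+1 : nat) (rows t k)).+1 :> nat.
Proof.
move=> lt; rewrite count_rows_upto 1?ltnW //.
exact: (box_of_col young0 yD0 (disjoint0s D) tD mN (lt : (0 <= k < m)%N)).
Qed.

Lemma kap_rows k : (k < m)%N -> kap (rows t k) (row_of t k.+1) = content_of t k.+1.
Proof. by move=> lt; rewrite /kap /content_of box_of_rows // /row_of; lia. Qed.

End Straight.

(** The column of an entry is one more than the number of smaller entries in its row, so the rows
    determine the tableau. *)
Lemma rows_inj D m t t' : young D -> (m <= N)%N -> t \in SYT D 0 m ->
  t' \in SYT D 0 m -> rows t m = rows t' m -> t = t'.
Proof.
move=> yD mN tD tD' E; apply/ffunP => x; apply: val_inj => /=.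
case xD: (x \in D); last by rewrite !(SYT_out tD) ?(SYT_out tD') ?xD.
have lt := SYT_range tD xD; have := box_of_val tD mN xD.
case tx: (t x : nat) lt => [|k] lt //.
have rE : row_of t k.+1 = row_of t' k.+1.
  by apply: val_inj; rewrite /= -!(@nth_rows _ m) // E.
have bE : box_of t k.+1 = box_of t' k.+1.
  rewrite [LHS]surjective_pairing [RHS]surjective_pairing; congr (_, _); first exact: rE.
  apply: val_inj; rewrite /= (box_of_rows yD tD mN) // (box_of_rows yD tD' mN) //.
  have lek : (k <= m)%N := ltnW lt.
  by rewrite rE -(take_rows t lek) E take_rows.
by move=> <-; rewrite bE; have [_ ->] := box_ofP tD' mN lt.
Qed.

Definition diag_of (s : seq nat) : {set box N} :=
  [set x : box N | (0 < x.1)%N && (0 < x.2 <= count_mem (x.1 : nat) s)%N].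

Lemma diag_ofE D s : young D ->
  (forall r : 'I_N.+1, (0 < r)%N -> count_mem (r : nat) s = rowlen D r) -> diag_of s = D.
Proof.
move=> yD H; apply/setP => x; rewrite inE (young_mem x yD).
by case: (ltnP 0 x.1) => //= x1; rewrite H.
Qed.

Lemma SYT_intro D m t :
  (forall x, x \in D -> (0 < t x <= m)%N) -> (forall x, x \notin D -> t x = 0%N :> nat) ->
  (forall k, (0 < k <= m)%N -> exists x, forall y, (t y == k :> nat) = (y == x)) ->
  (forall x y, x \in D -> y \in D -> x.1 = y.1 -> (x.2 < y.2)%N -> (t x < t y)%N) ->
  (forall x y, x \in D -> y \in D -> x.2 = y.2 -> (x.1 < y.1)%N -> (t x < t y)%N) ->
  t \in SYT D 0 m.
Proof.
move=> H1 H2 H3 H4 H5; rewrite inE; apply/and4P; split.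
- by apply/forallP => x; case: ifP => [/H1//|/negbT/H2->].
- apply/forallP => k; apply/implyP => /H3[x Hx]; apply/cards1P; exists x.
  by apply/setP => y; rewrite !inE -val_eqE Hx.
- by apply/forall_inP => x xD; apply/forall_inP => y yD; apply/implyP => /andP[/eqP e]; apply: H4.
- by apply/forall_inP => x xD; apply/forall_inP => y yD; apply/implyP => /andP[/eqP e]; apply: H5.
Qed.

(** The converse of [yam_rows]: each new entry goes to the end of its row, and the lattice condition
    keeps the columns increasing. *)
Lemma SYT_diag_of s : yam s -> (size s <= N)%N ->
  exists2 t, t \in SYT (diag_of s) 0 (size s) & rows t (size s) = s.
Proof.
elim/last_ind: s => [_ _|s r IH].
  exists [ffun=> ord0] => //; apply: SYT_intro => //; last 2 first.
  - by move=> x y; rewrite inE /=; lia.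
  - by move=> x y; rewrite inE /=; lia.
  - by move=> x; rewrite inE /=; lia.
  - by move=> x _; rewrite ffunE.
  - by move=> k /andP[k0]; rewrite leqNgt k0.
rewrite yam_rcons size_rcons => /andP[ys ar] lt; have /andP[r0 _] := ar.
have [t tD rt] := IH ys (ltnW lt).
have mN := ltnW lt.
have ltr : (r < N.+1)%N by rewrite ltnS (leq_trans (addable_le ys ar)).
have ltc : ((count_mem r s).+1 < N.+1)%N.
  by rewrite ltnS; apply: leq_ltn_trans (count_size _ _) lt.
pose b : box N := (Ordinal ltr, Ordinal ltc).
have bD : b \notin diag_of s by rewrite inE /= ltnn andbF.
have memD x : (x \in diag_of (rcons s r)) = (x == b) || (x \in diag_of s).
  rewrite !inE -cats1 count_cat /= addn0 -pair_eqE /= -!val_eqE /=.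
  by rewrite (eq_sym r); case: (x.1 =P r :> nat) => [->|_]; rewrite ?r0; lia.
have ltm : ((size s).+1 < N.+1)%N by [].
pose t' : filling N := [ffun x => if x == b then Ordinal ltm else t x].
have t'b : t' b = (size s).+1 :> nat by rewrite ffunE eqxx.
have t'D x : x \in diag_of s -> t' x = t x.
  by move=> xD; rewrite ffunE; case: eqP => // e; rewrite -e xD in bD.
have tb : t b = 0%N :> nat by apply: (SYT_out tD).
exists t'.
  apply: SYT_intro.
  - move=> x; rewrite memD => /orP[/eqP->|xD]; first by rewrite t'b /= leqnn.
    by have /andP[tx0 tx1] := SYT_range tD xD; rewrite t'D // tx0 leqW.
  - move=> x; rewrite memD negb_or => /andP[ne xD].
    by rewrite ffunE (negbTE ne); apply: (SYT_out tD).
  - move=> k kb; case: (k =P (size s).+1) => [->|ne].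
      exists b => y; rewrite ffunE; case: (y =P b) => [_|_] /=; first by rewrite eqxx.
      have : (t y <= size s)%N.
        case yD: (y \in diag_of s); first by have /andP[] := SYT_range tD yD.
        by rewrite (SYT_out tD) ?yD.
      by rewrite -ltnS => /ltn_eqF->.
    have kb' : (0 < k <= size s)%N by lia.
    have [x xD [tx ux]] := SYT_uniq tD mN kb'.
    exists x => y; rewrite ffunE; case: (y =P b) => [->|_] /=.
      rewrite (_ : (_ == k) = false); last by apply/eqP => e; apply: ne.
      by apply/esym; apply: contraNF bD => /eqP->.
    by apply/eqP/eqP => [/ux|->].
  - move=> x y; rewrite !memD => /orP[/eqP->|xD] /orP[/eqP->|yD]; rewrite ?ltnn //.
    + by rewrite inE in yD; move=> /= e; move: yD; rewrite -e /=; lia.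
    + by rewrite t'b t'D // => _ _; have /andP[] := SYT_range tD xD.
    + by rewrite !t'D //; apply: (SYT_row tD).
  - move=> x y; rewrite !memD => /orP[/eqP->|xD] /orP[/eqP->|yD]; rewrite ?ltnn //.
    + move=> e lt'; have : (count_mem (y.1 : nat) s <= count_mem r s)%N.
        by apply: yam_count_le => //; rewrite r0 ltnW.
      by move: yD; rewrite inE -e /=; lia.
    + by rewrite t'b t'D // => _ _; have /andP[] := SYT_range tD xD.
    + by rewrite !t'D //; apply: (SYT_col tD).
have box_eq k : (0 < k <= size s)%N -> box_of t' k = box_of t k.
  move=> kb; have [bxD tx] := box_ofP tD mN kb.
  rewrite {1}/box_of; case: pickP => [y|/(_ (box_of t k))]; last first.
    by rewrite t'D // tx eqxx.
  rewrite ffunE; case: (y =P b) => [_ /eqP /= e|_ /eqP ty]; first by move: kb; rewrite -e ltnn andbF.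
  by have [z _ [_ uz]] := SYT_uniq tD mN kb; rewrite (uz _ ty) (uz _ tx).
rewrite rows_succ; congr rcons.
  transitivity (rows t (size s)); last exact: rt.
  apply/eq_in_map => k; rewrite mem_iota add1n ltnS => kb.
  by rewrite /row_of box_eq.
rewrite /row_of /box_of; case: pickP => [y|/(_ b)]; last by rewrite t'b eqxx.
rewrite ffunE; case: (y =P b) => [->//|_ /= /eqP ty].
case yD: (y \in diag_of s); first by have /andP[_] := SYT_range tD yD; rewrite ty ltnn.
by have := SYT_out tD (negbT yD); rewrite ty.
Qed.

End SkewTableaux.

(** * Word modules and Specht modules *)

Section WordModule.
Context (F : fieldType) (q : F) (n : nat).
Local Notation W := (words F n n).
Local Notation H := (hecke q n).
Local Notation T := (Tgen q n).
Local Notation P := (pw q (JM q n)).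

Lemma actDl (u v : W) (x : H) : act (u + v) x = act u x + act v x.
Proof. exact: (linearD (actr x)). Qed.

Lemma actZl c (v : W) (x : H) : act (c *: v) x = c *: act v x.
Proof. exact: (linearZ_LR (actr x)). Qed.

Lemma act0l (x : H) : act (0 : W) x = 0.
Proof. exact: (linear0 (actr x)). Qed.

Lemma act_suml I (r : seq I) (f : I -> W) (x : H) :
  act (\sum_(i <- r) f i) x = \sum_(i <- r) act (f i) x.
Proof. exact: (linear_sum (actr x)). Qed.

Lemma act0r (v : W) : act v (0 : H) = 0.
Proof. by rewrite -(scale0r (0 : H)) actZ scale0r. Qed.

Lemma actNr (v : W) (x : H) : act v (- x) = - act v x.
Proof. by rewrite -scaleN1r actZ scaleN1r. Qed.

Lemma act_sumr I (r : seq I) (p : pred I) (f : I -> H) (v : W) :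
  act v (\sum_(i <- r | p i) f i) = \sum_(i <- r | p i) act v (f i).
Proof. exact: (big_morph (act v) (actD v) (act0r v)). Qed.

(** Lists expose neighbouring letters as [s ++ a :: c :: t]; the encoding is faithful for letters up
    to [n], hence the side conditions [all (leq^~ n)]. *)
Definition word_seq (x : seq nat) : word n n := [ffun p : 'I_n => inord (nth 0%N x p)].
Definition wv (x : seq nat) : W := wbase F (word_seq x).
Definition word_letters (w : word n n) : seq nat := [seq (w p : nat) | p <- enum 'I_n].

Lemma size_word_letters w : size (word_letters w) = n.
Proof. by rewrite size_map size_enum_ord. Qed.

Lemma nth_word_letters w (p : 'I_n) : nth 0%N (word_letters w) p = w p.
Proof. by rewrite (nth_map p) ?size_enum_ord // nth_ord_enum. Qed.

Lemma word_lettersK w : word_seq (word_letters w) = w.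
Proof. by apply/ffunP => p; rewrite ffunE nth_word_letters inord_val. Qed.

Lemma word_letters_bound w : all (leq^~ n) (word_letters w).
Proof. by apply/allP => k /mapP[p _ ->]; rewrite -ltnS. Qed.

Lemma word_seq_val x (p : 'I_n) : all (leq^~ n) x -> word_seq x p = nth 0%N x p :> nat.
Proof.
move=> bx; rewrite ffunE inordK // ltnS; case: (ltnP p (size x)) => [lt|ge].
  by move/allP: bx; apply; apply: mem_nth.
by rewrite nth_default.
Qed.

Lemma act_T_wv s a c t : size (s ++ a :: c :: t) = n ->
  all (leq^~ n) (s ++ a :: c :: t) ->
  act (wv (s ++ a :: c :: t)) (T (size s).+1) =
    if a == c then q *: wv (s ++ a :: c :: t)
    else if (a < c)%N then wv (s ++ c :: a :: t)
    else q *: wv (s ++ c :: a :: t) + (q - 1) *: wv (s ++ a :: c :: t).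
Proof.
move=> sz bx; have lt : (0 < (size s).+1 < n)%N by rewrite -sz size_cat /=; lia.
pose i : gidx n := Sub (size s).+1 lt.
rewrite -[(size s).+1]/(val i) actT act_gen_base /wgen.
have lE : word_seq (s ++ a :: c :: t) (lo i) = a :> nat.
  by rewrite word_seq_val //= nth_cat ltnn subnn.
have hE : word_seq (s ++ a :: c :: t) (hi i) = c :> nat.
  by rewrite word_seq_val //= nth_cat ltnNge leqnSn /= subSnn.
rewrite -val_eqE /= lE hE.
suff -> : wswap i (word_seq (s ++ a :: c :: t)) = word_seq (s ++ c :: a :: t) by [].
have bx' : all (leq^~ n) (s ++ c :: a :: t).
  by rewrite -(perm_all _ (perm_swap s t a c)).
apply/ffunP => p; apply: val_inj; rewrite ffunE /=.
rewrite [RHS]word_seq_val //; case: tpermP => [->|->|].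
- by rewrite hE /= nth_cat ltnn subnn.
- by rewrite lE /= nth_cat ltnNge leqnSn /= subSnn.
move=> /eqP; rewrite -val_eqE /= => ne1 /eqP; rewrite -val_eqE /= => ne2.
rewrite word_seq_val // !nth_cat; case: ltnP => // ge.
by have -> : (p - size s = (p - size s).-2.+2)%N by lia.
Qed.

Hypothesis q_neq0 : q != 0.
Hypothesis qint_neq0 : forall m, (0 < m <= n)%N -> qint q m != 0.

Let T_pwE := @T_pw F q n H T (JM q n) q_neq0 (@Tgen_quad F q n) (@Tgen_far F q n)
  (@Tgen_braid F q n) (JM_1 q n) (@JM_succ F q n) qint_neq0.

(** The two marked letters are vertically adjacent boxes of the first column. If they are
    consecutive, [T] acts by [q] on [v] and by [-1] on the projector. Otherwise the lower one is
    moved back a step: by induction the exchanged projector kills [v], leaving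
    [q v p = swap_coef v p], and the coefficient is not [q]. *)
Lemma pw_column_eq0 (v : W) s1 a s2 t :
  yam (s1 ++ a :: s2 ++ a.+1 :: t) -> size (s1 ++ a :: s2 ++ a.+1 :: t) = n ->
  a \notin s1 -> a.+1 \notin s1 -> a.+1 \notin s2 ->
  (forall l, (size s1 < l <= (size s1 + size s2).+1)%N -> act v (T l) = q *: v) ->
  act v (P (s1 ++ a :: s2 ++ a.+1 :: t)) = 0.
Proof.
elim/last_ind: s2 t => [|s2 d IH] t.
  rewrite /= addn0 => ys sz na na1 _ Hv.
  have := T_pwE ys sz; have vT : act v (T (size s1).+1) = q *: v.
    by apply: Hv; rewrite !leqnn.
  case=> [[E _ _]|[_ _ /(congr1 (act v)) E _]|[_ /andP[_ /orP[/eqP E|cnt]] _ _ _]].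
  - by lia.
  - move: E; rewrite actM vT actZl actNr => /eqP.
    rewrite -subr_eq0 opprK -[X in _ + X]scale1r -scalerDl scaler_eq0.
    have n1 : (1 < n)%N by rewrite -sz size_cat /=; lia.
    have := qint_neq0 (_ : (0 < 2 <= n)%N) => /(_ n1).
    by rewrite (qintD1 q_neq0 1) (qint1 q_neq0) mulr1 => /negbTE-> /= /eqP.
  - have := yam_mem_gt0 ys (_ : a \in _); rewrite mem_cat inE eqxx orbT => /(_ isT).
    by case: E => ->.
  - by move: cnt; rewrite /= (count_memPn na1) (count_memPn na).
rewrite mem_rcons inE negb_or size_rcons addnS -cats1 -!catA /= => ys sz na na1 /andP[nd na2] Hv.
pose s := s1 ++ a :: s2.
have sE : s1 ++ a :: s2 ++ d :: a.+1 :: t = s ++ d :: a.+1 :: t by rewrite /s -catA.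
have ss : size s = (size s1 + size s2).+1 by rewrite size_cat /= addnS.
rewrite sE in ys sz *; have vT : act v (T (size s).+1) = q *: v.
  by apply: Hv; rewrite ss; lia.
have cs : (count_mem a.+1 s < count_mem a s)%N.
  rewrite /s !count_cat /= eqxx (count_memPn na1) (count_memPn na2).
  by have -> : (a == a.+1) = false; lia.
case: (T_pwE ys sz) => [[E]|[[E] nad _ _]|[ne ad ys' /(congr1 (act v)) E _]].
- by rewrite E eqxx in nd.
- by move: nad; rewrite /addable /= -E cs orbT.
have IHv : act v (P (s ++ a.+1 :: d :: t)) = 0.
  rewrite /s -catA /=; apply: IH => //.
  - by move: ys'; rewrite /s -catA.
  - by rewrite -sz /s -catA !size_cat /= !size_cat.
  - by move=> l lb; apply: Hv; lia.
have [ysd add] : yam s /\ addable s d.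
  have := yam_catl (_ : yam (rcons s d ++ a.+1 :: t)).
  by rewrite cat_rcons => /(_ ys); rewrite yam_rcons => /andP[].
have ltn : ((size s).+1 < n)%N by rewrite -sz size_cat /=; lia.
have [_ nq _] := swap_coefP q_neq0 qint_neq0 ysd add ad ne ltn.
move: E; rewrite actM vT actD actZl actZ !actM IHv !act0l addr0 => /eqP.
by rewrite -subr_eq0 -scalerBl scaler_eq0 subr_eq0 eq_sym (negbTE nq) /= => /eqP.
Qed.

(** At the least such [p], [s] has its first letter [a + 1]. The first [a] of [s] precedes it, and
    monotonicity forces [x] to equal [a] from there up to [p], so the generators in between act on
    the word by [q] and [pw_column_eq0] applies. *)
Lemma pw_sorted_eq0 x m s p : size x = n -> all (leq^~ n) x -> all (leq 1) x ->
  (m <= n)%N -> (forall l, (l.+1 < m)%N -> (nth 0 x l <= nth 0 x l.+1)%N) ->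
  yam s -> size s = n -> (p < m)%N -> (nth 0 x p < nth 0 s p)%N ->
  act (wv x) (P s) = 0.
Proof.
move=> sx bx px le_mn sorted ys sz.
have mono l l' : (l <= l' < m)%N -> (nth 0 x l <= nth 0 x l')%N.
  move=> /andP[/subnK<-]; elim: (l' - l)%N => // d IH lt.
  by apply: leq_trans (IH (ltnW lt)) (sorted _ lt).
elim/ltn_ind: p => p IH lt big.
case: (boolP [exists l : 'I_p, (nth 0 x l < nth 0 s l)%N]) => [/existsP[l]|/existsPn small].
  by apply: IH => //; apply: ltn_trans lt.
have ltn := leq_trans lt le_mn.
have ad : addable (take p s) (nth 0%N s p) by apply/yamP => //; rewrite sz.
have x1 : (0 < nth 0 x p)%N by move/allP: px; apply; rewrite mem_nth ?sx.
have small_le l : (l < p)%N -> (nth 0 s l <= nth 0 x l)%N.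
  by move=> lp; have := small (Ordinal lp); rewrite -leqNgt.
case Ra: (nth 0%N s p) big ad => [|a] // big ad.
have nR : a.+1 \notin take p s.
  apply/negP => /(nthP 0%N)[l]; rewrite size_take sz ltn => lp; rewrite nth_take // => E.
  have := small_le _ lp; rewrite E leqNgt; apply/negP; rewrite negbK.
  by apply: leq_ltn_trans big; apply: mono; rewrite (ltnW lp).
have a_in : a \in take p s.
  have := ad; rewrite /addable /= (count_memPn nR) -has_count has_pred1 => /orP[/eqP|//].
  by case=> E; move: big; rewrite E; lia.
have [s1 [s2 [tE na]]] : exists s1 s2, take p s = s1 ++ a :: s2 /\ a \notin s1.
  exists (take (index a (take p s)) (take p s)), (drop (index a (take p s)).+1 (take p s)).
  split; first by rewrite -{1}[take p s](cat_take_drop (index a (take p s)))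
    (drop_nth 0%N) ?index_mem // nth_index.
  by apply/negP => /index_ltn; rewrite ltnn.
have psz : p = (size s1 + size s2).+1.
  by rewrite -[LHS](@size_takel p _ s) ?tE ?size_cat /= ?addnS // sz ltnW.
have sE : s = s1 ++ a :: s2 ++ a.+1 :: drop p.+1 s.
  by rewrite -{1}[s](cat_take_drop p) tE (drop_nth 0%N) ?sz // Ra -catA.
have s1p : (size s1 < p)%N by lia.
have xa : nth 0 x (size s1) = a.
  apply/eqP; rewrite eqn_leq; apply/andP; split.
    by rewrite -ltnS; apply: leq_ltn_trans big; apply: mono; rewrite (ltnW s1p).
  have := small_le _ s1p; rewrite -(nth_take 0%N s1p s) tE nth_cat ltnn subnn.
  by [].
have xE l : (size s1 <= l <= p)%N -> nth 0 x l = a.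
  move=> /andP[l1 l2]; apply/eqP; rewrite eqn_leq; apply/andP; split.
    by rewrite -ltnS; apply: leq_ltn_trans big; apply: mono; rewrite l2.
  by rewrite -{1}xa; apply: mono; rewrite l1 (leq_ltn_trans l2).
rewrite tE mem_cat inE !negb_or in nR; case/and3P: nR => nR1 _ nR2.
rewrite sE; apply: pw_column_eq0 => //; rewrite -?sE //.
move=> [//|l] lb; have [y [b [c [z [xs ysz]]]]] : exists s1 a c t, x = s1 ++ a :: c :: t /\ size s1 = l.
  by apply: split_two; rewrite sx; lia.
have bE : nth 0 x l = b by rewrite xs nth_cat ysz ltnn subnn.
have cE : nth 0 x l.+1 = c by rewrite xs nth_cat ysz ltnNge leqnSn /= subSnn.
rewrite -ysz xs act_T_wv -?xs //.
by rewrite -bE -cE !xE ?eqxx //; lia.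
Qed.

Lemma descent_ind (Q : seq nat -> Prop) m :
  (forall x, size x = n -> all (leq^~ n) x ->
     (forall l, (l.+1 < m)%N -> (nth 0 x l <= nth 0 x l.+1)%N) -> Q x) ->
  (forall s a c t, size (s ++ a :: c :: t) = n -> all (leq^~ n) (s ++ a :: c :: t) ->
     (a < c)%N -> ((size s).+1 < m)%N -> Q (s ++ a :: c :: t) -> Q (s ++ c :: a :: t)) ->
  (m <= n)%N -> forall x, size x = n -> all (leq^~ n) x -> Q x.
Proof.
(* Earlier positions weigh more, so removing a descent strictly lowers [f]. *)
move=> H1 H2 le_mn x; pose f (x : seq nat) := (\sum_(i < n) (n - i) * nth 0 x i)%N.
have [k] := ubnP (f x); elim: k x => // k IH x lt sx bx.
case: (boolP [forall l : 'I_m, (l.+1 < m)%N ==> (nth 0 x l <= nth 0 x l.+1)%N]).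
  move=> /forallP H; apply: H1 => // l lm.
  by have := H (Ordinal (ltnW lm)); rewrite /= lm.
move=> /forallPn[l]; rewrite negb_imply -ltnNge => /andP[lm big].
have [s [c [a [t [xE sl]]]]] : exists s1 a c t, x = s1 ++ a :: c :: t /\ size s1 = l.
  by apply: split_two; rewrite sx (leq_trans lm).
have cE : nth 0 x l = c by rewrite xE nth_cat sl ltnn subnn.
have aE : nth 0 x l.+1 = a by rewrite xE nth_cat sl ltnNge leqnSn /= subSnn.
rewrite cE aE in big.
have sx' : size (s ++ a :: c :: t) = n by rewrite -sx xE !size_cat.
have bx' : all (leq^~ n) (s ++ a :: c :: t) by rewrite (perm_all _ (perm_swap s t a c)) -xE.
rewrite xE; apply: H2 => //; first by rewrite sl.
rewrite ltnS in lt; apply: IH => //; apply: leq_trans lt; rewrite xE /f.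
have l0 : (l < n)%N by apply: leq_trans (ltn_ord l) le_mn.
have l1 : (l.+1 < n)%N by apply: leq_trans lm le_mn.
rewrite (bigD1 (Ordinal l0)) // (bigD1 (Ordinal l1)) /=; last by rewrite -val_eqE /=; lia.
rewrite [X in (_ <= X)%N](bigD1 (Ordinal l0)) // [X in (_ <= _ + X)%N](bigD1 (Ordinal l1)) /=; last first.
  by rewrite -val_eqE /=; lia.
rewrite (eq_bigr (fun i : 'I_n => (n - i) * nth 0 (s ++ c :: a :: t) i)%N); last first.
  move=> i; rewrite -!val_eqE /= => /andP[n0 n1]; congr (_ * _)%N.
  rewrite !nth_cat; case: ltnP => // ge.
  by have -> : (i - size s = (i - size s).-2.+2)%N by lia.
have E0 b d u : nth 0%N (s ++ b :: d :: u) l = b by rewrite nth_cat sl ltnn subnn.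
have E1 b d u : nth 0%N (s ++ b :: d :: u) l.+1 = d.
  by rewrite nth_cat sl ltnNge leqnSn /= subSnn.
rewrite !E0 !E1 !addnA ltn_add2r.
have -> : (n - l = (n - l.+1).+1)%N by lia.
by rewrite !mulSn -!addnA [X in (_ + X < _)%N]addnC ltn_add2r.
Qed.

(** Unlike a pointwise comparison, the sum of the first [m] letters is invariant under exchanges
    among them, in the word and in the tableau alike. Sorting the prefix therefore reduces to
    [pw_sorted_eq0]. *)
Lemma pw_prefix_eq0 m x s : size x = n -> all (leq^~ n) x -> all (leq 1) x ->
  (m <= n)%N -> yam s -> size s = n -> (sumn (take m x) < sumn (take m s))%N ->
  act (wv x) (P s) = 0.
Proof.
move=> sx bx + le_mn; move: s.
suff K : forall s, all (leq 1) x -> yam s -> size s = n ->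
    (sumn (take m x) < sumn (take m s))%N -> act (wv x) (P s) = 0.
  by move=> s px; apply: K.
move: x sx bx; apply: (descent_ind (m := m)) => //.
  move=> x sx bx sorted s px ys sz lt.
  have [p pm big] : exists2 p, (p < m)%N & (nth 0 x p < nth 0 s p)%N.
    case: (boolP [exists p : 'I_m, (nth 0 x p < nth 0 s p)%N]) => [/existsP[p]|/existsPn H].
      by exists p.
    move: lt; rewrite ltnNge => /negP[].
    have E y : size y = n -> sumn (take m y) = (\sum_(p < m) nth 0 y p)%N.
      move=> sy; rewrite sumnE (big_nth 0%N) size_takel ?sy // big_mkord.
      by apply: eq_bigr => p _; rewrite nth_take.
    by rewrite !E //; apply: leq_sum => p _; have := H p; rewrite -leqNgt.
  exact: (pw_sorted_eq0 sx bx px le_mn sorted ys sz pm big).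
move=> z a c t sx bx ac lm IH s px ys sz lt.
have px' : all (leq 1) (z ++ a :: c :: t) by rewrite (perm_all _ (perm_swap z t a c)).
have E := act_T_wv sx bx; rewrite ltn_eqF // ac in E.
have sumE (y : seq nat) b d u : (size y).+1 = (size z).+1 ->
    sumn (take m (y ++ b :: d :: u)) = sumn (take m (y ++ d :: b :: u)).
  move=> [sy]; rewrite !take_cat; case: ltnP => [|_]; first by lia.
  have -> : (m - size y = (m - size y).-2.+2)%N by lia.
  by apply: perm_sumn; rewrite /= perm_swap.
have [y [b [d [u [sE szy]]]]] : exists s1 a c t, s = s1 ++ a :: c :: t /\ size s1 = size z.
  by apply: split_two; rewrite sz -sx size_cat /=; lia.
rewrite sE in ys sz lt *; rewrite -E -szy -actM.
have lt1 : (sumn (take m (z ++ a :: c :: t)) < sumn (take m (y ++ b :: d :: u)))%N.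
  by rewrite (sumE z).
have v0 : act (wv (z ++ a :: c :: t)) (P (y ++ b :: d :: u)) = 0 by apply: IH.
case: (T_pwE ys sz) => [[_ -> _]|[_ _ -> _]|[_ _ ys' -> _]].
- by rewrite actZ v0 scaler0.
- by rewrite actNr v0 oppr0.
rewrite actD actZ !actM v0 scaler0 add0r IH ?act0l //.
  by rewrite -sz !size_cat.
by rewrite -(sumE y) ?szy.
Qed.

Lemma ptab_pw (t : filling n) m : young (finset (fun x : box n => (0 < t x)%N)) ->
  t \in SYT (finset (fun x : box n => (0 < t x)%N)) 0 m -> (m <= n)%N ->
  ptab q n t m = P (rows t m).
Proof.
move=> yD tD mn; rewrite /ptab /pw size_rows.
rewrite big_nat_cond [RHS]big_nat_cond; apply: eq_bigr => k /andP[/andP[k0 km] _].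
have lt : (k.-1 < m)%N by lia.
rewrite (take_rows t (ltnW lt)) (nth_rows t lt) (kap_rows yD tD mn lt).
by rewrite prednK.
Qed.

Section Shape.
Variables (D : {set box n}) (m : nat).
Hypotheses (yD : young D) (mn : (m <= n)%N).

Lemma ptabE t : t \in SYT D 0 m -> ptab q n t m = P (rows t m).
Proof.
move=> tD; have E : finset (fun x : box n => (0 < t x)%N) = D.
  by apply/setP => x; rewrite inE (SYT_mem tD).
by apply: ptab_pw; rewrite ?E.
Qed.

(** The shape is read off letter counts, which makes the predicate invariant under permutation, as
    [shape_projector_T] demands. *)
Definition has_shape (s : seq nat) : bool :=
  [forall r : 'I_n.+1, (0 < r)%N ==> (count_mem (r : nat) s == rowlen D r)].

Lemma has_shape_perm s s' : perm_eq s s' -> has_shape s = has_shape s'.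
Proof.
by move=> /seq.permP E; apply: eq_forallb => r; rewrite !E.
Qed.

Lemma has_shape_rows t : t \in SYT D 0 m -> has_shape (rows t m).
Proof.
by move=> tD; apply/forallP => r; apply/implyP => _; rewrite (count_rows_shape tD mn).
Qed.

Lemma has_shape_exists s : yam s -> size s = m -> has_shape s ->
  exists2 t, t \in SYT D 0 m & rows t m = s.
Proof.
move=> ys sz /forallP H; have [|t] := @SYT_diag_of n s ys; first by rewrite sz.
rewrite sz (diag_ofE yD) => [tD E|r r0]; first by exists t.
by apply/eqP; have := H r; rewrite r0.
Qed.

(** A weight whose first [m] letters have the shape [D] comes from exactly one tableau of the sum;
    any other weight comes from none. *)
Lemma pshape_projector : shape_projector q n (JM q n) m has_shape (pshape q n D m).
Proof.
move=> s x ys sz wx; rewrite /pshape mulr_sumr.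
have xE t : t \in SYT D 0 m -> x * ptab q n t m = if take m s == rows t m then x else 0.
  move=> tD; rewrite ptabE //.
  have := @wt_pw _ q n _ (JM q n) q_neq0 qint_neq0 s (rows t m) x ys.
  by rewrite size_rows sz => -> //; apply: (yam_rows yD tD mn).
have stm : size (take m s) = m by rewrite size_takel // sz.
case: ifP => [hs|nhs]; last first.
  apply: big1 => t tD; rewrite xE //; case: eqP => // E.
  by rewrite E has_shape_rows in nhs.
have [t tD E] := has_shape_exists (yam_take m ys) stm hs.
rewrite (bigD1 t) //= xE // E eqxx big1 ?addr0 // => t' /andP[tD' ne].
rewrite xE // -E; case: eqP => // E'.
by rewrite (rows_inj yD mn tD' tD (esym E')) eqxx in ne.
Qed.

End Shape.

Section SpechtModule.
Variable D : {set box n}.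
Hypothesis yD : young D.
Local Notation S := (specht q n D).

Lemma word_of_seq t : t \in SYT D 0 n -> wbase F (word_of t n) = wv (rows t n).
Proof.
move=> tD; rewrite /wv; congr wbase; apply/ffunP => p; apply: ord_inj.
rewrite /word_of ffunE word_seq_val ?nth_rows //.
by apply/allP => k /mapP[i _ ->]; rewrite -ltnS.
Qed.

Lemma specht_mem s : yam s -> size s = n -> has_shape D s ->
  act (wv s) (P s) \in S.
Proof.
move=> ys sz hs; have [t tD E] := has_shape_exists yD (leqnn n) ys sz hs.
apply/memv_span/mapP; exists t; rewrite ?mem_enum //.
by rewrite word_of_seq // (ptabE yD (leqnn n) tD) E.
Qed.

Lemma specht_ind (Q : W -> Prop) :
  (forall a u v, Q u -> Q v -> Q (a *: u + v)) -> Q 0 ->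
  (forall s, yam s -> size s = n -> has_shape D s -> Q (act (wv s) (P s))) ->
  forall v, v \in S -> Q v.
Proof.
move=> QL Q0 Qg v /coord_span->.
apply: big_ind => // [x y Qx Qy|i _]; first by rewrite -[x]scale1r; apply: QL.
rewrite -[_ *: _]addr0; apply: (QL) => //.
set g := _`_i; have : g \in [seq act (wbase F (word_of t n)) (ptab q n t n) | t <- enum (SYT D 0 n)].
  by apply: mem_nth; apply: (leq_trans (ltn_ord i)); rewrite size_tuple.
case/mapP=> t; rewrite mem_enum => tD ->.
rewrite word_of_seq // (ptabE yD (leqnn n) tD); apply: Qg.
- exact: (yam_rows yD tD (leqnn n)).
- exact: size_rows.
- exact: has_shape_rows.
Qed.

Lemma shape_bound s : yam s -> size s = n -> all (leq^~ n) s /\ all (leq 1) s.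
Proof.
move=> ys sz; split; apply/allP => r rs; last exact: yam_mem_gt0 ys rs.
have := rs; rewrite -index_mem => lt; move/yamP: (ys) => /(_ _ lt).
rewrite nth_index // => ar; apply: leq_trans (addable_le (yam_take _ ys) ar) _.
by rewrite size_takel ?sz // -?sz // ltnW.
Qed.

(** Only the exchangeable case is not immediate: there [p T] leaves the projector [p], and its extra
    term has to be matched with the spanning vector of the exchanged tableau. *)
Lemma specht_T v i : (0 < i < n)%N -> v \in S -> act v (T i) \in S.
Proof.
case: i => // i /andP[_ lt]; move: v; apply: specht_ind => [a u v uS vS||s ys sz hs].
- by rewrite actDl actZl memvD ?memvZ.
- by rewrite act0l mem0v.
have [z [a [c [t [sE szz]]]]] : exists s1 a c t, s = s1 ++ a :: c :: t /\ size s1 = i.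
  by apply: split_two; rewrite sz.
have vS := specht_mem ys sz hs; rewrite {}sE in ys sz hs vS *.
rewrite -szz -actM; case: (T_pwE ys sz) => [[_ _ ->]|[_ _ _ ->]|[ne ac ys' E1 E2]].
- by rewrite actZ memvZ.
- by rewrite actNr memvN.
have sz' : size (z ++ c :: a :: t) = n by rewrite -sz !size_cat.
have hs' : has_shape D (z ++ c :: a :: t).
  by rewrite -(has_shape_perm D (perm_swap z t a c)).
have [bs ps] := shape_bound ys sz; have [bs' ps'] := shape_bound ys' sz'.
have vS' := specht_mem ys' sz' hs'.
(* Moving up from an ascent: [T] just swaps the letters of the word, and the diagonal term
   disappears because the prefix sum of the word is smaller than that of the other tableau. *)
have lower b d : (b < d)%N -> yam (z ++ b :: d :: t) -> size (z ++ b :: d :: t) = n ->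
    yam (z ++ d :: b :: t) ->
    act (act (wv (z ++ b :: d :: t)) (P (z ++ b :: d :: t))) (T (size z).+1 * P (z ++ d :: b :: t)) =
    act (wv (z ++ d :: b :: t)) (P (z ++ d :: b :: t)).
  move=> bd yb sb yd; have sd : size (z ++ d :: b :: t) = n by rewrite -sb !size_cat.
  have [bb pb] := shape_bound yb sb.
  have E := act_T_wv sb bb; rewrite ltn_eqF // bd in E.
  rewrite -[in RHS]E -[RHS]actM.
  have nad : addable z d.
    by move: yd; rewrite -cat_rcons => /yam_catl; rewrite yam_rcons => /andP[].
  have nab : addable z b.
    by move: yb; rewrite -cat_rcons => /yam_catl; rewrite yam_rcons => /andP[].
  case: (T_pwE yd sd) => [[E']|[_ nb _ _]|[_ _ _ E3 _]].
  - by rewrite E' ltnn in bd.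
  - by rewrite nab in nb.
  rewrite [in RHS]E3 actD actZ (@pw_prefix_eq0 (size z).+1 _ (z ++ d :: b :: t)) //.
  - by rewrite scaler0 add0r -actM mulrA.
  - by rewrite szz ltnW.
  have sumE x y : sumn (take (size z).+1 (z ++ x :: y)) = (sumn z + x)%N.
    by rewrite -cat_rcons take_size_cat ?size_rcons // -cats1 sumn_cat /= addn0.
  by rewrite !sumE ltn_add2l.
case: (ltngtP a c) => [lt_ac|lt_ca|/eqP]; last by rewrite (negbTE ne).
  rewrite E2 actD actZ -mulrA [X in _ + X]actM lower //.
  by rewrite memvD ?memvZ.
have := lower c a lt_ca ys' sz' ys.
case: (T_pwE ys' sz') => [[E']|[_ nb _ _]|[_ _ _ _ E3]].
- by rewrite E' eqxx in ne.
- have : addable z a by move: ys; rewrite -cat_rcons => /yam_catl; rewrite yam_rcons => /andP[].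
  by move=> aa; rewrite aa in nb.
set x := act (wv (z ++ c :: a :: t)) _ in vS' *; set y := act (wv (z ++ a :: c :: t)) _ in vS *.
move=> yE; have xT : act x (T (size z).+1) = swap_coef q z c a *: x + y.
  by rewrite -yE /x -!actM E3 actD actZ mulrA.
(* For a descent the action on [y] is solved from the quadratic relation applied to [x], since [x T]
   is a multiple of [x] plus [y]. *)
have := actM x (T (size z).+1) (T (size z).+1).
have ltz : (0 < (size z).+1 < n)%N by rewrite szz.
rewrite (Tgen_quad q ltz) actD !actZ act1 xT actDl actZl xT => E.
rewrite actM -/y.
have -> : act y (T (size z).+1) =
   (q - 1) *: (swap_coef q z c a *: x + y) + q *: x
   - swap_coef q z c a *: (swap_coef q z c a *: x + y).
  by rewrite E addrC addKr.
by rewrite memvB ?memvD ?memvZ ?memvD ?memvZ.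
Qed.

(** A word with a descent is [T] applied to the word with that descent removed; [pshape] commutes
    with [T] and the Specht module is stable, so sorted words suffice. *)
Lemma act_pshape_mem x : size x = n -> all (leq^~ n) x -> all (leq 1) x ->
  has_shape D x -> act (wv x) (pshape q n D n) \in S.
Proof.
move=> sx bx; move: x sx bx; apply: (descent_ind (m := n)) => // [x sx bx sorted px hx|].
  rewrite /pshape act_sumr; apply: memv_suml => t tD.
  rewrite (ptabE yD (leqnn n) tD).
  have ys := yam_rows yD tD (leqnn n) (leqnn n).
  case: (rows t n =P x) => [E|ne].
    by rewrite -E; apply: specht_mem => //; [apply: size_rows|apply: has_shape_rows].
  suff -> : act (wv x) (P (rows t n)) = 0 by apply: mem0v.
  case: (boolP [exists p : 'I_n, (nth 0 x p < nth 0 (rows t n) p)%N]) => [/existsP[p lt]|/existsPn H].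
    exact: (pw_sorted_eq0 sx bx px (leqnn n) sorted ys (size_rows t n) (ltn_ord p) lt).
  (* The tableau word now lies pointwise below [x] and has the same letters; equal sums force
     equality. *)
  case: ne; apply: (@eq_from_nth _ 0%N); rewrite size_rows ?sx // => p pn.
  have pE : perm_eq (rows t n) x.
    have [br pr] := shape_bound ys (size_rows t n).
    apply/allP => r rin; apply/eqP.
    have rb : (0 < r <= n)%N.
      by move: rin; rewrite mem_cat => /orP[] rin; rewrite ?(allP br _ rin) ?(allP pr _ rin)
        ?(allP bx _ rin) ?(allP px _ rin).
    have rn : (r < n.+1)%N by case/andP: rb.
    have /forallP/(_ (Ordinal rn)) := hx; have /forallP/(_ (Ordinal rn)) := has_shape_rows (leqnn n) tD.
    by case/andP: rb => /= -> _ /= /eqP-> /eqP->.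
  have sumE y : size y = n -> sumn y = (\sum_(i < n) nth 0 y i)%N.
    by move=> sy; rewrite sumnE (big_nth 0%N) sy big_mkord.
  have le (i : 'I_n) : (nth 0 (rows t n) i <= nth 0 x i)%N by have := H i; rewrite -leqNgt.
  have := perm_sumn pE; rewrite !sumE ?size_rows // => /eqP.
  have := leqif_sum (fun i (_ : true) => leqif_eq (le i)).
  by move=> [_ ->] /forallP/(_ (Ordinal pn))/eqP.
move=> z a c t sx bx ac lt IH px hx.
have E := act_T_wv sx bx; rewrite ltn_eqF // ac in E.
have px' : all (leq 1) (z ++ a :: c :: t) by rewrite (perm_all _ (perm_swap z t a c)).
have hx' : has_shape D (z ++ a :: c :: t) by rewrite (has_shape_perm D (perm_swap z t a c)).
have C : GRing.comm (T (size z).+1) (pshape q n D n).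
  apply: (shape_projector_T q_neq0 (@Tgen_quad F q n) (@Tgen_far F q n)
    (@Tgen_braid F q n) (JM_1 q n) (@JM_succ F q n) qint_neq0
    (pshape_projector yD (leqnn n)) (@has_shape_perm D)) => //.
by rewrite -E -actM C actM; apply: specht_T; rewrite ?IH.
Qed.

End SpechtModule.

End WordModule.

Section PartitionDiagrams.
Variable N : nat.

Lemma nth_partition (n : nat) (s : seq nat) a b : is_partition n s -> (a <= b)%N ->
  (nth 0 s b <= nth 0 s a)%N.
Proof.
case/and3P=> ss _ _ ab; case: (ltnP b (size s)) => [lt|ge]; last by rewrite nth_default.
have tr : transitive geq by move=> x y z /= h1 h2; apply: leq_trans h2 h1.
exact: (sorted_leq_nth tr (fun x => leqnn x) 0%N ss _ _ (leq_ltn_trans ab lt) lt ab).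
Qed.

Lemma young_ydiag (n : nat) s : is_partition n s -> young (ydiag N s).
Proof.
move=> ps x; rewrite inE => /and3P[x1 x2 xn]; split=> // y /andP[y1 yx1] /andP[y2 yx2].
rewrite inE y1 y2 /= (leq_trans yx2) // (leq_trans xn) //.
by apply: (nth_partition ps); rewrite -ltnS !prednK.
Qed.

End PartitionDiagrams.

(** * Insertion of the last letters and the inclusion of Hecke algebras *)

Section Extension.
Context (F : fieldType) (q : F) (N j n : nat) (t : filling N).
Hypothesis jn : (j <= n)%N.
Local Notation Phi' := (@Phi N F t j n).

(* x in H_j(q) and y in H_n(q) act compatibly with the insertion of the last
   n - j letters. *)
Definition phi_compat (x : hecke q j) (y : hecke q n) : Prop :=
  forall v : words F N j, Phi' (act v x) = act (Phi' v) y.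

Lemma Phi_is_linear : linear Phi'.
Proof.
move=> a u v; rewrite /Phi scaler_sumr -big_split /=.
by apply: eq_bigr => w _; rewrite !ffunE scalerDl scalerA.
Qed.
HB.instance Definition _ := GRing.isLinear.Build F (words F N j) (words F N n) _ Phi' Phi_is_linear.

Lemma PhiZ c u : Phi' (c *: u) = c *: Phi' u.
Proof. exact: (linearZ_LR Phi'). Qed.

Lemma PhiD u v : Phi' (u + v) = Phi' u + Phi' v.
Proof. exact: (linearD Phi'). Qed.

Lemma Phi_base w : Phi' (wbase F w) = wbase F (wext t n w).
Proof.
rewrite /Phi (bigD1 w) //= big1 => [|w' ne]; first by rewrite !ffunE eqxx addr0 scale1r.
by rewrite !ffunE (negPf ne) scale0r.
Qed.

Lemma phi_compat0 : phi_compat 0 0.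
Proof.
move=> v; rewrite -(scale0r (0 : hecke q j)) -(scale0r (0 : hecke q n)) !actZ !scale0r.
exact: (linear0 Phi').
Qed.

Lemma phi_compat1 : phi_compat 1 1.
Proof. by move=> v; rewrite !act1. Qed.

Lemma phi_compatD x x' y y' : phi_compat x y -> phi_compat x' y' ->
  phi_compat (x + x') (y + y').
Proof. by move=> H H' v; rewrite !actD -H -H'; apply: (linearD Phi'). Qed.

Lemma phi_compatM x x' y y' : phi_compat x y -> phi_compat x' y' ->
  phi_compat (x * x') (y * y').
Proof. by move=> H H' v; rewrite !actM -H -H'. Qed.

Lemma phi_compatZ c x y : phi_compat x y -> phi_compat (c *: x) (c *: y).
Proof. by move=> H v; rewrite !actZ -H; apply: (linearZ_LR Phi'). Qed.

Lemma phi_compatB x x' y y' : phi_compat x y -> phi_compat x' y' ->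
  phi_compat (x - x') (y - y').
Proof.
by move=> H H'; rewrite -!scaleN1r; apply: phi_compatD => //; apply: phi_compatZ.
Qed.

Lemma phi_compat_sum I (r : seq I) (p : pred I) f g :
  (forall i, p i -> phi_compat (f i) (g i)) ->
  phi_compat (\sum_(i <- r | p i) f i) (\sum_(i <- r | p i) g i).
Proof.
by move=> H; apply: (big_ind2 phi_compat) => //; [apply: phi_compat0|move=> *; apply: phi_compatD].
Qed.

Lemma phi_compat_prod I (r : seq I) (p : pred I) f g :
  (forall i, p i -> phi_compat (f i) (g i)) ->
  phi_compat (\prod_(i <- r | p i) f i) (\prod_(i <- r | p i) g i).
Proof.
by move=> H; apply: (big_ind2 phi_compat) => //; [apply: phi_compat1|move=> *; apply: phi_compatM].
Qed.

Lemma wextE (w : word N j) (p : 'I_n) (lt : (p < j)%N) : wext t n w p = w (Ordinal lt).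
Proof. by rewrite ffunE insubT. Qed.

Lemma wext_out (w : word N j) (p : 'I_n) : (j <= p)%N -> wext t n w p = row_of t p.+1.
Proof. by move=> ge; rewrite ffunE insubF // ltnNge ge. Qed.

Lemma phi_compat_T l : (0 < l < j)%N -> phi_compat (Tgen q j l) (Tgen q n l).
Proof.
move=> ij; have ijn : (0 < l < n)%N by case/andP: (ij) => -> /= h; apply: leq_trans jn.
pose gj : gidx j := Sub l ij; pose gn : gidx n := Sub l ijn.
move=> v; have E1 u : act u (Tgen q j l) = act_gen q gj u by rewrite -[l]/(val gj) actT.
have E2 u : act u (Tgen q n l) = act_gen q gn u by rewrite -[l]/(val gn) actT.
rewrite E1 E2 [act_gen q gj v]/act_gen (linear_sum Phi') [Phi' v]/Phi.
rewrite (linear_sum (act_gen q gn)); apply: eq_bigr => w _.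
transitivity (v w *: Phi' (wgen q gj w)); first exact: PhiZ.
transitivity (v w *: act_gen q gn (wbase F (wext t n w))); last exact/esym/act_genZ.
congr (_ *: _); rewrite act_gen_base /wgen.
have lE : wext t n w (lo gn) = w (lo gj).
  have lt : (lo gn < j)%N by case/andP: (ij) => h1 h2; apply: leq_ltn_trans (leq_pred _) h2.
  by rewrite (wextE _ lt); congr (w _); apply: val_inj.
have hE : wext t n w (hi gn) = w (hi gj).
  have lt : (hi gn < j)%N by case/andP: (ij).
  by rewrite (wextE _ lt); congr (w _); apply: val_inj.
have sE : wswap gn (wext t n w) = wext t n (wswap gj w).
  apply/ffunP => p; rewrite [LHS]ffunE; case: tpermP => [->|->|ne1 ne2].
  - have lt : (lo gn < j)%N by case/andP: (ij) => h1 h2; apply: leq_ltn_trans (leq_pred _) h2.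
    rewrite hE (wextE _ lt); have -> : Ordinal lt = lo gj by apply: val_inj.
    by rewrite wswap_lo.
  - have lt : (hi gn < j)%N by case/andP: (ij).
    rewrite lE (wextE _ lt); have -> : Ordinal lt = hi gj by apply: val_inj.
    by rewrite wswap_hi.
  case: (ltnP p j) => [lt|ge]; last by rewrite !wext_out.
  rewrite !(wextE _ lt) wswap_out //.
    by apply: contra_notN ne1 => /eqP/(congr1 val) e; apply: val_inj.
  by apply: contra_notN ne2 => /eqP/(congr1 val) e; apply: val_inj.
rewrite lE hE sE; case: ifP => _; last case: ifP => _.
- by rewrite PhiZ Phi_base.
- by rewrite Phi_base.
- by rewrite PhiD !PhiZ !Phi_base.
Qed.

Lemma phi_compat_prodT (r : seq nat) : all (fun l => 0 < l < j)%N r ->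
  phi_compat (\prod_(l <- r) Tgen q j l) (\prod_(l <- r) Tgen q n l).
Proof.
move=> /allP H; rewrite big_seq [X in phi_compat _ X]big_seq.
by apply: phi_compat_prod => l /H; apply: phi_compat_T.
Qed.

Lemma phi_compat_Bop m : (m <= j)%N -> phi_compat (Bop q j m) (Bop q n m).
Proof.
move=> mj; rewrite /Bop big_nat_cond [X in phi_compat _ X]big_nat_cond.
apply: phi_compat_sum => i /andP[/andP[i0 im] _]; apply: phi_compat_prodT.
by apply/allP => l; rewrite mem_rev mem_index_iota; lia.
Qed.

Lemma phi_compat_Bstar m : (m <= j)%N -> phi_compat (Bstar q j m) (Bstar q n m).
Proof.
move=> mj; rewrite /Bstar big_nat_cond [X in phi_compat _ X]big_nat_cond.
apply: phi_compat_sum => i /andP[/andP[i0 im] _]; apply: phi_compat_prodT.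
by apply/allP => l; rewrite mem_index_iota; lia.
Qed.

Lemma phi_compat_R2R : phi_compat (R2R q j j) (R2R q n j).
Proof. by apply: phi_compatM; [apply: phi_compat_Bstar|apply: phi_compat_Bop]. Qed.

Lemma phi_compat_JM k : (k <= j)%N -> phi_compat (JM q j k) (JM q n k).
Proof.
move=> kj; rewrite /JM big_nat_cond [X in phi_compat _ X]big_nat_cond.
apply: phi_compat_sum => i /andP[/andP[i0 ik] _]; apply/phi_compatZ/phi_compatM;
  apply: phi_compat_prodT; apply/allP => l; rewrite ?mem_rev mem_index_iota; lia.
Qed.

Lemma phi_compat_ptab (s : filling N) m : (m <= j)%N ->
  phi_compat (ptab q j s m) (ptab q n s m).
Proof.
move=> mj; rewrite /ptab big_nat_cond [X in phi_compat _ X]big_nat_cond.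
apply: phi_compat_prod => k /andP[/andP[k0 km] _]; apply: phi_compat_prod => d _.
apply/phi_compatZ/phi_compatB; first by apply: phi_compat_JM; lia.
exact/phi_compatZ/phi_compat1.
Qed.

End Extension.

Lemma yam_uniq s : yam s -> uniq s -> s = iota 1 (size s).
Proof.
elim/last_ind: s => // s r IH; rewrite yam_rcons rcons_uniq => /andP[ys ar] /andP[nr us].
have sE := IH ys us; rewrite size_rcons.
have -> : iota 1 (size s).+1 = rcons (iota 1 (size s)) (size s).+1.
  by have := iotaD 1 (size s) 1; rewrite addn1 [iota (1 + size s) 1]/= cats1.
have memE a : (a \in s) = (0 < a <= size s)%N by rewrite {1}sE mem_iota add1n ltnS.
have rs := addable_le ys ar; have r0 : (0 < r)%N by case/andP: ar.
have -> : r = (size s).+1 by move: nr; rewrite memE r0 /= -ltnNge => ?; apply/eqP; rewrite eqn_leq rs.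
by congr rcons.
Qed.

(** * Vanishing of truncated Specht modules *)

Section OneDimensional.
Context (F : fieldType) (q r : F) (N j : nat).
Hypothesis q_neq0 : q != 0.
Hypothesis r_neq0 : r != 0.
Hypothesis r_root : r * r = (q - 1) * r + q.
Local Notation H := (hecke q j).
Local Notation T := (Tgen q j).
Local Notation J := (JM q j).
Local Notation W := (words F N j).
Implicit Type v : W.

Let lD v w (x : H) : act (v + w) x = act v x + act w x.
Proof. exact: (linearD (actr x)). Qed.
Let lZ a v (x : H) : act (a *: v) x = a *: act v x.
Proof. exact: (linearZ_LR (actr x)). Qed.
Let l0 (x : H) : act (0 : W) x = 0.
Proof. exact: (linear0 (actr x)). Qed.
Let r0 v : act v (0 : H) = 0.
Proof. by rewrite -(scale0r (0 : H)) actZ scale0r. Qed.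
Let rN v (x : H) : act v (- x) = - act v x.
Proof. by rewrite -scaleN1r actZ scaleN1r. Qed.

Definition scaled_by (k : nat) v : Prop :=
  forall i, (0 < i < k)%N -> act v (T i) = r *: v.

(* The r-analogue of [Bop], which is the case r = q. *)
Fixpoint Bchar (k : nat) : H :=
  if k is k'.+1 then 1 + (r / q) *: (T k' * Bchar k') else 0.

Lemma Bchar1 : Bchar 1 = 1.
Proof. by rewrite /= mulr0 scaler0 addr0. Qed.

Lemma Bchar_comm k i : (k < i)%N -> (i < j)%N -> GRing.comm (T i) (Bchar k).
Proof.
elim: k => [_ _|k IH lt lti]; first exact: commr0.
case: k IH lt => [|k] IH lt; first by rewrite Bchar1; apply: commr1.
apply: commrD; first exact: commr1.
apply/comm_scale/commrM; last by apply: IH => //; apply: ltnW.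
by apply/esym; apply: Tgen_far; rewrite ?lt.
Qed.

Lemma scaled_by_T k v : (k.+2 < j)%N -> scaled_by k.+2 v -> scaled_by k.+1 (act v (T k.+2)).
Proof.
move=> lt sv i ib; rewrite -actM -Tgen_far; [|lia|lia].
by rewrite actM sv ?lZ //; lia.
Qed.

Lemma scaled_by_braid k v : (k.+2 < j)%N -> scaled_by k.+2 v ->
  act (act (act v (T k.+2)) (T k.+1 * Bchar k.+1)) (T k.+2) =
  r *: act (act v (T k.+2)) (T k.+1 * Bchar k.+1).
Proof.
move=> lt sv; rewrite -!actM.
have -> : T k.+2 * (T k.+1 * Bchar k.+1 * T k.+2) =
    T k.+1 * (T k.+2 * (T k.+1 * Bchar k.+1)).
  have C : GRing.comm (T k.+2) (Bchar k.+1) by apply: Bchar_comm.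
  have br : T k.+1 * T k.+2 * T k.+1 = T k.+2 * T k.+1 * T k.+2 by apply: Tgen_braid; lia.
  by rewrite -!mulrA -C !mulrA br.
by rewrite actM sv ?lZ //; lia.
Qed.

(** [Bchar] is the sum over coset representatives, weighted by the character [T i] to [r]; it turns
    an eigenvector of the smaller algebra into one of the next. *)
Lemma scaled_by_Bchar k v : (k.+1 < j)%N -> scaled_by k.+1 v ->
  scaled_by k.+2 (act v (Bchar k.+2)).
Proof.
elim: k v => [|k IH] v lt sv i ib.
  have -> : i = 1%N by lia.
  have E : Bchar 2 = 1 + (r / q) *: T 1 by rewrite -[Bchar 2]/(1 + _ *: (_ * Bchar 1)) Bchar1 mulr1.
  rewrite E -!actM mulrDl mul1r mul_scalel Tgen_quad // !actD !actZ !actD !actZ act1.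
  move: (act v (T 1)) => w.
  by lin F (words F N j); field: r_root.
have E w : act w (Bchar k.+3) = w + (r / q) *: act (act w (T k.+2)) (Bchar k.+2).
  by rewrite -[Bchar k.+3]/(1 + _ *: (_ * Bchar k.+2)) actD act1 actZ actM.
have E2 w : act w (Bchar k.+2) = w + (r / q) *: act w (T k.+1 * Bchar k.+1).
  by rewrite -[Bchar k.+2]/(1 + _ *: (_ * Bchar k.+1)) actD act1 actZ.
have sv' : scaled_by k.+1 (act v (T k.+2)) by apply: scaled_by_T.
rewrite E lD lZ; case: (ltngtP i k.+2) => [lti|gti|iE]; last 2 first.
- by lia.
- rewrite iE E2 lD lZ scaled_by_braid //.
  have -> : act (act v (T k.+2)) (T k.+2) = (q - 1) *: act v (T k.+2) + q *: v.
    by rewrite -actM Tgen_quad // actD !actZ act1.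
  move: (act v (T k.+2)) (act (act v (T k.+2)) (T k.+1 * Bchar k.+1)) => w x.
  by lin F (words F N j); field: r_root.
have ib1 : (0 < i < k.+2)%N by lia.
rewrite (IH _ (ltnW lt) sv' _ ib1) (sv _ ib1).
by lin F (words F N j); ring.
Qed.

(** Consequently [Bchar k.+2] acts on [v] as [1 + r J k.+2]. *)
Lemma scaled_by_JM k v : (k.+1 < j)%N -> scaled_by k.+1 v ->
  act v (J k.+2) = q^-1 *: act (act v (T k.+1)) (Bchar k.+1).
Proof.
elim: k v => [|k IH] v lt sv; rewrite JM_succ //.
  by rewrite JM_1 mulr0 mul0r add0r actZ Bchar1 act1.
rewrite actZ actD !actM (IH _ (ltnW lt) (scaled_by_T lt sv)) lZ -[act _ (Bchar k.+1)]actM.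
rewrite scaled_by_braid // -[Bchar k.+2]/(1 + _ *: (_ * Bchar k.+1)) actD act1 actZ.
move: (act v (T k.+2)) (act (act v (T k.+2)) (T k.+1 * Bchar k.+1)) => w x.
by lin F (words F N j); field.
Qed.

(** [a m] is the content of box [m + 1] in a single row ([r = q], [a m = m]) or in a single column
    ([r = -1], [a m = - m]). *)
Variable a : nat -> int.
Hypothesis a0 : a 0 = 0.
Hypothesis aS : forall m, qint q (a m.+1) = q^-1 * (r * (r * qint q (a m) + 1)).

Lemma scaled_by_content m v : (m < j)%N -> scaled_by m.+1 v ->
  act v (J m.+1) = qint q (a m) *: v.
Proof.
elim: m => [_ _|m IH lt sv]; first by rewrite JM_1 r0 a0 qint0 scale0r.
have sT : act v (T m.+1) = r *: v by apply: sv; rewrite ltnSn.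
have sJ : act v (J m.+1) = qint q (a m) *: v.
  by apply: IH; [apply: ltnW|move=> i ib; apply: sv; lia].
rewrite JM_succ // actZ actD !actM sT lZ sJ !lZ sT aS.
by lin F (words F N j); ring.
Qed.

(** The factor with [b] is [Bchar] up to the scalar [r], and after it the vector is scaled by one
    more generator. Hence [J n.+1] takes on it the content that prolongs the row or column. *)
Lemma scaled_by_two_contents n (b : int) v : (0 < n < j)%N -> scaled_by n v ->
  r * qint q b = -1 ->
  act (act v (J n.+1 - (qint q b)%:A)) (J n.+1 - (qint q (a n))%:A) = 0.
Proof.
case: n => // n lt sv hb.
have sw := scaled_by_Bchar lt sv; have := scaled_by_content lt sw.
have vB : act v (Bchar n.+2) = r *: act v (J n.+2 - (qint q b)%:A).
  rewrite (actD v (J n.+2)) rN (scaled_by_JM lt sv) -[Bchar n.+2]/(1 + _ *: (_ * Bchar n.+1)).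
  rewrite actD !actZ act1 actM scalerDr scalerN !scalerA hb scaleN1r opprK addrC.
  by congr (_ + _).
rewrite vB !lZ scalerA mulrC -scalerA => /(scalerI r_neq0) E.
by rewrite (actD _ (J n.+2)) rN E actZ act1 subrr.
Qed.

End OneDimensional.

Section RootProducts.
Context (F : fieldType) (q : F) (N j : nat) (x : hecke q j) (f g : int -> F) (P : pred int).
Local Notation A d := (x - (f d)%:A).
Local Notation W := (words F N j).

Let lZ a (v : W) (y : hecke q j) : act (a *: v) y = a *: act v y.
Proof. exact: (linearZ_LR (actr y)). Qed.
Let l0 (y : hecke q j) : act (0 : W) y = 0.
Proof. exact: (linear0 (actr y)). Qed.

Lemma root_factor_comm d e : GRing.comm (A d) (A e).
Proof.
have c1 y c : GRing.comm y (c%:A : hecke q j) by apply/comm_scale/commr1.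
apply: commrB; last exact: c1.
by apply/commr_sym/commrB; [|exact: c1].
Qed.

Let swap (v : W) d e : act (act v (A d)) (A e) = act (act v (A e)) (A d).
Proof. by rewrite -!actM root_factor_comm. Qed.

Lemma root_product1 l a (v : W) : act v (A a) = 0 -> a \in l -> P a ->
  act v (\prod_(d <- l | P d) (g d *: A d)) = 0.
Proof.
move=> + + Pa; elim: l v => // d l IH v va; rewrite inE big_cons => al.
case: (d =P a) => [E|/eqP ne]; first by rewrite E Pa actM actZ va scaler0 l0.
have al' : a \in l by case/orP: al => // /eqP e; rewrite e eqxx in ne.
case: ifP => _; last exact: IH.
by rewrite actM actZ lZ IH ?scaler0 // swap va l0.
Qed.

Lemma root_product2 l a b (v : W) : act (act v (A a)) (A b) = 0 -> a != b ->
  a \in l -> b \in l -> P a -> P b ->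
  act v (\prod_(d <- l | P d) (g d *: A d)) = 0.
Proof.
move=> + ab + + Pa Pb; elim: l v => // d l IH v vab; rewrite !inE big_cons => al bl.
case: (d =P a) => [E|/eqP ne].
  rewrite E Pa actM actZ lZ (@root_product1 _ b) ?scaler0 //.
  by case/orP: bl => // /eqP e; rewrite e E eqxx in ab.
case: (d =P b) => [E|/eqP ne'].
  rewrite E Pb actM actZ lZ (@root_product1 _ a) ?scaler0 //; first by rewrite swap.
  by case/orP: al => // /eqP e; rewrite e eqxx in ne.
have al' : a \in l by case/orP: al => // /eqP e; rewrite e eqxx in ne.
have bl' : b \in l by case/orP: bl => // /eqP e; rewrite e eqxx in ne'.
case: ifP => _; last exact: IH.
by rewrite actM actZ lZ IH ?scaler0 // [act (act v _) (A a)]swap swap vab l0.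
Qed.

End RootProducts.

Section TruncatedDiagram.
Context (F : fieldType) (q : F) (n j : nat) (mu : seq nat) (t : filling n).
Hypothesis q_neq0 : q != 0.
Hypothesis qint_neq0 : forall m, (0 < m <= n)%N -> qint q m != 0.
Hypotheses (pmu : is_partition j mu) (n0 : (0 < n)%N) (nj : (n < j)%N).
Local Notation E := (ydiag n mu).
Hypothesis tE : t \in SYT E 0 j.

Let yE : young E := young_ydiag pmu.

Lemma SYT_truncated : t \in SYT E 0 n.
Proof.
move: tE; rewrite !inE => /and4P[/forallP H1 /forallP H2 -> ->]; rewrite !andbT.
apply/andP; split; apply/forallP.
  by move=> x; move: (H1 x); case: ifP => // _ /andP[-> _] /=; rewrite -ltnS.
by move=> k; apply/implyP => /andP[k0 kn]; have := H2 k; rewrite k0 (leq_trans kn (ltnW nj)).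
Qed.

Let s := rows t n.
Let ys : yam s := yam_rows yE SYT_truncated (leqnn n) (leqnn n).
Let sz : size s = n := size_rows t n.

Lemma mem_truncated r c : (0 < r <= n)%N -> (0 < c <= n)%N -> (c <= nth 0 mu r.-1)%N ->
  (c <= count_mem r s)%N.
Proof.
move=> /andP[r0 rn] /andP[c0 cn] le; rewrite (count_rows_shape SYT_truncated (leqnn n)).
have rn' : (r < n.+1)%N by []. have cn' : (c < n.+1)%N by [].
have := young_mem (Ordinal rn', Ordinal cn') yE; rewrite inE /= r0 c0 le /=.
by move/esym.
Qed.

(** The entries 1, ..., n fill the part of the diagram inside an n by n square. Since [j > n]
    something has been cut off, so the first row or the first column alone already has [n] boxes
    there. *)
Lemma truncated_rows : s = nseq n 1%N \/ uniq s.
Proof.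
have /and3P[_ mu0 /eqP smu] := pmu.
case: (ltnP n (nth 0 mu 0)) => [big|small].
  left; rewrite -sz; apply/all_pred1P; rewrite all_count eqn_leq count_size sz /=.
  by apply: mem_truncated; rewrite ?n0 ?leqnn // ltnW.
case: (ltnP n (size mu)) => [big|small'].
  right; apply: (leq_size_uniq (iota_uniq 1 n)); last by rewrite size_iota sz.
  move=> r; rewrite mem_iota add1n ltnS => rb; rewrite -has_pred1 has_count.
  apply: mem_truncated => //; rewrite ?n0 // lt0n; apply: contraNneq mu0 => <-.
  by case/andP: rb => r0 rn; apply/mem_nth/(leq_ltn_trans _ big)/(leq_trans (leq_pred r)).
have : (sumn mu <= n)%N; last by rewrite smu leqNgt nj.
have H i : (0 < i <= n)%N -> (nth 0 mu i.-1 <= count_mem i s)%N.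
  move=> ib; case: (posnP (nth 0 mu i.-1)) => [->//|c0]; apply: mem_truncated => //.
  by rewrite c0 (leq_trans _ small) // (nth_partition pmu).
have := @count_rows s (fun i => nth 0 mu i.-1) 1 n.-1.
rewrite sz => /(_ (fun i ib => H i ltac:(lia)) (H 1%N ltac:(lia))).
have bE : (\sum_(1 <= i < n.+1) nth 0 mu i.-1 =
    nth 0 mu 0 + \sum_(2 <= i < 1 + n.-1.+1) nth 0 mu i.-1)%N.
  by rewrite big_ltn // add1n prednK.
move=> le; have {}le : (\sum_(1 <= i < n.+1) nth 0 mu i.-1 <= n)%N by rewrite bE.
rewrite big_add1 /= in le; apply: leq_trans le.
rewrite sumnE (big_nth 0%N) [X in (_ <= X)%N](@big_cat_nat _ _ _ (size mu)) //=.
exact: leq_addr.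
Qed.

(** The first [n] letters give a vector on which all [T i] with [i < n] act by one scalar. The
    factors of [ptab] at [k = n + 1] include both roots of the quadratic equation of [J n.+1] on it,
    so they kill it. *)
Lemma truncated_generator : act (wbase F (word_of t j)) (ptab q j t j) = 0.
Proof.
have T_pwE := @T_pw F q n (hecke q n) (Tgen q n) (JM q n) q_neq0 (@Tgen_quad F q n) (@Tgen_far F q n)
  (@Tgen_braid F q n) (JM_1 q n) (@JM_succ F q n) qint_neq0.
have wE : word_of t j = wext t j (word_of t n).
  apply/ffunP => p; rewrite [LHS]ffunE; case: (ltnP p n) => pn; last by rewrite wext_out.
  by rewrite (wextE _ _ pn) ffunE.
pose u := act (wbase F (word_of t n)) (ptab q n t n).
have uE : act (wbase F (word_of t j)) (ptab q j t n) = Phi t j u.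
  by rewrite (phi_compat_ptab q t (ltnW nj) t (leqnn n)) Phi_base wE.
have scaled r : (forall i, (0 < i < n)%N -> pw q (JM q n) s * Tgen q n i = r *: pw q (JM q n) s) ->
    scaled_by q r n (Phi t j u).
  move=> H i ib; rewrite -(phi_compat_T q t (ltnW nj) ib) -PhiZ; congr Phi.
  by rewrite /u (ptabE q yE (leqnn n) SYT_truncated) -actM H // actZ.
have split i : (0 < i < n)%N -> exists z b c y, s = z ++ b :: c :: y /\ (size z).+1 = i.
  move=> ib; have [z [b [c [y [-> zE]]]]] : exists s1 a c t, s = s1 ++ a :: c :: t /\ size s1 = i.-1.
    by apply: split_two; rewrite sz; lia.
  by exists z, b, c, y; split=> //; rewrite zE; lia.
have kill (b e : int) : act (act (Phi t j u) (JM q j n.+1 - (qint q b)%:A)) (JM q j n.+1 - (qint q e)%:A) = 0 ->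
    (0 < `|b| <= n)%N -> (0 < `|e| <= n)%N -> b != e ->
    act (wbase F (word_of t j)) (ptab q j t j) = 0.
  move=> K bb eb be.
  (* No box can carry the entry [n + 1], so [box_of] returns its default and the content is 0. Every
     [d] with [0 < |d| <= n] therefore contributes a factor, and none of these is omitted. *)
  have cE : content_of t n.+1 = 0.
    rewrite /content_of /box_of; case: pickP => [x /eqP tx|_]; last by [].
    by have := ltn_ord (t x); rewrite tx ltnn.
  have -> : ptab q j t j = ptab q j t n * \prod_(n.+1 <= k < j.+1)
      \prod_(d <- contents k | (d != content_of t k) && (qint q (content_of t k) - qint q d != 0))
      ((qint q (content_of t k) - qint q d)^-1 *: (JM q j k - (qint q d)%:A)).
    by rewrite /ptab (@big_cat_nat _ _ _ n.+1) //= ltnS ltnW.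
  rewrite actM uE big_ltn ?ltnS // actM.
  have memc (d : int) : (0 < `|d| <= n)%N -> d \in contents n.+1.
    move=> db; rewrite /contents mem_filter; apply/andP; split.
      by apply/implyP => /eqP d0; rewrite d0 in db.
    apply/mapP; exists (absz (d + n%:Z)); last by rewrite /=; lia.
    by rewrite mem_iota leq0n add0n doubleS -mul2n /=; lia.
  have good (d : int) : (0 < `|d| <= n)%N ->
      (d != content_of t n.+1) && (qint q (content_of t n.+1) - qint q d != 0).
    move=> db; have d0 : d != 0 by apply: contraTneq db => ->.
    rewrite cE d0 subr_eq0 (qint_inj_bounded q_neq0 qint_neq0) // 1?eq_sym //.
    by move: db; clear; lia.
  have -> : act (Phi t j u) (\prod_(d <- contents n.+1 | (d != content_of t n.+1) &&
        (qint q (content_of t n.+1) - qint q d != 0))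
      ((qint q (content_of t n.+1) - qint q d)^-1 *: (JM q j n.+1 - (qint q d)%:A))) = 0.
    by apply: (root_product2 (f := qint q) _ K be); rewrite ?memc ?good.
  exact: (linear0 (actr _)).
case: truncated_rows => [s1|us].
  (* A row of [n] boxes has addable contents [n] and [-1]; a column, below, has [1] and [-n]. *)
  apply: (kill (-1) n%:Z); try lia.
  apply: (@scaled_by_two_contents _ q q n j q_neq0 q_neq0 _ (fun m => m%:Z)) => //.
  - by ring.
  - by move=> m; rewrite mulKf // -(qintD1 q_neq0); congr qint; lia.
  - by rewrite n0.
  - apply: scaled => i /split[z [b [c [y [sE <-]]]]]; have := ys; have := sz; rewrite sE => sz' ys'.
    have mem1 d : d \in s -> d = 1%N by rewrite s1 mem_nseq => /andP[_ /eqP].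
    have bs : b \in s by rewrite sE mem_cat in_cons eqxx orbT.
    have cs : c \in s by rewrite sE mem_cat !in_cons eqxx !orbT.
    have bc : b = c := etrans (mem1 b bs) (esym (mem1 c cs)).
    case: (T_pwE _ _ _ _ ys' sz') => [[_ _ E]|[E _ _ _]|[ne _ _ _ _]]; first exact: E.
      by move: E; rewrite bc; lia.
    by rewrite bc eqxx in ne.
  - have := qintB1 q_neq0 0; rewrite add0r qint0 => /eqP; rewrite addr_eq0 => /eqP->.
    by [].
apply: (kill 1 (- n%:Z)); try lia.
apply: (@scaled_by_two_contents _ q (-1) n j q_neq0 _ _ (fun m => - m%:Z)) => //.
- by rewrite oppr_eq0 oner_eq0.
- by ring.
- move=> m; have := qintB1 q_neq0 (- m%:Z).
  have -> : - m%:Z - 1 = - m.+1%:Z by lia.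
  by move<-; field.
- by rewrite n0.
- apply: scaled => i /split[z [b [c [y [sE <-]]]]]; have := ys; have := sz; have := us.
  rewrite sE => us' sz' ys'; rewrite scaleN1r.
  case: (T_pwE _ _ _ _ ys' sz') => [[bc _ _]|[_ _ _ E]|[ne _ ys2 _ _]]; [|exact: E|].
    by move: us'; rewrite bc cat_uniq /= inE eqxx !andbF.
  have us2 : uniq (z ++ c :: b :: y) by rewrite (perm_uniq (perm_swap z y c b)).
  have := yam_uniq ys' us'; rewrite (_ : size _ = size (z ++ c :: b :: y)); last by rewrite !size_cat.
  rewrite -(yam_uniq ys2 us2) => /eqP; rewrite eqseq_cat // eqxx /= eqseq_cons.
  by rewrite (negbTE ne).
by rewrite (qint1 q_neq0) mulr1.
Qed.

End TruncatedDiagram.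

(** * Semisimplicity *)

Section Semisimplicity.
Context (F : fieldType) (q : F) (n : nat).
Hypothesis q_neq0 : q != 0.
Hypothesis natr_neq0 : forall m, (0 < m)%N -> m%:R != 0 :> F.
Local Open Scope quotient_scope.
Local Notation H := (hecke q n).
Local Notation T := (Tgen q n).
Local Notation B := (Bop q n).

(** The sum of all [T_w] with [w] in the symmetric group on [m] letters, factored through coset
    representatives. *)
Definition symmetrizer (m : nat) : H := \prod_(1 <= k < m.+1) B k.

Lemma T_symmetrizer i : (0 < i < n)%N -> T i * symmetrizer n = q *: symmetrizer n.
Proof.
move=> lt; have /andP[i0 ltn] := lt.
have BS m : (0 < m < n)%N -> B m.+1 = 1 + T m * B m by rewrite Bop_succ.
have BsS m : (0 < m < n)%N -> Bstar q n m.+1 = 1 + Bstar q n m * T m by rewrite Bstar_succ.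
have BT : T i * B i * B i.+1 = q *: (B i * B i.+1).
  exact: (T_B_B q_neq0 (@Tgen_quad F q n) (@Tgen_far F q n) (@Tgen_braid F q n)
    (Bop_1 q n) (Bstar_1 q n) BS BsS lt).
have cB k : (0 < k < i)%N -> GRing.comm (T i) (B k).
  move=> kb; apply: (proj1 (comm_B q_neq0 (Bop_1 q n) (Bstar_1 q n) BS BsS _ _)).
    by move=> l lb; apply/esym; apply: Tgen_far; lia.
  by lia.
rewrite /symmetrizer (@big_cat_nat _ _ _ i) //=; last by rewrite ltnW // ltnS ltnW.
rewrite [X in _ * (_ * X) = _]big_ltn; last by rewrite ltnS ltnW.
rewrite [X in _ * (_ * (_ * X)) = _]big_ltn //.
rewrite [X in _ = _ *: (_ * X)]big_ltn; last by rewrite ltnS ltnW.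
rewrite [X in _ = _ *: (_ * (_ * X))]big_ltn //.
set p1 := bigop _ _ _; set p2 := bigop _ _ _.
have c1 : GRing.comm (T i) p1.
  rewrite /p1 big_nat_cond; apply: commr_prod => k /andP[/andP[k0 ki] _].
  by apply: cB; rewrite k0.
rewrite mulrA c1 -mulrA (mulrA (B i)) (mulrA (T i)) (mulrA (T i)) BT.
by rewrite mul_scalel mul_scaler.
Qed.

Lemma heval_symmetrizer (x : hterm F n) :
  \pi_H x * symmetrizer n = heval q x *: symmetrizer n.
Proof.
elim: x => [i|||x IHx y IHy|x IHx|x IHx y IHy|c x IHx] /=.
- by have := T_symmetrizer (valP i); rewrite (TgenE q (valP i)) (_ : Sub _ _ = i) //; apply: val_inj.
- by rewrite scale0r -[\pi_H _]/(0 : H) mul0r.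
- by rewrite scale1r -[\pi_H _]/(1 : H) mul1r.
- have -> : \pi_H (HAdd x y) = \pi_H x + \pi_H y :> H by exact/esym/hadd_pi.
  by rewrite mulrDl IHx IHy scalerDl.
- have -> : \pi_H (HOpp x) = - \pi_H x :> H by exact/esym/hopp_pi.
  by rewrite mulNr IHx scaleNr.
- have -> : \pi_H (HMul x y) = \pi_H x * \pi_H y :> H by exact/esym/hmul_pi.
  by rewrite -mulrA IHy mul_scaler IHx scalerA mulrC.
- have -> : \pi_H (HScale c x) = c *: \pi_H x :> H by exact/esym/hscale_pi.
  by rewrite mul_scalel IHx scalerA.
Qed.

Lemma mul_symmetrizer (h : H) : exists c, h * symmetrizer n = c *: symmetrizer n.
Proof. by elim/quotW: h => x; exists (heval q x); apply: heval_symmetrizer. Qed.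

Lemma B_symmetrizer k : (0 < k <= n)%N ->
  B k * symmetrizer n = qint q k *: symmetrizer n.
Proof.
case: k => // k; elim: k => [_|k IH lt].
  by rewrite Bop_1 mul1r (qint1 q_neq0) scale1r.
rewrite Bop_succ mulrDl mul1r -mulrA IH; last by lia.
rewrite mul_scaler T_symmetrizer; last by lia.
have -> : qint q k.+2 = q * qint q k.+1 + 1.
  by rewrite -(qintD1 q_neq0); congr qint; lia.
by rewrite scalerDl scale1r scalerA addrC mulrC.
Qed.

Lemma symmetrizer_sqr :
  symmetrizer n * symmetrizer n = \prod_(1 <= k < n.+1) qint q k *: symmetrizer n.
Proof.
rewrite {1}/symmetrizer; set e := symmetrizer n.
suff H m : (m <= n)%N -> (\prod_(1 <= k < m.+1) B k) * e = \prod_(1 <= k < m.+1) qint q k *: e.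
  exact: H.
elim: m => [_|m IH lt]; first by rewrite !big_geq // mul1r scale1r.
have -> : \prod_(1 <= k < m.+2) B k = \prod_(1 <= k < m.+1) B k * B m.+1 by rewrite big_nat_recr.
have -> : \prod_(1 <= k < m.+2) qint q k = \prod_(1 <= k < m.+1) qint q k * qint q m.+1.
  by rewrite big_nat_recr.
by rewrite -mulrA B_symmetrizer // mul_scaler IH 1?ltnW // scalerA mulrC.
Qed.

(** The letter [c] exceeds everything to its left, so each generator meets an ascent and merely
    swaps: no power of [q] appears and all words have coefficient 1. *)
Lemma act_B_insert u c r : size (u ++ c :: r) = n -> all (leq^~ n) (u ++ c :: r) ->
  all (fun a => a < c)%N u ->
  exists2 l : seq (seq nat), (0 < size l)%N /\ all (perm_eq (rcons u c)) l &
    act (wv F n (u ++ c :: r)) (B (size u).+1) = \sum_(w <- l) wv F n (w ++ r).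
Proof.
elim/last_ind: u r => [|u b IH] r sz bx lc.
  exists [:: [:: c]]; first by rewrite /= perm_refl.
  by rewrite big_seq1 /= Bop_1 act1.
rewrite all_rcons in lc; case/andP: lc => bc lc.
rewrite cat_rcons in sz bx *; rewrite size_rcons.
have sz' : size (u ++ c :: b :: r) = n by rewrite -sz !size_cat.
have bx' : all (leq^~ n) (u ++ c :: b :: r) by rewrite -(perm_all _ (perm_swap u r b c)).
have [l [l0 lp] lE] := IH (b :: r) sz' bx' lc.
exists (rcons (rcons u b) c :: [seq rcons w b | w <- l]).
  split=> //=; rewrite perm_refl /= all_map; apply: sub_all lp => w pw /=.
  rewrite -!cats1 -!catA /= (perm_trans (_ : perm_eq _ (u ++ [:: c; b]))) //.
    by rewrite perm_swap.
  rewrite -cats1 in pw.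
  by rewrite -[u ++ [:: c; b]]/(u ++ [:: c] ++ [:: b]) catA perm_cat2r.
rewrite Bop_succ actD act1 actM act_T_wv // ltn_eqF // bc lE big_cons big_map !cat_rcons.
by congr (_ + _); apply: eq_bigr => w _; rewrite cat_rcons.
Qed.

Lemma act_symmetrizer m : (m <= n)%N ->
  exists2 l : seq (seq nat), (0 < size l)%N /\ all (perm_eq (iota 1 m)) l &
    act (wv F n (iota 1 n)) (symmetrizer m) = \sum_(w <- l) wv F n (w ++ iota m.+1 (n - m)).
Proof.
elim: m => [_|m IH lt].
  exists [:: [::]] => //; rewrite big_seq1 /symmetrizer big_geq // act1 subn0 //.
have [l [l0 lp] lE] := IH (ltnW lt).
have -> : symmetrizer m.+1 = symmetrizer m * B m.+1 by rewrite /symmetrizer big_nat_recr.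
rewrite actM lE act_suml.
have ie : iota m.+1 (n - m) = m.+1 :: iota m.+2 (n - m.+1).
  by have -> : (n - m = (n - m.+1).+1)%N by lia.
have step w : w \in l -> exists2 l' : seq (seq nat),
    (0 < size l')%N /\ all (perm_eq (iota 1 m.+1)) l' &
    act (wv F n (w ++ iota m.+1 (n - m))) (B m.+1) = \sum_(v <- l') wv F n (v ++ iota m.+2 (n - m.+1)).
  move=> wl; have pw := allP lp _ wl; have sw := perm_size pw; rewrite size_iota in sw.
  rewrite ie [in B m.+1]sw.
  have [||| l' [l'0 l'p] l'E] := @act_B_insert w m.+1 (iota m.+2 (n - m.+1)).
  - by rewrite size_cat /= size_iota -sw; lia.
  - rewrite -(perm_all _ (_ : perm_eq (iota 1 m ++ m.+1 :: iota m.+2 (n - m.+1)) _)).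
      by apply/allP => a; rewrite mem_cat inE !mem_iota; lia.
    by rewrite perm_cat2r.
  - by rewrite -(perm_all _ pw); apply/allP => a; rewrite mem_iota; lia.
  exists l' => //; split=> //; apply: sub_all l'p => v; apply: perm_trans.
  have -> : iota 1 m.+1 = rcons (iota 1 m) m.+1.
    by have := iotaD 1 m 1; rewrite addn1 [iota (1 + m) 1]/= cats1 add1n.
  by rewrite -!cats1 perm_cat2r.
have {step} : forall l0, all [in l] l0 -> exists2 l' : seq (seq nat),
    (size l0 <= size l')%N /\ all (perm_eq (iota 1 m.+1)) l' &
    \sum_(w <- l0) act (wv F n (w ++ iota m.+1 (n - m))) (B m.+1) =
    \sum_(v <- l') wv F n (v ++ iota m.+2 (n - m.+1)).
  elim=> [_|w l1 IHl /= /andP[wl /IHl[l2 [s2 p2] E2]]].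
    by exists [::]; rewrite // !big_nil.
  have [l3 [s3 p3] E3] := step w wl; exists (l3 ++ l2).
    by rewrite size_cat all_cat p3 p2; split=> //; rewrite -add1n leq_add.
  by rewrite big_cons big_cat E2 E3.
move=> /(_ l (introT allP (fun w h => h))) [l' [s' p'] E'].
by exists l' => //; split=> //; apply: leq_trans s'.
Qed.

(** Applied to the word 1 2 ... n it gives a nonempty sum of words with coefficient 1; the total of
    the coefficients is a positive integer, nonzero in [F]. *)
Lemma symmetrizer_neq0 : symmetrizer n != 0.
Proof.
apply/eqP => e0; have [l [l0 lp]] := act_symmetrizer (leqnn n).
rewrite e0 act0r => /(congr1 (fun v : words F n n => \sum_w v w)).
rewrite big1; last by move=> w _; rewrite ffunE.
have -> : \sum_w (\sum_(x <- l) wv F n (x ++ iota n.+1 (n - n))) w = (size l)%:R.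
  transitivity (\sum_(x <- l) (\sum_w wv F n (x ++ iota n.+1 (n - n)) w)).
    by rewrite exchange_big; apply: eq_bigr => w _; rewrite sum_ffunE.
  rewrite -sum1_size natr_sum; apply: eq_bigr => x _.
  rewrite (bigD1 (word_seq n (x ++ iota n.+1 (n - n)))) //= ffunE eqxx big1 ?addr0 // => w ne.
  by rewrite ffunE (negbTE ne).
by move/esym/eqP; rewrite (negbTE (natr_neq0 l0)).
Qed.

Lemma semisimple_qint_neq0 : semisimple H -> forall m, (0 < m <= n)%N -> qint q m != 0.
Proof.
move=> ss m mn; apply/negP => /eqP qm0; set e := symmetrizer n.
have ee : e * e = 0.
  rewrite symmetrizer_sqr (_ : \prod_(1 <= k < n.+1) _ = 0) ?scale0r //.
  apply/eqP; rewrite prodf_seq_eq0; apply/hasP; exists m.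
    by rewrite mem_index_iota.
  by apply/andP; split=> //; apply/eqP.
have [|J [[J0 JD JM] IJ split1]] := ss (fun x => exists h, x = e * h).
  split; first by exists 0; rewrite mulr0.
  - by move=> _ _ [h ->] [h' ->]; exists (h + h'); rewrite mulrDr.
  - by move=> _ a [h ->]; exists (h * a); rewrite mulrA.
have [y [z [[h yE] Jz E1]]] := split1 1.
(* [h * e] is a multiple of [e], so [y * y] contains [e * e]. Then [z * y = y] puts [y] into both
   ideals, whence the complement contains 1. *)
have yy : y * y = 0.
  have [c hc] := mul_symmetrizer h.
  by rewrite {1}yE -mulrA [in h * y]yE (mulrA h) hc mul_scalel mul_scaler mulrA ee mul0r scaler0.
have y0 : y = 0.
  have zE : z = 1 - y by rewrite E1 addrAC subrr add0r.
  have zy : z * y = y by rewrite zE mulrBl mul1r yy subr0.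
  by apply: IJ; [exists h | rewrite -zy; apply: JM].
have J1 : J 1 by rewrite E1 y0 add0r.
have := symmetrizer_neq0; rewrite -/e => /eqP; apply.
apply: IJ; first by exists 1; rewrite mulr1.
by rewrite -[e]mul1r; apply: JM.
Qed.

End Semisimplicity.

(** * Words of a fixed content *)

Section Support.
Context (F : fieldType) (q : F) (N m : nat) (c : pred (word N m)).

Definition supported (v : words F N m) : Prop := forall w, ~~ c w -> v w = 0.

Lemma supported0 : supported 0.
Proof. by move=> w _; rewrite ffunE. Qed.

Lemma supported_lin a u v : supported u -> supported v -> supported (a *: u + v).
Proof. by move=> su sv w nc; rewrite !ffunE su // sv // scaler0 addr0. Qed.

Lemma supported_base w : c w -> supported (wbase F w).
Proof. by move=> cw w' nc; rewrite ffunE; case: eqP => // E; rewrite E cw in nc. Qed.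

Lemma supported_act (v : words F N m) (x : hecke q m) :
  (forall i w, c (wswap i w) = c w) -> supported v -> supported (act v x).
Proof.
move=> cs; rewrite -[x]reprK act_pi; elim: (repr x) v => [i|||x1 IHx x2 IHy|x1 IHx|x1 IHx x2 IHy|a x1 IHx] v sv /=.
- move=> w nc; rewrite /act_gen sum_ffunE big1 // => w' _; rewrite ffunE.
  case cw: (c w'); last by rewrite (sv _ (negbT cw)) scale0r.
  have n1 : (w == w') = false by apply: contraNF nc => /eqP->.
  have n2 : (w == wswap i w') = false by apply: contraNF nc => /eqP->; rewrite cs.
  by rewrite /wgen; case: ifP => _; last case: ifP => _; rewrite !ffunE ?n1 ?n2 ?scaler0 ?addr0 ?scaler0.
- exact: supported0.
- exact: sv.
- by rewrite -[act_term q x1 v]scale1r; apply: supported_lin; [apply: IHx|apply: IHy].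
- by rewrite -scaleN1r -[_ *: _]addr0; apply: supported_lin; [apply: IHx|apply: supported0].
- by apply: IHy; apply: IHx.
- by rewrite -[_ *: _]addr0; apply: supported_lin; [apply: IHx|apply: supported0].
Qed.

End Support.

Lemma word_letters_wswap (n : nat) (i : gidx n) (w : word n n) :
  perm_eq (word_letters (wswap i w)) (word_letters w).
Proof.
rewrite /word_letters.
have -> : [seq (wswap i w p : nat) | p <- enum 'I_n] =
    [seq (w p : nat) | p <- [seq tperm (lo i) (hi i) p | p <- enum 'I_n]].
  by rewrite -[RHS]map_comp; apply: eq_map => p /=; rewrite ffunE.
apply: perm_map; apply: uniq_perm; rewrite ?enum_uniq //.
  by rewrite map_inj_uniq ?enum_uniq //; apply: perm_inj.
move=> p; rewrite mem_enum inE; apply/mapP; exists (tperm (lo i) (hi i) p).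
  by rewrite mem_enum.
by rewrite tpermK.
Qed.

(** * The eigenvectors *)

Section SkewProjection.
Context (F : fieldType) (q : F) (n j : nat) (E L : {set box n}) (t : filling n).
Hypothesis q_neq0 : q != 0.
Hypothesis qint_neq0 : forall m, (0 < m <= n)%N -> qint q m != 0.
Hypotheses (yE : young E) (yL : young L) (EL : E \subset L) (jn : (j <= n)%N).
Hypothesis tD : t \in SYT (L :\: E) j n.
Local Notation D := (L :\: E).
Local Notation H := (hecke q n).
Local Notation T := (Tgen q n).
Local Notation B := (Bop q n).
Local Notation Bs := (Bstar q n).
Local Notation J := (JM q n).
Local Notation W := (words F n n).
Local Notation Dk := (shape_upto E t).
Local Notation p k := (pshape q n (Dk k) k).

Lemma setUED : E :|: D = L.
Proof. by rewrite -{1}(setIidPr EL) setID. Qed.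

Lemma disjointED : [disjoint E & D].
Proof. by rewrite -setI_eq0; apply/eqP/setP => x; rewrite !inE; case: (x \in E). Qed.

Let yED : young (E :|: D). Proof. by rewrite setUED. Qed.
Let young_Dk k : young (Dk k) := @young_shape_upto n E _ _ _ _ yE yED tD k.
Let Dk_succ k (kb : (j <= k < n)%N) := shape_upto_succ disjointED tD (leqnn n) kb.

Lemma skew_projector k : (k <= n)%N -> shape_projector q n J k (has_shape (Dk k)) (p k).
Proof. by move=> kn; apply: pshape_projector. Qed.

Lemma skew_projector_T i k : (0 < i < k)%N -> (k <= n)%N -> GRing.comm (T i) (p k).
Proof.
move=> ik kn; apply: (shape_projector_T q_neq0 (@Tgen_quad F q n) (@Tgen_far F q n)
  (@Tgen_braid F q n) (JM_1 q n) (@JM_succ F q n) qint_neq0 (skew_projector kn)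
  (@has_shape_perm n (Dk k))) => //.
Qed.

Lemma skew_projector_idem k : (k <= n)%N -> p k * p k = p k.
Proof.
move=> kn; exact: (shape_projector_idem q_neq0 (@Tgen_quad F q n) (@Tgen_far F q n)
  (@Tgen_braid F q n) (JM_1 q n) (@JM_succ F q n) qint_neq0 (skew_projector kn)).
Qed.

Lemma skew_projector_comm k l : (k <= n)%N -> (l <= n)%N -> GRing.comm (p k) (p l).
Proof.
move=> kn ln; exact: (shape_projector_comm q_neq0 (@Tgen_quad F q n) (@Tgen_far F q n)
  (@Tgen_braid F q n) (JM_1 q n) (@JM_succ F q n) qint_neq0 (skew_projector kn) (skew_projector ln)).
Qed.

(** Consecutive shapes of [t] differ by the box of [k + 1], so every tableau that passes through
    both has this box as its step [k + 1]. *)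
Lemma skew_projector_J k : (j <= k < n)%N ->
  p k * p k.+1 * J k.+1 = qint q (content_of t k.+1) *: (p k * p k.+1).
Proof.
move=> kb; have /andP[jk kn] := kb.
apply: (shape_projector_J q_neq0 (@Tgen_quad F q n) (@Tgen_far F q n)
  (@Tgen_braid F q n) (JM_1 q n) (@JM_succ F q n) qint_neq0 kn (skew_projector (ltnW kn)) (skew_projector kn)).
move=> s r yr sz /forallP cs /forallP cs'; have := yr; rewrite yam_rcons => /andP[ys ar].
have r0 : (0 < r)%N by case/andP: ar.
have rn : (r < n.+1)%N by rewrite ltnS (leq_trans (addable_le ys ar)) // sz.
have [sE nb] := Dk_succ kb.
have := cs' (Ordinal rn); have := cs (Ordinal rn); rewrite /= r0 sE rowlen_set1U //.
move=> /eqP c1 /eqP; rewrite -cats1 count_cat /= eqxx c1 addn0 addnC => /addIn.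
case: eqP => // bE _; rewrite /kap /content_of.
by rewrite (box_of_col yE yED disjointED tD (leqnn n) kb) bE c1; lia.
Qed.

Lemma comm_Bn (y : H) m : (forall i, (0 < i < m)%N -> GRing.comm y (T i)) ->
  (0 < m <= n)%N -> GRing.comm y (B m) /\ GRing.comm y (Bs m).
Proof.
by apply: (comm_B q_neq0 (Bop_1 q n) (Bstar_1 q n)) => k _; rewrite (Bop_succ, Bstar_succ).
Qed.

Lemma skew_projector_B m k : (m <= k <= n)%N ->
  GRing.comm (p k) (B m) /\ GRing.comm (p k) (Bs m).
Proof.
move=> /andP[mk kn]; case: m mk => [_|m mk].
  by rewrite /Bop /Bstar !big_geq //; split; apply: commr0.
apply: comm_Bn; last by rewrite (leq_trans mk).
by move=> i /andP[i0 im]; apply/esym/skew_projector_T => //; rewrite i0 (leq_trans im).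
Qed.

Definition eigen (m : nat) : F :=
  q ^+ m * \sum_(j.+1 <= k < m.+1) qint q (content_of t k)
  + \sum_(j.+1 <= k < m.+1) q ^+ (m - k) * qint q k.

Lemma eigen_start : eigen j = 0.
Proof. by rewrite /eigen !big_geq // mulr0 addr0. Qed.

Lemma eigen_succ m : (j <= m)%N -> eigen m.+1 =
  q * eigen m + (qint q m.+1 + q ^+ m.+1 * qint q (content_of t m.+1)).
Proof.
move=> jm; have recr (f : nat -> F) :
    \sum_(j.+1 <= k < m.+2) f k = \sum_(j.+1 <= k < m.+1) f k + f m.+1.
  by rewrite big_nat_recr.
rewrite /eigen !recr subnn expr0 mul1r.
have -> : \sum_(j.+1 <= k < m.+1) q ^+ (m.+1 - k) * qint q k =
    q * \sum_(j.+1 <= k < m.+1) q ^+ (m - k) * qint q k.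
  rewrite mulr_sumr; apply: eq_big_nat => k /andP[_ km].
  by rewrite subSn // exprS mulrA.
by rewrite exprS; ring.
Qed.

Lemma sum_contents : \sum_(j.+1 <= k < n.+1) qint q (content_of t k) = qcontent q D.
Proof.
have K m : (j <= m <= n)%N ->
    \sum_(j.+1 <= k < m.+1) qint q (content_of t k) = qcontent q (Dk m :\: E).
  elim: m => [|m IH] /andP[jm mn].
    have j0 : j = 0%N by lia.
    by rewrite big_geq -?{2}j0 // /qcontent -{1}j0 (shape_upto_start E tD) setDv big_set0.
  case: (ltngtP j m.+1) jm => // [lt|je] _; last first.
    by rewrite -je big_geq // (shape_upto_start E tD) /qcontent setDv big_set0.
  have kb : (j <= m < n)%N by rewrite -ltnS lt.
  rewrite big_nat_recr //= IH; last by rewrite -ltnS lt ltnW.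
  have [sE nb] := Dk_succ kb; rewrite /qcontent.
  have -> : Dk m.+1 :\: E = box_of t m.+1 |: (Dk m :\: E).
    apply/setP => x; rewrite sE !in_setD !in_setU1 in_setD.
    case: eqP => // ->; rewrite andbT; apply: contra nb.
    by rewrite (mem_shape_upto E tD) => ->.
  have nin : box_of t m.+1 \notin Dk m :\: E by rewrite in_setD (negbTE nb) andbF.
  by rewrite addrC /content_of; apply/esym; exact: big_setU1 nin.
rewrite K ?jn ?leqnn // (shape_upto_end E tD) setUED //.
Qed.

Section Vector.
Variable y : W.
Hypothesis y_proj : forall k, (j <= k <= n)%N -> act y (p k) = y.
Hypothesis y_R : act y (R2R q n j) = 0.

(** The shuffles applied so far involve only generators of index below [k], all of which commute
    with [p k]. *)
Lemma Cop_proj m k : (j <= m <= k)%N -> (k <= n)%N ->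
  act (act y (Cop q n j m)) (p k) = act y (Cop q n j m).
Proof.
move=> /andP[jm mk] kn; have C : GRing.comm (p k) (Cop q n j m).
  rewrite /Cop big_nat_cond; apply: commr_prod => i /andP[/andP[_ im] _].
  by apply: (proj1 (skew_projector_B _)); rewrite kn andbT; lia.
by rewrite -actM -C actM y_proj // (leq_trans jm mk).
Qed.

Lemma Cop_eigen m : (j <= m <= n)%N ->
  act (act y (Cop q n j m)) (R2R q n m) = eigen m *: act y (Cop q n j m).
Proof.
elim: m => [|m IH] mb.
  have j0 : j = 0%N by lia.
  by rewrite -j0 eigen_start scale0r /Cop big_geq // act1.
case: (ltngtP j m.+1) mb => // [lt mn|je _]; last first.
  by rewrite -je eigen_start scale0r /Cop big_geq // act1.
have jm : (j <= m)%N by [].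
have {}IH : act (act y (Cop q n j m)) (R2R q n m) = eigen m *: act y (Cop q n j m).
  by apply: IH; rewrite jm ltnW.
have CE : Cop q n j m.+1 = Cop q n j m * B m.+1 by rewrite /Cop big_nat_recr.
rewrite CE actM; set z := act y (Cop q n j m) in IH *.
have zp k : (m <= k <= n)%N -> act z (p k) = z.
  by move=> /andP[mk kn]; apply: Cop_proj; rewrite // jm.
have zJ : act z (J m.+1) = qint q (content_of t m.+1) *: z.
  have zpp : act z (p m * p m.+1) = z by rewrite actM !zp ?leqnn ?leqnSn ?(ltnW mn).
  by rewrite -{1}zpp -actM skew_projector_J ?jm // actZ zpp.
have BR := B_R q_neq0 (@Tgen_quad F q n) (@Tgen_far F q n) (@Tgen_braid F q n)
  (JM_1 q n) (@JM_succ F q n) (Bop_1 q n) (Bstar_1 q n) (fun k _ => Bop_succ q n k)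
  (fun k _ => Bstar_succ q n k) (mn : (0 < m.+1 <= n)%N).
rewrite {}/R2R -actM BR in IH *.
rewrite actM !actD !actZ act1 zJ.
(* The term missing from [B_R] at level 1 is consistent: [m = 0] forces [j = 0], where the
   eigenvalue is 0. *)
have -> : act z ((q *: (Bs m.+1.-1 * B m.+1.-1)) *+ (1 < m.+1)%N) = (q * eigen m) *: z.
  case: (m =P 0%N) => [m0|/eqP m0].
    have -> : eigen m = 0 by rewrite (_ : m = j) ?eigen_start //; lia.
    by rewrite mulr0 scale0r m0 ltnn mulr0n act0r.
  have -> : (1 < m.+1)%N by rewrite ltnS lt0n.
  by rewrite mulr1n actZ /= IH scalerA.
by rewrite scalerA -!scalerDl actZl eigen_succ // addrA.
Qed.

End Vector.

Lemma skew_shape_end : Dk n = L.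
Proof. by rewrite (shape_upto_end E tD) setUED. Qed.

(** [has_shape] does not look at the letter 0, which is excluded separately. *)
Definition lam_word (w : word n n) : bool :=
  has_shape L (word_letters w) && all (leq 1) (word_letters w).

Lemma lam_word_wswap i w : lam_word (wswap i w) = lam_word w.
Proof.
by rewrite /lam_word (has_shape_perm _ (word_letters_wswap i w))
  (perm_all _ (word_letters_wswap i w)).
Qed.

Lemma supported_specht v : supported lam_word v -> act v (p n) = v -> v \in specht q n L.
Proof.
move=> sv pv; rewrite -pv (wbase_sum v) act_suml; apply: memv_suml => w _.
rewrite actZl; case gw: (lam_word w); last by rewrite sv ?gw // scale0r mem0v.
apply: memvZ; have -> : wbase F w = wv F n (word_letters w) by rewrite /wv word_lettersK.
rewrite skew_shape_end; case/andP: gw => hs px.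
apply: act_pshape_mem => //; [exact: size_word_letters|exact: word_letters_bound].
Qed.

Section Generator.
Variable s : filling n.
Hypothesis sE : s \in SYT E 0 j.

Lemma count_skew_rows d r : (j + d <= n)%N ->
  count_mem r (rows s j ++ [seq (row_of t i : nat) | i <- iota j.+1 d]) = rowlen (Dk (j + d)) r.
Proof.
elim: d => [_|d IH lt].
  by rewrite cats0 addn0 (shape_upto_start E tD) (count_rows_shape sE jn).
have kb : (j <= j + d < n)%N by rewrite leq_addr /= -addnS.
have [shE nb] := Dk_succ kb.
have -> : iota j.+1 d.+1 = rcons (iota j.+1 d) (j + d).+1.
  by have := iotaD j.+1 d 1; rewrite addn1 [iota (j.+1 + d) 1]/= cats1 addSn.
rewrite map_rcons -rcons_cat -cats1 count_cat IH; last by rewrite ltnW // -addnS.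
by rewrite addnS shE rowlen_set1U //= addn0 addnC.
Qed.

Lemma word_letters_wext : word_letters (wext t n (word_of s j)) =
  rows s j ++ [seq (row_of t i : nat) | i <- iota j.+1 (n - j)].
Proof.
have sz : size (rows s j ++ [seq (row_of t i : nat) | i <- iota j.+1 (n - j)]) = n.
  by rewrite size_cat size_rows size_map size_iota subnKC.
apply: (@eq_from_nth _ 0%N); rewrite size_word_letters ?sz // => k kn.
rewrite (nth_word_letters _ (Ordinal kn)) nth_cat size_rows; case: ltnP => kj.
  by rewrite (@wextE _ _ _ _ _ (Ordinal kn) kj) ffunE nth_rows.
rewrite wext_out // (nth_map 0%N) ?size_iota ?ltn_sub2r ?(leq_ltn_trans kj) //.
by rewrite nth_iota ?ltn_sub2r ?(leq_ltn_trans kj) // addSn subnKC.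
Qed.

Lemma lam_word_wext : lam_word (wext t n (word_of s j)).
Proof.
rewrite /lam_word word_letters_wext; apply/andP; split.
  apply/forallP => r; apply/implyP => _.
  by rewrite count_skew_rows ?subnKC // skew_shape_end.
rewrite all_cat; apply/andP; split; apply/allP => r.
  exact: (yam_mem_gt0 (yam_rows yE sE jn (leqnn j))).
case/mapP=> i; rewrite mem_iota addSn subnKC // ltnS => ib ->.
have [bD _] := box_ofP tD (leqnn n) ib.
have bL : box_of t i \in L by move: bD; rewrite in_setD => /andP[].
by have [] := yL bL.
Qed.

Lemma ptab_projector : ptab q n s j * p j = ptab q n s j.
Proof.
have PP := @pw_projector _ q n _ (JM q n) q_neq0 qint_neq0 (rows s j) (yam_rows yE sE jn (leqnn j)).
rewrite size_rows in PP; rewrite (ptabE q yE jn sE).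
apply: (shape_projector_sub q_neq0 (@Tgen_quad F q n) (@Tgen_far F q n)
  (@Tgen_braid F q n) (JM_1 q n) (@JM_succ F q n) qint_neq0 (PP jn) (skew_projector jn)).
by move=> x /eqP->; rewrite (shape_upto_start E tD); apply: has_shape_rows.
Qed.

End Generator.

Lemma Phi_specht u : u \in specht q j E ->
  supported lam_word (Phi t n u) /\ act (Phi t n u) (p j) = Phi t n u.
Proof.
move=> /coord_span->.
pose Q (v : words F n j) :=
  supported lam_word (Phi t n v) /\ act (Phi t n v) (p j) = Phi t n v.
have Q0 : Q 0.
  by rewrite /Q -(scale0r (0 : words F n j)) PhiZ scale0r; split; [apply: supported0|apply: act0l].
have QL a v w : Q v -> Q w -> Q (a *: v + w).
  move=> [sv pv] [sw pw']; rewrite /Q PhiD PhiZ; split; first exact: supported_lin.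
  by rewrite actDl actZl pv pw'.
apply: (big_ind Q) => // [x y Qx Qy|i _]; first by rewrite -[x]scale1r; apply: QL.
rewrite -[_ *: _]addr0; apply: (QL) => //.
set g := _`_i; have : g \in [seq act (wbase F (word_of s j)) (ptab q j s j) | s <- enum (SYT E 0 j)].
  by apply: mem_nth; apply: (leq_trans (ltn_ord i)); rewrite size_tuple.
case/mapP=> s; rewrite mem_enum => sE ->.
rewrite /Q (phi_compat_ptab q t jn s (leqnn j)) Phi_base; split.
  apply: supported_act; first exact: lam_word_wswap.
  exact/supported_base/lam_word_wext.
by rewrite -actM ptab_projector.
Qed.

Lemma skew_eigenvector u : u \in specht q j E -> act u (R2R q j j) = 0 ->
  let v := act (act (Phi t n u) (pskew q n E j t)) (Cop q n j n) in
  v \in specht q n L /\ act v (R2R q n n) =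
    (q ^+ n * qcontent q D + \sum_(j.+1 <= k < n.+1) q ^+ (n - k) * qint q k) *: v.
Proof.
move=> uE uR; have [sx px] := Phi_specht uE.
set x := Phi t n u in sx px *; set y := act x _ => v.
have comm_pskew z : (forall k, (j <= k <= n)%N -> GRing.comm z (p k)) ->
    GRing.comm z (pskew q n E j t).
  move=> H; rewrite /pskew big_nat_cond; apply: commr_prod => k /andP[/andP[jk kn] _].
  by apply: H; rewrite ltnW.
(* For [k > j] the idempotent [p k] is one of the commuting factors of [pskew]; for [k = j] it
   already fixes the extension of [u]. *)
have y_proj k : (j <= k <= n)%N -> act y (p k) = y.
  move=> /andP[jk kn]; rewrite /y -actM.
  have C : GRing.comm (p k) (pskew q n E j t).
    by apply: comm_pskew => l /andP[_ ln]; apply: skew_projector_comm.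
  case: (ltngtP j k) jk => // [lt|je] _; last by rewrite -C actM -je px.
  suff -> : pskew q n E j t * p k = pskew q n E j t by [].
  have -> : pskew q n E j t = (\prod_(j.+1 <= l < k) p l) * (p k * \prod_(k.+1 <= l < n.+1) p l).
    by rewrite /pskew (@big_cat_nat _ _ _ k) //= ?[X in _ * X]big_ltn // ltnW.
  have C' : GRing.comm (p k) (\prod_(k.+1 <= l < n.+1) p l).
    rewrite big_nat_cond; apply: commr_prod => l /andP[/andP[_ ln] _].
    exact: skew_projector_comm.
  by rewrite -!mulrA -C' (mulrA (p k)) skew_projector_idem.
(* [R2R] at level [j] commutes with every [p k], [k >= j], so it can act first, on the extension of
   [u], which it kills together with [u]. *)
have y_R : act y (R2R q n j) = 0.
  have C : GRing.comm (R2R q n j) (pskew q n E j t).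
    apply: comm_pskew => k kb; apply/commr_sym.
    by have [] := skew_projector_B kb; move=> *; apply: commrM.
  by rewrite /y -actM -C actM -(phi_compat_R2R q t jn) uR -(scale0r (0 : words F n j)) PhiZ scale0r act0l.
have nb : (j <= n <= n)%N by rewrite jn leqnn.
split; last by rewrite /v (Cop_eigen y_proj y_R nb) /eigen sum_contents.
apply: supported_specht; last by apply: Cop_proj.
by do 2!apply: (supported_act _ lam_word_wswap).
Qed.

End SkewProjection.

Theorem theorem5p5 (R : realType) (q : R[i]) (n j : nat) (lam mu : seq nat)
    (kappa : seq (words R[i] n j)) (u : words R[i] n j) (t : filling n) :
  q != 0 ->
  semisimple (hecke q n) ->
  is_partition n lam ->
  is_partition j mu ->
  ydiag n mu \subset ydiag n lam ->
  basis_of (specht q j (ydiag n mu)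
            :&: lker (linfun (@actr _ q n j (R2R q j j))))%VS
           kappa ->
  u \in kappa ->
  t \in SYT (ydiag n lam :\: ydiag n mu) j n ->
  let v : words R[i] n n :=
    act (act (Phi t n u) (pskew q n (ydiag n mu) j t)) (Cop q n j n) in
  v \in specht q n (ydiag n lam) /\
  (v = 0 \/
   v != 0 /\
   act v (R2R q n n) =
     (q ^+ n * qcontent q (ydiag n lam :\: ydiag n mu)
      + \sum_(j.+1 <= k < n.+1) q ^+ (n - k) * qint q k) *: v).
Proof.
move=> q_neq0 ss plam pmu sub kb uk tD v.
have natr_neq0 m : (0 < m)%N -> m%:R != 0 :> R[i] by rewrite lt0n pnatr_eq0.
have qint_neq0 := semisimple_qint_neq0 q_neq0 natr_neq0 ss.
have := basis_mem kb uk; rewrite memv_cap memv_ker lfunE => /andP[uE /eqP uR].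
have yE : young (ydiag n mu) := young_ydiag pmu.
have yL : young (ydiag n lam) := young_ydiag plam.
suff [vS vE] : v \in specht q n (ydiag n lam) /\ act v (R2R q n n) =
     (q ^+ n * qcontent q (ydiag n lam :\: ydiag n mu)
      + \sum_(j.+1 <= k < n.+1) q ^+ (n - k) * qint q k) *: v.
  by split=> //; case: (eqVneq v 0) => [|v0]; [left|right].
case: (leqP j n) => [jn|nj]; first exact: skew_eigenvector.
(* For [n = 0 < j] the module [S^mu] need not vanish. Then the only word is empty, the Specht module
   of [lam] is everything, and both [R2R] and the claimed eigenvalue are 0. *)
case: (posnP n) => [n0|n0].
  move: (n0) => En; clear -En q_neq0 qint_neq0 yL nj.
  have out (x : box n) : (0 < x.1)%N = false by have := ltn_ord x.1; lia.
  split; last first.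
    rewrite big_geq; last by rewrite ltnS ltnW.
    rewrite /qcontent big_pred0 ?mulr0 ?addr0 ?scale0r; last first.
      by move=> x; rewrite !inE !out.
    have -> : R2R q n n = 0 by rewrite /R2R /Bstar big_geq ?mul0r // En.
    exact: act0r.
  rewrite (wbase_sum v); apply: memv_suml => w _; apply: memvZ.
  have -> : wbase R[i] w = act (wv R[i] n [::]) (pw q (JM q n) [::]).
    rewrite /pw big_geq // act1; congr wbase; apply/ffunP => p.
    by exfalso; have := ltn_ord p; lia.
  apply: specht_mem => //; apply/forallP => r; apply/implyP => r0.
  by have := out (r, r); rewrite r0.
have u0 : u = 0.
  apply/eqP; rewrite -memv0; apply: (subvP _ _ uE); apply/span_subvP => x /mapP[s].
  by rewrite mem_enum => sE ->; rewrite memv0 (truncated_generator q_neq0 qint_neq0 pmu n0 nj sE).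
have -> : v = 0.
  by rewrite /v u0 -(scale0r (0 : words R[i] n j)) PhiZ scale0r !act0l.
by rewrite mem0v act0l scaler0.
Qed.
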